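(* Let $T>0$, let $g\in\mathcal G$, and let $(\phi_n)_{n\ge0}$ and $(\tilde\varphi_n)_{n\ge0}$ be the stochastic iterations $$\phi_{n+1}=\phi_n+\eta\,b(\phi_n)+\eta\,V(\phi_n;\gamma_n),\qquad \tilde\varphi_{n+1}=\tilde\varphi_n+\eta\,b(\tilde\varphi_n)+\eta\,\sigma(\tilde\varphi_n)\Delta W_n,$$ started from the same fixed $\phi_0=\tilde\varphi_0\in H$. Assume that $b$ and $\sigma$ have bounded derivatives up to the third order, that $\|Db\|_\infty>0$, and that $$\mathcal D:=\sup_{\phi\in H}\mathbb E\Big(\|\sigma(\phi)(\Delta W)\|^3+\|V(\phi;\gamma)\|^3\Big)<\infty .$$ Then, for each $\bar\eta\ge0$, $$\max_{k=0,\dots,\lfloor T/\eta\rfloor}\left|\mathbb E\big(g(\tilde\varphi_k)-g(\phi_k)\big)\right|\le\eta^2\,\mathcal D\,\mathcal C_{g,b,\sigma}(\bar\eta)\qquad\text{for all }\eta\in(0,\bar\eta],$$ where $$\mathcal C_{g,b,\sigma}(\bar\eta)=\bar A_1(\bar\eta)\frac{e^{T(4\|Db\|_\infty+6\bar\eta J_1^2)}-1}{4\|Db\|_\infty}+\bar A_2(\bar\eta)\frac{e^{T(2\|Db\|_\infty+\bar\eta J_1^2)}-1}{2\|Db\|_\infty}+\bar A_3(\bar\eta)\frac{e^{T(2\|Db\|_\infty+\bar\eta J_1^2)/2}-1}{\|Db\|_\infty}.$$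
   Context: $H$ is a real separable Hilbert space with norm $\|\cdot\|$. $\gamma$ is a $\Gamma$-valued random variable, $\{\mathcal F_\gamma:\gamma\in\Gamma\}$ a family of Fréchet differentiable functionals $H\to\mathbb R$, $\mathcal F=\mathbb E_\gamma\mathcal F_\gamma$ is Fréchet differentiable with $\nabla\mathcal F=\mathbb E_\gamma\nabla\mathcal F_\gamma$, and $\mathbb E_\gamma\|\nabla\mathcal F_\gamma(\phi)\|^2<\infty$ for all $\phi\in H$. Set $b=-\nabla\mathcal F:H\to H$ and $V(\phi;\gamma)=\nabla\mathcal F(\phi)-\nabla\mathcal F_\gamma(\phi)$. The $\gamma_n$ are i.i.d. copies of $\gamma$. $U=L^2(\Gamma)$ (square-integrable real functions of $\gamma$, with inner product $\mathbb E_\gamma[u_1u_2]$, assumed separable), and $\sigma(\phi)\in\mathcal L_2(U,H)$ (Hilbert–Schmidt operators) is given by $\sigma(\phi)u=\mathbb E_\gamma(V(\phi;\gamma)u(\gamma))$; thus $\sigma(\phi)\sigma(\phi)^*$ is the covariance operator of $V(\phi;\gamma)$. $\Delta W_n=\eta^{-1/2}(W_{(n+1)\eta}-W_{n\eta})$ are the normalized increments of a cylindrical Wiener process $W$ on $U$, i.e. $\sigma(\phi)\Delta W_n=\sum_i\xi_{n,i}\,\sigma(\phi)e_i$ with $(e_i)$ an orthonormal basis of $U$ and $\xi_{n,i}$ i.i.d. standard real Gaussians; $\Delta W$ denotes a generic copy. $\mathbb E$ is over all randomness ($\gamma_n$'s and $\Delta W_n$'s). Test class: $\mathcal G=\{g:H\to\mathbb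 R:\ \|D^ig\|_\infty:=\sup_{\phi\in H}\|D^ig(\phi)\|_{\mathcal L^i(H;\mathbb R)}<\infty,\ i=1,2,3\}$, where $D^ig$ is the $i$-th Fréchet derivative and $\mathcal L^i(H;F)$ is the space of continuous $i$-linear maps $H^i\to F$ with the usual norm. Likewise $\|D^ib\|_\infty$ and $\|D^i\sigma\|_\infty$ are the suprema over $H$ of the norms of $D^ib(\phi)\in\mathcal L^i(H;H)$ and $D^i\sigma(\phi)\in\mathcal L^i(H;\mathcal L_2(U,H))$. Constants: $J_i=(\|D^ib\|_\infty^2+\|D^i\sigma\|_\infty^2)^{1/2}$ for $i=1,2,3$; $C_1(\eta)=1+2\eta\|Db\|_\infty+\eta^2J_1^2$; $$\bar A_2(\eta)=\left(\|D^2g\|_\infty+\frac{\|Dg\|_\infty J_2}{\|Db\|_\infty}\right)\frac{J_2\,C_1(\eta)^{1/2}}{2\|Db\|_\infty},$$ $$\bar A_3(\eta)=\frac{1}{2\|Db\|_\infty}\left(\frac{\|Dg\|_\infty J_2^2\,C_1(\eta)^{1/2}}{2\|Db\|_\infty}+\|Dg\|_\infty J_3\right),$$ $$\bar A_1(\eta)=\|D^3g\|_\infty+\bar A_2(\eta)+\bar A_3(\eta).$$ *)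

(* Defs.v *)
From HB Require Import structures.
From mathcomp Require Export all_boot all_order all_algebra.
From mathcomp Require Export all_classical all_reals all_analysis.
From mathcomp Require Import ring lra.
Set Implicit Arguments.
Unset Strict Implicit.
Unset Printing Implicit Defensive.
Export Order.TTheory GRing.Theory Num.Theory.
Export numFieldNormedType.Exports.

Local Open Scope classical_set_scope.
Local Open Scope ring_scope.

HB.mixin Record CompleteNormedModule_isHilbert (R : realType) H
    & CompleteNormedModule R H := {
  dot : H -> H -> R ;
  dotC : forall x y, dot x y = dot y x ;
  dotDl : forall x y z, dot (x + y) z = dot x z + dot y z ;
  dotZl : forall a x y, dot (a *: x) y = a * dot x y ;
  dotxx : forall x, dot x x = `|x| ^+ 2
}.

#[short(type="hilbertType")]
HB.structure Definition Hilbert (R : realType) :=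
  {H of CompleteNormedModule R H & CompleteNormedModule_isHilbert R H}.

Definition separable_space (T : topologicalType) : Prop :=
  exists2 D : set T, countable D & dense D.

Definition borel (T : ptopologicalType) : Type := g_sigma_algebraType (@open T).
HB.instance Definition _ (T : ptopologicalType) := Measurable.on (borel T).

(* The type {blin V -> W} of bounded linear maps with the operator norm.
   {blin V -> {blin V -> W}} and {blin V -> {blin V -> {blin V -> W}}} are the
   spaces of continuous bi- and trilinear maps in curried form; the iterated
   operator norm is the usual norm of a multilinear map. *)
Section BoundedLinear.
Context {R : realType} {V W : normedModType R}.

Definition is_blin : {pred V -> W} :=
  fun f => `[< linear f /\ continuous f >].

Record blin := Blin { blin_val :> V -> W ; blin_valP : blin_val \in is_blin }.

HB.instance Definition _ := [isSub for blin_val].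
HB.instance Definition _ := [Choice of blin by <:].

Fact is_blin_submod : submod_closed is_blin.
Proof.
split.
  apply/asboolP; split; last exact: cst_continuous.
  by move=> a x y; rewrite -[0]/(cst 0) /= scaler0 addr0.
move=> a f g /asboolP[lf cf] /asboolP[lg cg]; apply/asboolP; split.
  move=> k x y; change (a *: f (k *: x + y) + g (k *: x + y) =
    k *: (a *: f x + g x) + (a *: f y + g y)).
  by rewrite lf lg !scalerDr !scalerA (mulrC a) addrACA.
by move=> x; apply: cvgD; [apply: cvgZr; exact: cf|exact: cg].
Qed.

HB.instance Definition _ := GRing.isSubmodClosed.Build R (V -> W) is_blin
  is_blin_submod.
HB.instance Definition _ := [SubChoice_isSubLmodule of blin by <:].

Lemma blin_linear (f : blin) : linear f.
Proof. by have /asboolP[] := blin_valP f. Qed.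

Lemma blin_continuous (f : blin) : continuous f.
Proof. by have /asboolP[] := blin_valP f. Qed.

HB.instance Definition _ (f : blin) :=
  GRing.isLinear.Build R V W _ (blin_val f) (blin_linear f).

Definition opnorm (f : blin) : R :=
  sup [set `|f x| | x in [set x | `|x| <= 1]].

Fact opnorm_has_sup (f : blin) : has_sup [set `|f x| | x in [set x | `|x| <= 1]].
Proof.
split; first by exists `|f 0|, 0 => //=; rewrite normr0.
have /linear_boundedP : bounded_near f (nbhs (0 : V)).
  exact/linear_bounded_continuous/blin_continuous.
move=> /pinfty_ex_gt0[M M0 fM]; exists M => _ [x /= x1 <-].
by rewrite (le_trans (fM x))// ler_piMr// ltW.
Qed.

Lemma opnorm_ub (f : blin) x : `|f x| <= opnorm f * `|x|.
Proof.
have [->|x0] := eqVneq x 0; first by rewrite linear0 !normr0 mulr0.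
have nx0 : 0 < `|x| by rewrite normr_gt0.
rewrite -ler_pdivrMr// mulrC -[X in X * _]gtr0_norm ?invr_gt0// -normrZ -linearZ.
apply: sup_upper_bound; first exact: opnorm_has_sup.
exists (`|x|^-1 *: x) => //=.
by rewrite normrZ gtr0_norm ?invr_gt0// mulVf// gt_eqF.
Qed.

Lemma opnorm_ge0 (f : blin) : 0 <= opnorm f.
Proof.
apply: (le_trans (normr_ge0 (f 0))).
apply: sup_upper_bound; first exact: opnorm_has_sup.
by exists 0 => //=; rewrite normr0.
Qed.

Lemma opnorm_le (f : blin) (M : R) :
  (forall x, `|x| <= 1 -> `|f x| <= M) -> opnorm f <= M.
Proof.
move=> fM; apply: ge_sup; first by have [] := opnorm_has_sup f.
by move=> _ [x /= x1 <-]; exact: fM.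
Qed.

Fact opnormD (f g : blin) : opnorm (f + g) <= opnorm f + opnorm g.
Proof.
apply: opnorm_le => x x1; rewrite (le_trans (ler_normD _ _))//.
by rewrite lerD// (le_trans (opnorm_ub _ _))// ler_piMr// opnorm_ge0.
Qed.

Fact opnormZ (a : R) (f : blin) : opnorm (a *: f) = `|a| * opnorm f.
Proof.
have key (c : R) (h : blin) : opnorm (c *: h) <= `|c| * opnorm h.
  apply: opnorm_le => x x1; rewrite -[(c *: h) x]/(c *: h x) normrZ ler_wpM2l//.
  by rewrite (le_trans (opnorm_ub _ _))// ler_piMr// opnorm_ge0.
apply/eqP; rewrite eq_le key/=.
have [->|a0] := eqVneq a 0; first by rewrite normr0 mul0r opnorm_ge0.
have na0 : 0 < `|a| by rewrite normr_gt0.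
rewrite -ler_pdivlMl//; have := key a^-1 (a *: f).
by rewrite scalerA mulVf// scale1r normfV.
Qed.

Fact opnorm0_eq0 (f : blin) : opnorm f = 0 -> f = 0.
Proof.
move=> f0; apply/val_inj/funext => x; apply/normr0_eq0/eqP.
by rewrite eq_le normr_ge0 andbT (le_trans (opnorm_ub _ _))// f0 mul0r.
Qed.

HB.instance Definition _ :=
  Lmodule_isNormed.Build R blin opnormD opnormZ opnorm0_eq0.

End BoundedLinear.
Arguments blin {R} V W.
Notation "{ 'blin' V -> W }" := (blin V W)
  (at level 0, V at level 98, W at level 99, format "{ 'blin'  V  ->  W }").

Section FrechetDerivatives.
Context {R : realType} {V W : normedModType R}.
Implicit Type f : V -> W.

(* 0 where the library's differential is not a bounded linear map *)
Definition frechet f (x : V) : {blin V -> W} := insubd 0 ('d f x : V -> W).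

Lemma frechetE f x : differentiable f x -> frechet f x = 'd f x :> (V -> W).
Proof.
move=> dfx; apply: insubdK; apply/asboolP; split; last exact: diff_continuous.
exact: linearP.
Qed.

Definition supnorm f : \bar R := ereal_sup (range (fun x => `|f x|%:E)).

End FrechetDerivatives.

Section BoundedDerivatives.
Context {R : realType} {V W : normedModType R}.
Implicit Type f : V -> W.

Definition supD1 f : \bar R := supnorm (frechet f).
Definition supD2 f : \bar R := supnorm (frechet (frechet f)).
Definition supD3 f : \bar R := supnorm (frechet (frechet (frechet f))).

Definition bounded_derivatives3 f : Prop :=
  [/\ forall x, differentiable f x,
      forall x, differentiable (frechet f) x,
      forall x, differentiable (frechet (frechet f)) x
    & [/\ (supD1 f < +oo)%E, (supD2 f < +oo)%E & (supD3 f < +oo)%E]].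

End BoundedDerivatives.

Definition is_gradient (R : realType) (H : hilbertType R) (f : H -> R)
    (x v : H) : Prop :=
  differentiable f x /\ forall h, 'd f x h = dot v h.

(* L^2(mu), as functions rather than as almost-everywhere classes: l2norm is a
   seminorm, and maps out of L^2 are required to be bounded for it, so that they
   do not distinguish almost everywhere equal functions. *)
Section L2.
Context d (T : measurableType d) (R : realType) (mu : probability T R).

Definition L2 : Type := LfunType mu (lee1n 2).
HB.instance Definition _ := GRing.Lmodule.on L2.
Definition L2_fun (u : L2) : T -> R := (u : LfunType mu (lee1n 2)).
Coercion L2_fun : L2 >-> Funclass.

Definition l2dot (u v : L2) : R := (\int[mu]_x (u x * v x))%R.
Definition l2norm (u : L2) : R := Num.sqrt (l2dot u u).

(* A countable orthonormal basis (l2vec i)_{i in l2idx}; the index set is a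
   subset of nat so that finite-dimensional L^2 is allowed. *)
Record l2basis := L2Basis {
  l2idx : pred nat ;
  l2vec : nat -> L2 ;
  l2basis_orthonormal : forall i j, l2idx i -> l2idx j ->
    l2dot (l2vec i) (l2vec j) = (i == j)%:R ;
  l2basis_total : forall u : L2,
    (fun N => l2norm (u - \sum_(i < N | l2idx i) l2dot u (l2vec i) *: l2vec i))
      @ \oo --> (0 : R) }.

End L2.

(* The type {hs e -> H} of Hilbert-Schmidt operators from L^2(mu) to H, with the
   Hilbert-Schmidt norm (which does not depend on the orthonormal basis e). *)
Section HilbertSchmidt.
Context d (T : measurableType d) (R : realType) (mu : probability T R)
  (e : l2basis mu) (H : hilbertType R).

Definition hs_sum (A : L2 mu -> H) : \bar R :=
  (\sum_(i <oo | l2idx e i) (`|A (l2vec e i)| ^+ 2)%:E)%E.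

Definition is_hs : {pred L2 mu -> H} := fun A =>
  `[< [/\ linear A, (exists C : R, forall u, `|A u| <= C * l2norm u)
        & (hs_sum A < +oo)%E] >].

Record hs := Hs { hs_val :> L2 mu -> H ; hs_valP : hs_val \in is_hs }.

HB.instance Definition _ := [isSub for hs_val].
HB.instance Definition _ := [Choice of hs by <:].

Lemma hs_sum_ge0 A : (0 <= hs_sum A)%E.
Proof. by apply: nneseries_ge0 => i _ _; rewrite lee_fin sqr_ge0. Qed.

Lemma hs_sumD (A B : L2 mu -> H) (t : R) : 0 < t ->
  (hs_sum (A + B)%R <= (1 + t)%:E * hs_sum A + (1 + t^-1)%:E * hs_sum B)%E.
Proof.
move=> t0; rewrite /hs_sum.
have tV0 : 0 < t^-1 by rewrite invr_gt0.
rewrite -!nneseriesZl; [|by move=> i _; rewrite lee_fin sqr_ge0..].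
rewrite -nneseriesD; [|by move=> i _ _; rewrite -EFinM lee_fin mulr_ge0 ?sqr_ge0//
  addr_ge0// ltW..].
apply: lee_nneseries => i; first by move=> _ _; rewrite lee_fin sqr_ge0.
move=> _; rewrite -!EFinM -EFinD lee_fin.
set a := A _; set b := B _; rewrite -[(A + B) _]/(a + b).
rewrite (@le_trans _ _ ((`|a| + `|b|) ^+ 2))//.
  by rewrite ler_pXn2r ?nnegrE ?addr_ge0 ?ler_normD.
move: (normr_ge0 a) (normr_ge0 b); move: `|a| `|b| => {}a {}b a0 b0.
rewrite -subr_ge0.
have -> : (1 + t) * a ^+ 2 + (1 + t^-1) * b ^+ 2 - (a + b) ^+ 2 =
    t^-1 * (t * a - b) ^+ 2.
  by field; rewrite gt_eqF.
by rewrite mulr_ge0 ?invr_ge0 ?sqr_ge0// ltW.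
Qed.

Lemma hs_sumZ (a : R) (A : L2 mu -> H) :
  hs_sum (a *: A)%R = ((a ^+ 2)%:E * hs_sum A)%E.
Proof.
rewrite /hs_sum -nneseriesZl; last by move=> i _; rewrite lee_fin sqr_ge0.
apply: eq_eseriesr => i _; rewrite -EFinM; congr EFin.
by rewrite -[(a *: A) _]/(a *: A _) normrZ exprMn real_normK// num_real.
Qed.

Fact is_hs_submod : submod_closed is_hs.
Proof.
split.
  apply/asboolP; split; first by move=> a x y; rewrite -[0]/(cst 0) /= scaler0 addr0.
    by exists 0 => u; rewrite -[0 u]/(0 : H) normr0 mul0r.
  rewrite /hs_sum eseries0 ?ltry// => i _ _.
  by rewrite -[0 _]/(0 : H) normr0 expr0n.
move=> a A B /asboolP[lA [C AC] sA] /asboolP[lB [D BD] sB]; apply/asboolP; split.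
- move=> k x y; change (a *: A (k *: x + y) + B (k *: x + y) =
    k *: (a *: A x + B x) + (a *: A y + B y)).
  by rewrite lA lB !scalerDr !scalerA (mulrC a) addrACA.
- exists (`|a| * C + D) => u; rewrite -[(a *: A + B) u]/(a *: A u + B u).
  by rewrite (le_trans (ler_normD _ _))// mulrDl lerD// normrZ -mulrA ler_wpM2l.
- rewrite (le_lt_trans (hs_sumD _ _ ltr01))// hs_sumZ.
  by rewrite lte_add_pinfty// !lte_mul_pinfty ?lee_fin ?mule_ge0 ?lee_fin ?sqr_ge0
    ?hs_sum_ge0 ?addr_ge0 ?invr_ge0.
Qed.

HB.instance Definition _ := GRing.isSubmodClosed.Build R (L2 mu -> H) is_hs
  is_hs_submod.
HB.instance Definition _ := [SubChoice_isSubLmodule of hs by <:].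

Lemma hs_linear (A : hs) : linear A.
Proof. by have /asboolP[] := hs_valP A. Qed.

Lemma hs_bounded (A : hs) : exists C : R, forall u, `|A u| <= C * l2norm u.
Proof. by have /asboolP[] := hs_valP A. Qed.

Lemma hs_sum_fin_num (A : hs) : hs_sum A \is a fin_num.
Proof. by have /asboolP[] := hs_valP A; rewrite ge0_fin_numE ?hs_sum_ge0. Qed.

HB.instance Definition _ (A : hs) :=
  GRing.isLinear.Build R (L2 mu) H _ (hs_val A) (hs_linear A).

Definition hsnorm (A : hs) : R := Num.sqrt (fine (hs_sum A)).

Lemma hsnorm_sqr (A : hs) : (hsnorm A ^+ 2)%:E = hs_sum A.
Proof. by rewrite sqr_sqrtr ?fine_ge0 ?hs_sum_ge0// fineK ?hs_sum_fin_num. Qed.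

Fact hsnorm0_eq0 (A : hs) : hsnorm A = 0 -> A = 0.
Proof.
move=> A0; have sA0 : hs_sum A = 0%E by rewrite -hsnorm_sqr A0 expr0n.
have Ae i : l2idx e i -> A (l2vec e i) = 0.
  move=> ei; apply/normr0_eq0/eqP.
  suff : `|A (l2vec e i)| ^+ 2 == 0 by rewrite expf_eq0.
  rewrite eq_le sqr_ge0 andbT -lee_fin -[leRHS]/(0%E : \bar R) -sA0 /hs_sum.
  rewrite (@nneseriesD1 _ _ i)//.
  by apply: leeDl; apply: nneseries_ge0 => j _ _; rewrite lee_fin sqr_ge0.
apply/val_inj/funext => u; change (A u = 0).
have [C AC] := hs_bounded A.
apply/normr0_eq0/eqP; rewrite eq_le normr_ge0 andbT.
have cvgC : (fun N => C * l2norm (u - \sum_(i < N | l2idx e i)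
    l2dot u (l2vec e i) *: l2vec e i)) @ \oo --> (0 : R).
  by rewrite -(mulr0 C); apply: cvgMr; exact: l2basis_total.
rewrite -(cvg_lim (@Rhausdorff R) cvgC); apply: limr_ge.
  by apply/cvg_ex; exists 0.
apply: nearW => N; apply: le_trans (AC _).
rewrite linearB linear_sum big1 ?subr0// => i ei.
by rewrite linearZ/= Ae// scaler0.
Qed.

Fact hsnormD (A B : hs) : hsnorm (A + B) <= hsnorm A + hsnorm B.
Proof.
have [/hsnorm0_eq0 ->|A0] := eqVneq (hsnorm A) 0.
  by rewrite add0r lerDr sqrtr_ge0.
have [/hsnorm0_eq0 ->|B0] := eqVneq (hsnorm B) 0.
  by rewrite addr0 lerDl sqrtr_ge0.
have {A0} A0 : 0 < hsnorm A by rewrite lt_def A0 sqrtr_ge0.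
have {B0} B0 : 0 < hsnorm B by rewrite lt_def B0 sqrtr_ge0.
rewrite -(@ler_pXn2r _ 2)// ?nnegrE ?addr_ge0 ?sqrtr_ge0// -lee_fin hsnorm_sqr.
have t0 : 0 < hsnorm B / hsnorm A by rewrite divr_gt0.
rewrite (le_trans (hs_sumD _ _ t0))// -!hsnorm_sqr -!EFinM -EFinD lee_fin.
move: A0 B0; move: (hsnorm A) (hsnorm B) => x y x0 y0.
rewrite le_eqVlt; apply/orP; left; apply/eqP; field.
by rewrite !gt_eqF.
Qed.

Fact hsnormZ (a : R) (A : hs) : hsnorm (a *: A) = `|a| * hsnorm A.
Proof.
rewrite /hsnorm (_ : hs_sum _ = ((a ^+ 2)%:E * hs_sum A)%E); last exact: hs_sumZ.
by rewrite fineM ?hs_sum_fin_num//= sqrtrM ?sqr_ge0// sqrtr_sqr.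
Qed.

HB.instance Definition _ := Lmodule_isNormed.Build R hs hsnormD hsnormZ hsnorm0_eq0.

End HilbertSchmidt.
Notation "{ 'hs' e -> H }" := (hs e H)
  (at level 0, e at level 98, H at level 99, format "{ 'hs'  e  ->  H }").

Section Probability.
Context d (T : measurableType d) (R : realType) (mu : probability T R).

(* m is the Bochner integral of f: simple functions sum_j 1_(A_j) h_j converge
   to f in L^1(mu; H) and their integrals sum_j mu(A_j) h_j converge to m. *)
Definition bochner_mean (H : hilbertType R) (f : T -> H) (m : H) : Prop :=
  measurable_fun setT (f : T -> borel H) /\
  exists s : nat -> seq (set T * H),
    [/\ forall n p, p \in s n -> measurable p.1,
        (fun n => \int[mu]_x
           (`|f x - \sum_(p <- s n) (\1_(p.1) x : R) *: p.2|)%:E)%E @ \oo --> 0%E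
      & (fun n => \sum_(p <- s n) fine (mu p.1) *: p.2) @ \oo --> m].

Definition mutually_independent (I : eqType) d' (S : measurableType d')
    (J : {pred I}) (X : I -> {RV mu >-> S}) : Prop :=
  forall (s : seq I) (A : I -> set S), uniq s -> {subset s <= J} ->
    (forall i, measurable (A i)) ->
    mu (\bigcap_(i in [set` s]) (X i @^-1` A i)) =
    (\prod_(i <- s) mu (X i @^-1` A i))%E.

Definition iid (I : eqType) d' (S : measurableType d') (J : {pred I})
    (X : I -> {RV mu >-> S}) (nu : set S -> \bar R) : Prop :=
  mutually_independent J X /\
  forall i, i \in J -> forall A, measurable A -> distribution mu (X i) A = nu A.

End Probability.

Section Iterations.
Context d (Omega : measurableType d) (R : realType) (P : probability Omega R)
  dG (Gamma : measurableType dG) (mu : probability Gamma R) (e : l2basis mu)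
  (H : hilbertType R).

(* S = A (Delta W) = sum_i xi_i A e_i, the series converging in L^2(P; H), for a
   possibly random Hilbert-Schmidt operator A. *)
Definition is_noise (xi : nat -> Omega -> R) (A : Omega -> {hs e -> H})
    (S : Omega -> H) : Prop :=
  measurable_fun setT (S : Omega -> borel H) /\
  (fun N => \int[P]_w
     (`|S w - \sum_(i < N | l2idx e i) xi i w *: A w (l2vec e i)| ^+ 2)%:E)%E
    @ \oo --> 0%E.

Definition sgd_iterates (eta : R) (b : H -> H) (V : H -> Gamma -> H)
    (gam : nat -> Omega -> Gamma) (phi0 : H) (phi : nat -> Omega -> H) : Prop :=
  (forall w, phi 0 w = phi0) /\
  forall n w,
    phi n.+1 w = phi n w + eta *: b (phi n w) + eta *: V (phi n w) (gam n w).

Definition gaussian_iterates (eta : R) (b : H -> H) (sigma : H -> {hs e -> H})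
    (xi : nat -> nat -> Omega -> R) (phi0 : H) (phi : nat -> Omega -> H) : Prop :=
  (forall w, phi 0 w = phi0) /\
  forall n, exists2 S : Omega -> H,
    is_noise (xi n) (fun w => sigma (phi n w)) S &
    forall w, phi n.+1 w = phi n w + eta *: b (phi n w) + eta *: S w.

Definition third_moment (sigmaW : H -> Omega -> H) (V : H -> Gamma -> H)
    (gam : Omega -> Gamma) : \bar R :=
  ereal_sup (range (fun phi : H =>
    \int[P]_w (`|sigmaW phi w| ^+ 3 + `|V phi (gam w)| ^+ 3)%:E)%E).

End Iterations.

Section Constants.
Context dG (Gamma : measurableType dG) (R : realType) (mu : probability Gamma R)
  (e : l2basis mu) (H : hilbertType R).
Context (g : H -> R) (b : H -> H) (sigma : H -> {hs e -> H}).

Let Dg := fine (supD1 g).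
Let D2g := fine (supD2 g).
Let D3g := fine (supD3 g).
Let Db := fine (supD1 b).

Definition J1 : R := Num.sqrt (fine (supD1 b) ^+ 2 + fine (supD1 sigma) ^+ 2).
Definition J2 : R := Num.sqrt (fine (supD2 b) ^+ 2 + fine (supD2 sigma) ^+ 2).
Definition J3 : R := Num.sqrt (fine (supD3 b) ^+ 2 + fine (supD3 sigma) ^+ 2).

Definition C1 (eta : R) : R := 1 + 2 * eta * Db + eta ^+ 2 * J1 ^+ 2.

Definition A2 (eta : R) : R :=
  (D2g + Dg * J2 / Db) * (J2 * Num.sqrt (C1 eta) / (2 * Db)).

Definition A3 (eta : R) : R :=
  (2 * Db)^-1 * (Dg * J2 ^+ 2 * Num.sqrt (C1 eta) / (2 * Db) + Dg * J3).

Definition A1 (eta : R) : R := D3g + A2 eta + A3 eta.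

Definition Cgbsigma (T eta : R) : R :=
  A1 eta * ((expR (T * (4 * Db + 6 * eta * J1 ^+ 2)) - 1) / (4 * Db))
  + A2 eta * ((expR (T * (2 * Db + eta * J1 ^+ 2)) - 1) / (2 * Db))
  + A3 eta * ((expR (T * (2 * Db + eta * J1 ^+ 2) / 2) - 1) / Db).

End Constants.

(* Main.v *)
Require Import Defs.
From HB Require Import structures.
From mathcomp Require Import ring lra measurable_realfun.

(* The Gaussian chain is first driven by only N coordinates of the noise. Let P be the resulting
   Markov operator, P u (x) = E u(x + eta b(x) + eta sum_(i < N) xi_i sigma(x) e_i). The
   derivatives of P^n g up to order three (the third one read as a Lipschitz constant of the
   second) obey a linear recursion: in one step the k-th derivative grows at most by the k-th
   moment of the linearised step, plus lower order terms with factors J_2 and J_3. With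
   A P^n g the expectation of P^n g after one SGD step, a Taylor expansion to second order
   gives |A P^n g - P^(n+1) g| <= eta^3 |D^3 P^n g| D / 6 up to the truncation, since
   sigma Delta W and V both have mean zero and covariance sigma sigma^*: expanding V in the
   basis e of L^2(mu), for any bounded bilinear Q the expectations of Q(V, V) and
   Q(sigma Delta W, sigma Delta W) are both the sum of Q(sigma e_i, sigma e_i). The errors
   telescope along the SGD chain, and the geometric sum of the derivative bounds gives the
   constant. Finally N tends to infinity: the truncated chains converge in L^2 to the given
   Gaussian iterates. *)

(** The full noise at x is only an L^2 limit, defined up to a null set depending on x, so it has no
    pathwise derivative in x. With N coordinates every step is, for each outcome, a smooth map of x
    whose Lipschitz constants have a fourth moment, and derivatives pass under the expectation.
    These pathwise constants grow with N, so they may enter only qualitatively. Two kinds of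
    constants are therefore kept apart: crude ones, which make quadratic remainders integrable, and
    sharp ones, uniform in N, which are iterated. Cutting a segment into many pieces removes the
    crude one wherever a Lipschitz constant is wanted; hence the third derivative is read as such a
    constant, and no third derivative of a composition or an expectation has to exist. The exponent
    4 |Db| + 6 eta J_1^2 comes from the third moment of the linearised step, bounded through the
    fourth moment ((1 + eta |Db|)^2 + 3 (eta |Dsigma|)^2)^2. The given Gaussian iterates are only
    almost surely functions of the noise, so on the Gaussian side independence is used for the
    truncated chains alone. *)

Set Implicit Arguments.
Unset Strict Implicit.
Unset Printing Implicit Defensive.

Local Open Scope classical_set_scope.
Local Open Scope ring_scope.

(** * Functions with a Lipschitz second derivative *)

(** Derivatives are plain functions tied to [f] by quadratic remainders, so that the class is
    visibly stable under sums, compositions and expectations: each field is a linear identity or an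
    inequality. The single [C] is crude on purpose; sharp constants are carried separately. *)
Record C21 (R : realType) (V W : normedModType R) (f : V -> W) (f1 : V -> V -> W)
    (f2 : V -> V -> V -> W) (C : R) : Prop := {
  C21_lin1 : forall x a h k, f1 x (a *: h + k) = a *: f1 x h + f1 x k ;
  C21_lin2l : forall x a h k l, f2 x (a *: h + k) l = a *: f2 x h l + f2 x k l ;
  C21_lin2r : forall x a h k l, f2 x l (a *: h + k) = a *: f2 x l h + f2 x l k ;
  C21_bd1 : forall x h, `|f1 x h| <= C * `|h| ;
  C21_bd2 : forall x h k, `|f2 x h k| <= C * `|h| * `|k| ;
  C21_lip0 : forall x h, `|f (x + h) - f x| <= C * `|h| ;
  C21_lip1 : forall x h k, `|f1 (x + h) k - f1 x k| <= C * `|h| * `|k| ;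
  C21_lip2 : forall x h k l,
    `|f2 (x + h) k l - f2 x k l| <= C * `|h| * `|k| * `|l| ;
  C21_quad0 : forall x h, `|f (x + h) - f x - f1 x h| <= C * `|h| ^+ 2 ;
  C21_quad1 : forall x h k,
    `|f1 (x + h) k - f1 x k - f2 x h k| <= C * `|h| ^+ 2 * `|k| }.

(** * Mean value inequality and Lipschitz constants *)

Section Lipschitz.
Context {R : realType}.

(** Continuous induction: the supremum of the t in [0, 1] with [D t <= D 0] belongs to this set by
    the comparison on its left, and equals 1 by the comparison on its right. The hypothesis compares
    [D] only with its value at t, as a derivative estimate does. *)
Lemma locally_nonincreasing (D : R -> R) :
  (forall t, 0 <= t <= 1 -> exists2 d : R, 0 < d &
    forall s, `|s - t| < d -> (s <= t -> D t <= D s) /\ (t <= s -> D s <= D t)) ->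
  D 1 <= D 0.
Proof.
move=> Dloc.
pose S := [set t | [/\ 0 <= t, t <= 1 & D t <= D 0]].
have S0 : S 0 by split => //; exact: ler01.
have hS : has_sup S by split; [exists 0 | exists 1 => t []].
have S1 : ubound S 1 by move=> t [].
have c0 : 0 <= sup S by exact: (sup_upper_bound hS).
have c1 : sup S <= 1 by apply: ge_sup => //; exists 0.
have [d d0 dP] := Dloc (sup S) (introT andP (conj c0 c1)).
have [s Ss sS] := sup_adherent d0 hS.
have sc : s <= sup S by exact: (sup_upper_bound hS).
have Dc : D (sup S) <= D 0.
  have [_ _ Ds] := Ss; apply: le_trans Ds.
  have /dP[+ _] : `|s - sup S| < d.
    by rewrite ler0_norm ?subr_le0// opprB ltrBlDr -ltrBlDl.
  exact.
have [e|ne] := eqVneq (sup S) 1; first by rewrite -e.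
have lt1 : sup S < 1 by rewrite lt_neqAle ne.
pose m := Num.min (d / 2) (1 - sup S).
have m0 : 0 < m by rewrite lt_min divr_gt0//= subr_gt0.
have : S (sup S + m).
  split; first by rewrite addr_ge0// ltW.
    by rewrite -lerBrDl ge_min lexx orbT.
  apply: le_trans Dc.
  have /dP[_] : `|sup S + m - sup S| < d.
    rewrite addrAC subrr add0r gtr0_norm//.
    by rewrite (@le_lt_trans _ _ (d / 2)) ?ge_min ?lexx// ltr_pdivrMr// ltr_pMr// ltrDl.
  by apply; rewrite lerDl ltW.
by move=> /(sup_upper_bound hS); rewrite gerDl leNgt m0.
Qed.

Context {V W : normedModType R}.

Lemma differentiable_eps (f : V -> W) (y : V) (eps : R) :
  differentiable f y -> 0 < eps ->
  exists2 d : R, 0 < d & forall k, `|k| < d ->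
    `|f (y + k) - f y - 'd f y k| <= eps * `|k|.
Proof.
move=> /diff_locally/eqaddoP dy e0.
have /nbhs_ballP[d /= d0 dP] := dy _ e0.
exists d => // k kd.
have := dP k; rewrite -ball_normE /ball_/= sub0r normrN => /(_ kd).
by rewrite -[X in `|X| <= _]/(f (k + y) - (f y + 'd f y k)) (addrC k) opprD addrA.
Qed.

(** The norm need not be differentiable, so the estimate is a monotonicity statement: t |-> |f (x +
    t h) - f x| - (M + e) t is locally nonincreasing for every e > 0, by the triangle inequality
    through the value at t. *)
Lemma mean_value_ineq (f : V -> W) (M : R) (x h : V) :
  (forall y, differentiable f y) ->
  (forall t, 0 <= t <= 1 -> `|'d f (x + t *: h) h| <= M) ->
  `|f (x + h) - f x| <= M.
Proof.
move=> fd fM.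
apply/ler_addgt0Pr => e e0.
pose D t := `|f (x + t *: h) - f x| - (M + e) * t.
suff : D 1 <= D 0.
  by rewrite /D scale1r scale0r addr0 subrr normr0 mulr1 mulr0 subr0 subr_le0.
apply: locally_nonincreasing => t t01.
set y := x + t *: h.
(* 1 + |h| replaces |h| so that h = 0 needs no separate case. *)
have h0 : 0 < 1 + `|h| by rewrite ltr_pwDl.
have [d d0 dP] := differentiable_eps (fd y) (divr_gt0 e0 h0).
have key s : `|s - t| < d / (1 + `|h|) ->
    `|f (x + s *: h) - f y| <= (M + e) * `|s - t|.
  move=> st; have -> : x + s *: h = y + (s - t) *: h.
    by rewrite /y -addrA -scalerDl addrCA subrr addr0.
  have /dP : `|(s - t) *: h| < d.
    rewrite normrZ; apply: le_lt_trans (_ : `|s - t| * (1 + `|h|) < _).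
      by rewrite ler_wpM2l// lerDr.
    by rewrite -ltr_pdivlMr.
  set a := f (y + _) - f y => aP.
  rewrite -(subrK ('d f y ((s - t) *: h)) a) (le_trans (ler_normD _ _))//.
  rewrite mulrDl [M * _ + _]addrC lerD//; last first.
    by rewrite linearZ/= normrZ mulrC ler_wpM2r//; exact: fM.
  rewrite (le_trans aP)// normrZ mulrCA [leRHS]mulrC ler_wpM2l//.
  by rewrite mulrAC ler_pdivrMr// (ler_wpM2l (ltW e0))// lerDr.
exists (d / (1 + `|h|)); first by rewrite divr_gt0.
move=> s /key sP; rewrite /D; split=> st.
- have tri : `|f y - f x| <= `|f (x + s *: h) - f x| + `|f (x + s *: h) - f y|.
    rewrite -[in leLHS](subrKA (f (x + s *: h))) addrC (le_trans (ler_normD _ _))//.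
    by rewrite [`|f y - _|]distrC.
  move: sP; rewrite ler0_norm ?subr_le0// -/y => sP; lra.
- have tri : `|f (x + s *: h) - f x| <= `|f (x + s *: h) - f y| + `|f y - f x|.
    by rewrite -[in leLHS](subrKA (f y)) ler_normD.
  move: sP; rewrite ger0_norm ?subr_ge0// -/y => sP; lra.
Qed.

(* Cutting the segment [x, x + h] into n pieces turns the quadratic error into
   [C * |h|^2 / n]. *)
Lemma lipschitz_of_quadratic (f : V -> W) (A C : R) :
  (forall x h, `|f (x + h) - f x| <= A * `|h| + C * `|h| ^+ 2) ->
  forall x h, `|f (x + h) - f x| <= A * `|h|.
Proof.
move=> fAC x h; apply/ler_addgt0Pr => e e0.
pose n := (Num.truncn (`|C| * `|h| ^+ 2 / e)).+1.
have n0 : 0 < n%:R :> R by rewrite ltr0n.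
have nC : C * `|h| ^+ 2 / n%:R <= e.
  rewrite ler_pdivrMr// -ler_pdivrMl// mulrC.
  apply: (@le_trans _ _ (`|C| * `|h| ^+ 2 / e)).
    by rewrite ler_wpM2r ?invr_ge0 ?(ltW e0)// ler_wpM2r ?exprn_ge0// ler_norm.
  by rewrite ltW// /n truncnS_gt.
pose k := n%:R^-1 *: h.
have nk : `|k| = `|h| / n%:R by rewrite normrZ gtr0_norm ?invr_gt0// mulrC.
have step m : `|f (x + m%:R *: k) - f x| <= m%:R * (A * `|k| + C * `|k| ^+ 2).
  elim: m => [|m ih]; first by rewrite scale0r addr0 subrr normr0 mul0r.
  rewrite -[in leLHS](subrKA (f (x + m%:R *: k))).
  rewrite (le_trans (ler_normD _ _))// -natr1 mulrDl mul1r addrC lerD//.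
  by rewrite scalerDl scale1r addrA.
have := step n; rewrite /k scalerA divff ?gt_eqF// scale1r => /le_trans; apply.
rewrite -/k nk; move: nC; rewrite expr_div_n.
rewrite [_ * (_ + _)](_ : _ = A * `|h| + C * `|h| ^+ 2 / n%:R); last first.
  by field; rewrite gt_eqF.
by move=> ?; rewrite lerD2l.
Qed.
End Lipschitz.

(** * From Fréchet derivatives to quadratic remainders *)

Section FrechetC21.
Context {R : realType} {V W : normedModType R}.

Lemma supnorm_ub (U : normedModType R) (f : V -> U) x : (supnorm f < +oo)%E ->
  `|f x| <= fine (supnorm f).
Proof.
move=> foo; have : (`|f x|%:E <= supnorm f)%E by apply: ereal_sup_ubound; exists x.
by move: foo; case: (supnorm f) => //= r _.
Qed.

Lemma frechet_lip (U : normedModType R) (f : V -> U) (M : R) :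
  (forall x, differentiable f x) -> (forall x, `|frechet f x| <= M) ->
  forall x h, `|f (x + h) - f x| <= M * `|h|.
Proof.
move=> fd fM x h; apply: mean_value_ineq => // t _.
rewrite -frechetE//; apply: le_trans (opnorm_ub _ _) _.
by rewrite ler_wpM2r//; exact: fM.
Qed.

(** The mean value inequality for [f - L], with [L] the derivative at x: along the segment its
    derivative is at most M |h|. The value of the constant is immaterial here, only a quadratic
    bound is wanted. *)
Lemma frechet_quad (U : normedModType R) (f : V -> U) (M : R) :
  (forall x, differentiable f x) ->
  (forall x h, `|frechet f (x + h) - frechet f x| <= M * `|h|) ->
  forall x h, `|f (x + h) - f x - frechet f x h| <= M * `|h| ^+ 2.
Proof.
move=> fd fM x h.
set L := frechet f x.
have Ld y : differentiable (L : V -> U) y.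
  by apply: linear_differentiable; exact: blin_continuous.
pose g := (f - (L : V -> U)).
have -> : f (x + h) - f x - L h = g (x + h) - g x.
  rewrite -[g (x + h)]/(f (x + h) - L (x + h)) -[g x]/(f x - L x) linearD.
  by rewrite [L x + L h]addrC opprD opprB [f (x + h) + (_ - _)]addrA subrKA addrAC.
apply: mean_value_ineq => [y|t /andP[t0 t1]]; first exact: differentiableB.
rewrite diffB// diff_lin; last exact: blin_continuous.
rewrite -[X in `|X|]/('d f (x + t *: h) h - L h) -frechetE//.
rewrite -[X in `|X|]/((frechet f (x + t *: h) - L) h).
rewrite (le_trans (opnorm_ub _ _))// expr2 mulrA ler_wpM2r//.
have M0 : 0 <= M * `|h| := le_trans (normr_ge0 _) (fM x h).
rewrite (le_trans (fM _ _))// normrZ ger0_norm// mulrCA ler_piMl//.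
Qed.

Lemma bounded_derivatives_C21 (f : V -> W) : bounded_derivatives3 f ->
  exists C, C21 f (fun x h => frechet f x h) (fun x h k => frechet (frechet f) x h k) C.
Proof.
move=> [d0 d1 d2 [s1 s2 s3]].
pose C := Num.max (fine (supD1 f)) (Num.max (fine (supD2 f)) (fine (supD3 f))).
exists C.
have b1 x : `|frechet f x| <= C by rewrite (le_trans (supnorm_ub x s1))// /C le_max lexx.
have b2 x : `|frechet (frechet f) x| <= C.
  by rewrite (le_trans (supnorm_ub x s2))// /C !le_max lexx orbT.
have b3 x : `|frechet (frechet (frechet f)) x| <= C.
  by rewrite (le_trans (supnorm_ub x s3))// /C !le_max lexx !orbT.
have op (U U' : normedModType R) (A : {blin U -> U'}) (c : R) u : `|A| <= c -> `|A u| <= c * `|u|.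
  by move=> Ac; rewrite (le_trans (opnorm_ub _ _))// ler_wpM2r.
have l0 := frechet_lip d0 b1; have l1 := frechet_lip d1 b2; have l2 := frechet_lip d2 b3.
split.
- by move=> x a h k; rewrite linearP.
- by move=> x a h k l; rewrite linearP.
- by move=> x a h k l; rewrite linearP.
- by move=> x h; exact: op.
- by move=> x h k; apply/op/op.
- exact: l0.
- by move=> x h k; exact: (op _ _ (_ - _)).
- by move=> x h k l; exact/(op _ _ (_ - _))/(op _ _ (_ - _)).
- exact: frechet_quad.
- by move=> x h k; apply: (op _ _ (_ - _ - _)); exact: frechet_quad.
Qed.

(** The three suprema stay separate here because they enter the final constant: they start the
    recursion for [g] and bound the coefficients of a step. *)
Lemma bounded_derivatives_sharp (f : V -> W) : bounded_derivatives3 f ->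
  [/\ forall x h, `|frechet f x h| <= fine (supD1 f) * `|h|,
      forall x h k, `|frechet (frechet f) x h k| <= fine (supD2 f) * `|h| * `|k|
    & forall x h k l, `|frechet (frechet f) (x + h) k l - frechet (frechet f) x k l|
        <= fine (supD3 f) * `|h| * `|k| * `|l|].
Proof.
move=> [d0 d1 d2 [s1 s2 s3]].
have op (U U' : normedModType R) (A : {blin U -> U'}) (c : R) u : `|A| <= c -> `|A u| <= c * `|u|.
  by move=> Ac; rewrite (le_trans (opnorm_ub _ _))// ler_wpM2r.
have l2 := frechet_lip d2 (fun x => supnorm_ub x s3).
split=> [x h|x h k|x h k l].
- by apply: op; exact: supnorm_ub.
- by apply/op/op; exact: supnorm_ub.
- exact/(op _ _ (_ - _))/(op _ _ (_ - _)).
Qed.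

End FrechetC21.

(** * Stability under linear maps and sums *)

Section C21_algebra.
Context {R : realType} {V W U : normedModType R}.

Lemma C21_le (f : V -> W) (f1 : V -> V -> W) (f2 : V -> V -> V -> W) (C D : R) : C <= D -> C21 f f1 f2 C -> C21 f f1 f2 D.
Proof.
move=> CD fC; split; try by case: fC.
- by move=> *; apply: le_trans (C21_bd1 fC _ _) _; rewrite ler_wpM2r.
- by move=> *; apply: le_trans (C21_bd2 fC _ _ _) _; do 2 rewrite ler_wpM2r//.
- by move=> *; apply: le_trans (C21_lip0 fC _ _) _; rewrite ler_wpM2r.
- by move=> *; apply: le_trans (C21_lip1 fC _ _ _) _; do 2 rewrite ler_wpM2r//.
- by move=> *; apply: le_trans (C21_lip2 fC _ _ _ _) _; do 3 rewrite ler_wpM2r//.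
- by move=> *; apply: le_trans (C21_quad0 fC _ _) _; rewrite ler_wpM2r ?exprn_ge0.
- by move=> *; apply: le_trans (C21_quad1 fC _ _ _) _; do 2 rewrite ler_wpM2r ?exprn_ge0//.
Qed.

Lemma C21_map (f : V -> W) (f1 : V -> V -> W) (f2 : V -> V -> V -> W) (C c : R)
    (L : W -> U) : linear L -> 0 <= c ->
  (forall w, `|L w| <= c * `|w|) -> C21 f f1 f2 C ->
  C21 (fun x => L (f x)) (fun x h => L (f1 x h)) (fun x h k => L (f2 x h k)) (c * C).
Proof.
move=> lL c0 Lc fC.
have LB x y : L (x - y) = L x - L y by rewrite addrC -scaleN1r lL scaleN1r addrC.
split.
- by move=> *; rewrite (C21_lin1 fC) lL.
- by move=> *; rewrite (C21_lin2l fC) lL.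
- by move=> *; rewrite (C21_lin2r fC) lL.
- by move=> *; rewrite -!(mulrA c) (le_trans (Lc _))// ler_wpM2l// (C21_bd1 fC).
- by move=> *; rewrite -!(mulrA c) (le_trans (Lc _))// ler_wpM2l// (C21_bd2 fC).
- by move=> *; rewrite -!LB -!(mulrA c) (le_trans (Lc _))// ler_wpM2l// (C21_lip0 fC).
- by move=> *; rewrite -!LB -!(mulrA c) (le_trans (Lc _))// ler_wpM2l// (C21_lip1 fC).
- by move=> *; rewrite -!LB -!(mulrA c) (le_trans (Lc _))// ler_wpM2l// (C21_lip2 fC).
- by move=> *; rewrite -!LB -!(mulrA c) (le_trans (Lc _))// ler_wpM2l// (C21_quad0 fC).
- by move=> *; rewrite -!LB -!(mulrA c) (le_trans (Lc _))// ler_wpM2l// (C21_quad1 fC).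
Qed.

Lemma C21D (f : V -> W) (f1 : V -> V -> W) (f2 : V -> V -> V -> W) (C D : R)
    (g : V -> W) (g1 : V -> V -> W) (g2 : V -> V -> V -> W) : C21 f f1 f2 C -> C21 g g1 g2 D ->
  C21 (fun x => f x + g x) (fun x h => f1 x h + g1 x h)
    (fun x h k => f2 x h k + g2 x h k) (C + D).
Proof.
move=> fC gD.
have add (a b : W) (c d : R) : `|a| <= c -> `|b| <= d -> `|a + b| <= c + d.
  by move=> ac bd; rewrite (le_trans (ler_normD _ _))// lerD.
have DB (a b c d : W) : (a + b) - (c + d) = (a - c) + (b - d).
  by rewrite opprD addrACA.
have DB2 (a b c d e h : W) : (a + b) - (c + d) - (e + h) = (a - c - e) + (b - d - h).
  by rewrite [a + b - (c + d)]DB DB.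
split.
- by move=> *; rewrite (C21_lin1 fC) (C21_lin1 gD) scalerDr addrACA.
- by move=> *; rewrite (C21_lin2l fC) (C21_lin2l gD) scalerDr addrACA.
- by move=> *; rewrite (C21_lin2r fC) (C21_lin2r gD) scalerDr addrACA.
- by move=> *; rewrite !mulrDl; apply: add; [exact: (C21_bd1 fC)|exact: (C21_bd1 gD)].
- by move=> *; rewrite !mulrDl; apply: add; [exact: (C21_bd2 fC)|exact: (C21_bd2 gD)].
- by move=> *; rewrite DB !mulrDl; apply: add; [exact: (C21_lip0 fC)|exact: (C21_lip0 gD)].
- by move=> *; rewrite DB !mulrDl; apply: add; [exact: (C21_lip1 fC)|exact: (C21_lip1 gD)].
- by move=> *; rewrite DB !mulrDl; apply: add; [exact: (C21_lip2 fC)|exact: (C21_lip2 gD)].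
- by move=> *; rewrite DB2 !mulrDl; apply: add; [exact: (C21_quad0 fC)|exact: (C21_quad0 gD)].
- by move=> *; rewrite DB2 !mulrDl; apply: add; [exact: (C21_quad1 fC)|exact: (C21_quad1 gD)].
Qed.

Lemma C21_cst0 : C21 (fun=> 0 : W) (fun (_ _ : V) => 0) (fun (_ _ _ : V) => 0) 0.
Proof. by split=> *; rewrite ?subrr ?normr0 ?mul0r// scaler0 addr0. Qed.

Lemma C21_sum (I : Type) (r : seq I) (p : pred I) (f : I -> V -> W)
    (f1 : I -> V -> V -> W) (f2 : I -> V -> V -> V -> W) (C : I -> R) :
  (forall i, p i -> C21 (f i) (f1 i) (f2 i) (C i)) ->
  C21 (fun x => \sum_(i <- r | p i) f i x) (fun x h => \sum_(i <- r | p i) f1 i x h)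
    (fun x h k => \sum_(i <- r | p i) f2 i x h k) (\sum_(i <- r | p i) C i).
Proof.
move=> fC; elim: r => [|i r ih].
  rewrite big_nil; have := C21_cst0.
  congr C21; [apply/funext => x|apply/funext => x; apply/funext => h|
    apply/funext => x; apply/funext => h; apply/funext => k]; by rewrite big_nil.
rewrite big_cons; have [pi|npi] := boolP (p i).
  have := C21D (fC _ pi) ih.
  congr C21; [apply/funext => x|apply/funext => x; apply/funext => h|
    apply/funext => x; apply/funext => h; apply/funext => k]; by rewrite big_cons pi.
move: ih; congr C21; [apply/funext => x|apply/funext => x; apply/funext => h|
  apply/funext => x; apply/funext => h; apply/funext => k]; by rewrite big_cons (negbTE npi).
Qed.

End C21_algebra.

Lemma C21_id (R : realType) (V : normedModType R) :
  C21 (fun x : V => x) (fun _ h => h) (fun (_ _ _ : V) => 0) 1.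
Proof.
have e (x h : V) : x + h - x = h by rewrite addrAC subrr add0r.
split=> //.
- by move=> *; rewrite scaler0 addr0.
- by move=> *; rewrite scaler0 addr0.
- by move=> *; rewrite mul1r.
- by move=> *; rewrite normr0 !mulr_ge0.
- by move=> *; rewrite e mul1r.
- by move=> *; rewrite subrr normr0 !mulr_ge0.
- by move=> *; rewrite subrr normr0 !mulr_ge0.
- by move=> *; rewrite e subrr normr0 mulr_ge0// exprn_ge0.
- by move=> *; rewrite subrr subr0 normr0 !mulr_ge0// exprn_ge0.
Qed.

(** * Chain rule with explicit constants *)

Section Composition.
Context {R : realType} {V W : normedModType R}.
Variables (u : W -> R) (u1 : W -> W -> R) (u2 : W -> W -> W -> R) (C : R).
Variables (f : V -> W) (f1 : V -> V -> W) (f2 : V -> V -> V -> W) (L : R).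
Hypotheses (uC : C21 u u1 u2 C) (fL : C21 f f1 f2 L) (L1 : 1 <= L).

Let u1B x a b : u1 x (a - b) = u1 x a - u1 x b.
Proof. by rewrite addrC -scaleN1r (C21_lin1 uC) scaleN1r addrC. Qed.
Let u2Bl x a b c : u2 x (a - b) c = u2 x a c - u2 x b c.
Proof. by rewrite addrC -scaleN1r (C21_lin2l uC) scaleN1r addrC. Qed.
Let u2Br x a b c : u2 x c (a - b) = u2 x c a - u2 x c b.
Proof. by rewrite addrC -scaleN1r (C21_lin2r uC) scaleN1r addrC. Qed.

Definition comp1 x h := u1 (f x) (f1 x h).
Definition comp2 x h k := u2 (f x) (f1 x h) (f1 x k) + u1 (f x) (f2 x h k).

Let comp2B x h k l :
  comp2 (x + h) k l - comp2 x k l =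
  (u2 (f x + (f (x + h) - f x)) (f1 x k) (f1 x l) - u2 (f x) (f1 x k) (f1 x l))
  + u2 (f (x + h)) (f1 (x + h) k - f1 x k) (f1 (x + h) l)
  + u2 (f (x + h)) (f1 x k) (f1 (x + h) l - f1 x l)
  + (u1 (f x + (f (x + h) - f x)) (f2 x k l) - u1 (f x) (f2 x k l))
  + u1 (f (x + h)) (f2 (x + h) k l - f2 x k l).
Proof. rewrite /comp2 u1B u2Bl u2Br [f x + _]addrC subrK; ring. Qed.

Let sum5 (a b c d e : R) A B C' D E : `|a| <= A -> `|b| <= B -> `|c| <= C' ->
  `|d| <= D -> `|e| <= E -> `|a + b + c + d + e| <= A + B + C' + D + E.
Proof.
move=> *; do 4 (apply: le_trans (ler_normD _ _) _; apply: lerD => //).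
Qed.

Let L0 : 0 <= L. Proof. exact: le_trans L1. Qed.

Let pow_le m : (m <= 3)%N -> L ^+ m <= L ^+ 3.
Proof. by move=> m3; exact: ler_weXn2l. Qed.

(** The differences in [comp2B] are replaced by their first-order parts, which carry the sharp
    constants [K1], [K2], [K3]. What remains is quadratic in h and contains the crude [L];
    [lipschitz_of_quadratic] removes it once expectations have been taken. *)
Lemma comp2_lip (K1 K2 K3 : R) : 0 <= K1 -> 0 <= K2 -> 0 <= K3 ->
  (forall x h, `|u1 x h| <= K1 * `|h|) ->
  (forall x h k, `|u2 x h k| <= K2 * `|h| * `|k|) ->
  (forall x h k, `|u1 (x + h) k - u1 x k| <= K2 * `|h| * `|k|) ->
  (forall x h k l, `|u2 (x + h) k l - u2 x k l| <= K3 * `|h| * `|k| * `|l|) ->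
  forall x h k l, `|comp2 (x + h) k l - comp2 x k l| <=
    K3 * (`|f1 x h| * `|f1 x k| * `|f1 x l|)
    + K2 * (`|f2 x h k| * `|f1 x l| + `|f2 x h l| * `|f1 x k| + `|f2 x k l| * `|f1 x h|)
    + K1 * `|f2 (x + h) k l - f2 x k l|
    + (K3 + 5 * K2) * L ^+ 3 * (`|h| ^+ 2 * `|k| * `|l|).
Proof.
move=> K10 K20 K30 b1 b2 lip1 lip2 x h k l.
have near0 (a b c : W) r : `|a - b - c| <= r -> `|a - b| <= `|c| + r.
  move=> abr; rewrite -(subrK c (a - b)) addrC (le_trans (ler_normD _ _))//.
  by rewrite lerD2l.
have d0 := near0 _ _ _ _ (C21_quad0 fL x h).
have dk := near0 _ _ _ _ (C21_quad1 fL x h k).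
have dl := near0 _ _ _ _ (C21_quad1 fL x h l).
have bl' := C21_bd1 fL (x + h) l.
have bl : `|f1 (x + h) l| <= `|f1 x l| + L * `|h| * `|l|.
  rewrite -(subrK (f1 x l) (f1 _ l)) addrC (le_trans (ler_normD _ _))// lerD2l.
  exact: (C21_lip1 fL).
have bh := C21_bd1 fL x h; have bk := C21_bd1 fL x k; have bl0 := C21_bd1 fL x l.
have chk := C21_bd2 fL x h k; have chl := C21_bd2 fL x h l; have ckl := C21_bd2 fL x k l.
have := sum5 (lip2 (f x) (f (x + h) - f x) (f1 x k) (f1 x l))
  (b2 (f (x + h)) (f1 (x + h) k - f1 x k) (f1 (x + h) l))
  (b2 (f (x + h)) (f1 x k) (f1 (x + h) l - f1 x l))
  (lip1 (f x) (f (x + h) - f x) (f2 x k l))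
  (b1 (f (x + h)) (f2 (x + h) k l - f2 x k l)).
rewrite -comp2B => /le_trans; apply.
set h' := `|h| in bh chk chl d0 dk dl bl *; set k' := `|k| in bk chk ckl dk *.
set l' := `|l| in bl' bl0 bl chl ckl dl *.
have [h0 k0 l0] : [/\ 0 <= h', 0 <= k' & 0 <= l'] by split; exact: normr_ge0.
have L2 := pow_le (isT : 2 <= 3)%N; have L1' := pow_le (isT : 1 <= 3)%N.
have L30 : 0 <= L ^+ 3 by exact: exprn_ge0.
set p := h' ^+ 2 * k' * l'.
have p0 : 0 <= p by rewrite !mulr_ge0 ?exprn_ge0.
have t1 : `|f (x + h) - f x| * `|f1 x k| * `|f1 x l| <=
    `|f1 x h| * `|f1 x k| * `|f1 x l| + L ^+ 3 * p.
  apply: (@le_trans _ _ ((`|f1 x h| + L * h' ^+ 2) * `|f1 x k| * `|f1 x l|)).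
    by rewrite !ler_wpM2r.
  rewrite [leLHS](_ : _ = `|f1 x h| * `|f1 x k| * `|f1 x l|
    + L * h' ^+ 2 * (`|f1 x k| * `|f1 x l|)); last by ring.
  rewrite lerD2l (_ : L ^+ 3 * p = L * h' ^+ 2 * ((L * k') * (L * l'))); last by rewrite /p; ring.
  by rewrite ler_wpM2l ?mulr_ge0 ?exprn_ge0// ler_pM.
have t2 : `|f1 (x + h) k - f1 x k| * `|f1 (x + h) l| <=
    `|f2 x h k| * `|f1 x l| + 2 * L ^+ 3 * p.
  apply: (@le_trans _ _ (`|f2 x h k| * (`|f1 x l| + L * h' * l') + L * h' ^+ 2 * k' * (L * l'))).
    apply: (@le_trans _ _ ((`|f2 x h k| + L * h' ^+ 2 * k') * `|f1 (x + h) l|)).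
      by rewrite ler_wpM2r.
    by rewrite mulrDl lerD// ler_wpM2l// !mulr_ge0 ?exprn_ge0.
  rewrite mulrDr -addrA lerD2l -(mulrA 2) mulr_natl mulr2n lerD//.
    apply: (@le_trans _ _ (L * h' * k' * (L * h' * l'))).
      by rewrite ler_wpM2r// !mulr_ge0.
    rewrite (_ : _ * _ = L ^+ 2 * p); last by rewrite /p; ring.
    exact: ler_wpM2r.
  rewrite (_ : _ * _ = L ^+ 2 * p); last by rewrite /p; ring.
  exact: ler_wpM2r.
have t3 : `|f1 x k| * `|f1 (x + h) l - f1 x l| <=
    `|f2 x h l| * `|f1 x k| + L ^+ 3 * p.
  apply: (@le_trans _ _ (`|f1 x k| * (`|f2 x h l| + L * h' ^+ 2 * l'))).
    by rewrite ler_wpM2l.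
  rewrite mulrDr mulrC lerD2l.
  apply: (@le_trans _ _ (L * k' * (L * h' ^+ 2 * l'))).
    by rewrite ler_wpM2r// !mulr_ge0 ?exprn_ge0.
  rewrite (_ : _ * _ = L ^+ 2 * p); last by rewrite /p; ring.
  exact: ler_wpM2r.
have t4 : `|f (x + h) - f x| * `|f2 x k l| <= `|f2 x k l| * `|f1 x h| + L ^+ 3 * p.
  apply: (@le_trans _ _ ((`|f1 x h| + L * h' ^+ 2) * `|f2 x k l|)).
    by rewrite ler_wpM2r.
  rewrite mulrDl mulrC lerD2l.
  apply: (@le_trans _ _ (L * h' ^+ 2 * (L * k' * l'))).
    by rewrite ler_wpM2l// !mulr_ge0 ?exprn_ge0.
  rewrite (_ : _ * _ = L ^+ 2 * p); last by rewrite /p; ring.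
  exact: ler_wpM2r.
have {}t1 := ler_wpM2l K30 t1; have {}t2 := ler_wpM2l K20 t2.
have {}t3 := ler_wpM2l K20 t3; have {}t4 := ler_wpM2l K20 t4.
have K2p : 0 <= K2 * L ^+ 3 * p by rewrite !mulr_ge0.
rewrite -/p; clearbody p; lra.
Qed.

(** Every quantity splits into at most five terms, each at most C L^m with m <= 3, and L >= 1 allows
    one common power. *)
Lemma C21_comp : 0 <= C -> C21 (fun x => u (f x)) comp1 comp2 (6 * C * L ^+ 3).
Proof.
move=> C0.
have L3 := pow_le (isT : 1 <= 3)%N; have L2 := pow_le (isT : 2 <= 3)%N.
have L30 : 0 <= L ^+ 3 by exact: exprn_ge0.
have CL : C * L <= 6 * C * L ^+ 3.
  apply: (@le_trans _ _ (C * L ^+ 3)); first by rewrite ler_wpM2l.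
  by rewrite -mulrA ler_peMl ?mulr_ge0// ler1n.
split.
- by move=> *; rewrite /comp1 (C21_lin1 fL) (C21_lin1 uC).
- move=> x a h k l; rewrite /comp2 (C21_lin1 fL) (C21_lin2l uC) (C21_lin2l fL) (C21_lin1 uC).
  by rewrite scalerDr addrACA.
- move=> x a h k l; rewrite /comp2 (C21_lin1 fL) (C21_lin2r uC) (C21_lin2r fL) (C21_lin1 uC).
  by rewrite scalerDr addrACA.
- move=> x h; apply: (@le_trans _ _ (C * L * `|h|)); last by rewrite ler_wpM2r.
  by rewrite (le_trans (C21_bd1 uC _ _))// -mulrA ler_wpM2l// (C21_bd1 fL).
- move=> x h k.
  have hk0 : 0 <= `|h| * `|k| by rewrite mulr_ge0.
  have a1 : `|u2 (f x) (f1 x h) (f1 x k)| <= C * (L * `|h|) * (L * `|k|).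
    apply: (le_trans (C21_bd2 uC _ _ _)).
    by apply: ler_pM; rewrite ?mulr_ge0// ?ler_wpM2l// (C21_bd1 fL).
  have a2 : `|u1 (f x) (f2 x h k)| <= C * (L * `|h| * `|k|).
    by apply: (le_trans (C21_bd1 uC _ _)); rewrite ler_wpM2l// (C21_bd2 fL).
  have {}L2 := ler_wpM2r hk0 (ler_wpM2l C0 L2).
  have {}L3 := ler_wpM2r hk0 (ler_wpM2l C0 L3).
  have : 0 <= C * L ^+ 3 * (`|h| * `|k|) by rewrite !mulr_ge0.
  have := ler_normD (u2 (f x) (f1 x h) (f1 x k)) (u1 (f x) (f2 x h k)).
  rewrite /comp2; lra.
- move=> x h; apply: (@le_trans _ _ (C * L * `|h|)); last by rewrite ler_wpM2r.
  rewrite (le_trans (_ : _ <= C * `|f (x + h) - f x|))//.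
    by rewrite -[in X in u X](subrK (f x) (f (x + h))) [_ + f x]addrC (C21_lip0 uC).
  by rewrite -mulrA ler_wpM2l// (C21_lip0 fL).
- move=> x h k.
  have -> : comp1 (x + h) k - comp1 x k =
    (u1 (f x + (f (x + h) - f x)) (f1 (x + h) k) - u1 (f x) (f1 (x + h) k))
     + u1 (f x) (f1 (x + h) k - f1 x k).
    by rewrite u1B [f x + _]addrC subrK /comp1; ring.
  rewrite (le_trans (ler_normD _ _))//.
  apply: (@le_trans _ _ (C * (L * `|h|) * (L * `|k|) + C * (L * `|h| * `|k|))).
    apply: lerD.
      apply: (le_trans (C21_lip1 uC _ _ _)).
      by apply: ler_pM; rewrite ?mulr_ge0// ?ler_wpM2l// ?(C21_lip0 fL)// (C21_bd1 fL).
    by apply: (le_trans (C21_bd1 uC _ _)); rewrite ler_wpM2l// (C21_lip1 fL).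
  have {}L2 := ler_wpM2r (mulr_ge0 (normr_ge0 h) (normr_ge0 k)) (ler_wpM2l C0 L2).
  have {}L3 := ler_wpM2r (mulr_ge0 (normr_ge0 h) (normr_ge0 k)) (ler_wpM2l C0 L3).
  have : 0 <= C * L ^+ 3 * (`|h| * `|k|) by rewrite !mulr_ge0.
  lra.
- move=> x h k l.
  have hkl0 : 0 <= `|h| * `|k| * `|l| by rewrite !mulr_ge0.
  have fh := C21_lip0 fL x h; have bh := C21_bd1 fL (x + h).
  have a1 : `|u2 (f x + (f (x + h) - f x)) (f1 x k) (f1 x l) - u2 (f x) (f1 x k) (f1 x l)|
      <= C * (L * `|h|) * (L * `|k|) * (L * `|l|).
    apply: (le_trans (C21_lip2 uC _ _ _ _)).
    by do 2 ?[apply: ler_pM; rewrite ?mulr_ge0//]; rewrite ?ler_wpM2l// (C21_bd1 fL).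
  have a2 : `|u2 (f (x + h)) (f1 (x + h) k - f1 x k) (f1 (x + h) l)|
      <= C * (L * `|h| * `|k|) * (L * `|l|).
    apply: (le_trans (C21_bd2 uC _ _ _)).
    by apply: ler_pM; rewrite ?mulr_ge0//; rewrite ?ler_wpM2l// (C21_lip1 fL).
  have a3 : `|u2 (f (x + h)) (f1 x k) (f1 (x + h) l - f1 x l)|
      <= C * (L * `|k|) * (L * `|h| * `|l|).
    apply: (le_trans (C21_bd2 uC _ _ _)).
    by apply: ler_pM; rewrite ?mulr_ge0//; rewrite ?ler_wpM2l// ?(C21_bd1 fL)// (C21_lip1 fL).
  have a4 : `|u1 (f x + (f (x + h) - f x)) (f2 x k l) - u1 (f x) (f2 x k l)|
      <= C * (L * `|h|) * (L * `|k| * `|l|).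
    apply: (le_trans (C21_lip1 uC _ _ _)).
    by apply: ler_pM; rewrite ?mulr_ge0//; rewrite ?ler_wpM2l// (C21_bd2 fL).
  have a5 : `|u1 (f (x + h)) (f2 (x + h) k l - f2 x k l)|
      <= C * (L * `|h| * `|k| * `|l|).
    by apply: (le_trans (C21_bd1 uC _ _)); rewrite ler_wpM2l// (C21_lip2 fL).
  rewrite comp2B; apply: (le_trans (sum5 a1 a2 a3 a4 a5)).
  have {}L2 := ler_wpM2r hkl0 (ler_wpM2l C0 L2).
  have {}L3 := ler_wpM2r hkl0 (ler_wpM2l C0 L3).
  have : 0 <= C * L ^+ 3 * (`|h| * `|k| * `|l|) by rewrite !mulr_ge0.
  lra.
- move=> x h; rewrite /comp1.
  have -> : u (f (x + h)) - u (f x) - u1 (f x) (f1 x h) =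
     (u (f x + (f (x + h) - f x)) - u (f x) - u1 (f x) (f (x + h) - f x))
     + u1 (f x) (f (x + h) - f x - f1 x h).
    by rewrite !u1B [f x + _]addrC subrK; ring.
  have a1 : `|u (f x + (f (x + h) - f x)) - u (f x) - u1 (f x) (f (x + h) - f x)|
      <= C * (L * `|h|) ^+ 2.
    apply: (le_trans (C21_quad0 uC _ _)); rewrite ler_wpM2l//.
    by rewrite ler_pXn2r ?nnegrE ?mulr_ge0// (C21_lip0 fL).
  have a2 : `|u1 (f x) (f (x + h) - f x - f1 x h)| <= C * (L * `|h| ^+ 2).
    by apply: (le_trans (C21_bd1 uC _ _)); rewrite ler_wpM2l// (C21_quad0 fL).
  apply: le_trans (ler_normD _ _) _.
  have h20 : 0 <= `|h| ^+ 2 by rewrite exprn_ge0.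
  have {}L2 := ler_wpM2r h20 (ler_wpM2l C0 L2).
  have {}L3 := ler_wpM2r h20 (ler_wpM2l C0 L3).
  have : 0 <= C * L ^+ 3 * `|h| ^+ 2 by rewrite !mulr_ge0.
  lra.
- move=> x h k; rewrite /comp1 /comp2.
  (* Four terms, padded by a zero to fit [sum5]. *)
  have -> : u1 (f (x + h)) (f1 (x + h) k) - u1 (f x) (f1 x k)
      - (u2 (f x) (f1 x h) (f1 x k) + u1 (f x) (f2 x h k)) =
    (u1 (f x + (f (x + h) - f x)) (f1 (x + h) k) - u1 (f x) (f1 (x + h) k)
      - u2 (f x) (f (x + h) - f x) (f1 (x + h) k))
    + u2 (f x) (f (x + h) - f x - f1 x h) (f1 (x + h) k)
    + u2 (f x) (f1 x h) (f1 (x + h) k - f1 x k)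
    + u1 (f x) (f1 (x + h) k - f1 x k - f2 x h k) + 0.
    by rewrite !u1B !u2Bl !u2Br [f x + _]addrC subrK; ring.
  have h20 : 0 <= `|h| ^+ 2 by rewrite exprn_ge0.
  have h2k0 : 0 <= `|h| ^+ 2 * `|k| by rewrite mulr_ge0.
  have fh := C21_lip0 fL x h; have bk := C21_bd1 fL (x + h) k.
  have a1 : `|u1 (f x + (f (x + h) - f x)) (f1 (x + h) k) - u1 (f x) (f1 (x + h) k)
      - u2 (f x) (f (x + h) - f x) (f1 (x + h) k)| <= C * (L * `|h|) ^+ 2 * (L * `|k|).
    apply: (le_trans (C21_quad1 uC _ _ _)).
    apply: ler_pM; rewrite ?mulr_ge0 ?exprn_ge0// ler_wpM2l//.
    by rewrite ler_pXn2r ?nnegrE ?mulr_ge0.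
  have a2 : `|u2 (f x) (f (x + h) - f x - f1 x h) (f1 (x + h) k)|
      <= C * (L * `|h| ^+ 2) * (L * `|k|).
    apply: (le_trans (C21_bd2 uC _ _ _)).
    by apply: ler_pM; rewrite ?mulr_ge0// ler_wpM2l// (C21_quad0 fL).
  have a3 : `|u2 (f x) (f1 x h) (f1 (x + h) k - f1 x k)|
      <= C * (L * `|h|) * (L * `|h| * `|k|).
    apply: (le_trans (C21_bd2 uC _ _ _)).
    by apply: ler_pM; rewrite ?mulr_ge0//; rewrite ?ler_wpM2l// ?(C21_bd1 fL)// (C21_lip1 fL).
  have a4 : `|u1 (f x) (f1 (x + h) k - f1 x k - f2 x h k)|
      <= C * (L * `|h| ^+ 2 * `|k|).
    by apply: (le_trans (C21_bd1 uC _ _)); rewrite ler_wpM2l// (C21_quad1 fL).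
  have a5 : `|0 : R| <= 0 by rewrite normr0.
  apply: (le_trans (sum5 a1 a2 a3 a4 a5)).
  have {}L2 := ler_wpM2r h2k0 (ler_wpM2l C0 L2).
  have {}L3 := ler_wpM2r h2k0 (ler_wpM2l C0 L3).
  have : 0 <= C * L ^+ 3 * (`|h| ^+ 2 * `|k|) by rewrite !mulr_ge0.
  lra.
Qed.
End Composition.

(** * Taylor expansion with sharp constants *)

Section Taylor.
Context {R : realType}.

(** Subtracting e t makes the slope at most -e, which beats the quadratic error when the increment
    is shorter than e / (C + 1). *)
Let quadratic_nonincreasing (G G1 : R -> R) (C : R) :
  (forall t s, 0 <= t <= 1 -> `|s| <= 1 -> `|G (t + s) - G t - s * G1 t| <= C * s ^+ 2) ->
  (forall t, 0 <= t <= 1 -> G1 t <= 0) -> G 1 <= G 0.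
Proof.
move=> GC G10; apply/ler_addgt0Pr => e e0.
have C0 : 0 <= C.
  have := GC 0 1; rewrite lexx ler01 normr1 lexx expr1n mulr1 => /(_ isT isT).
  exact: le_trans (normr_ge0 _).
suff : (fun t => G t - e * t) 1 <= (fun t => G t - e * t) 0.
  by rewrite /= mulr1 mulr0 subr0 lerBlDr.
apply: (@locally_nonincreasing _ (fun t => G t - e * t)) => t t01.
exists (Num.min 1 (e / (C + 1))); first by rewrite lt_min ltr01 divr_gt0// ltr_wpDl.
move=> s; rewrite lt_min => /andP[s1 se].
have se' : C * `|s - t| <= e.
  move: se; rewrite ltr_pdivlMr ?ltr_wpDl// => se.
  have := normr_ge0 (s - t); nra.
have := GC t (s - t) t01 (ltW s1).
rewrite [t + _]addrC subrK ler_norml => /andP[lo hi].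
have g1 := G10 t t01.
split=> st.
- have st' : s - t <= 0 by rewrite subr_le0.
  rewrite ler0_norm// in se'; nra.
- have st' : 0 <= s - t by rewrite subr_ge0.
  rewrite ger0_norm// in se'; nra.
Qed.

(** Comparison with a majorant: below, [M] is an explicit polynomial whose value at 1 is the sharp
    Taylor remainder, so that no integral remainder is needed. *)
Lemma quadratic_mean_value (G G1 M M1 : R -> R) (C D : R) :
  (forall t s, 0 <= t <= 1 -> `|s| <= 1 -> `|G (t + s) - G t - s * G1 t| <= C * s ^+ 2) ->
  (forall t s, 0 <= t <= 1 -> `|s| <= 1 -> `|M (t + s) - M t - s * M1 t| <= D * s ^+ 2) ->
  (forall t, 0 <= t <= 1 -> `|G1 t| <= M1 t) -> `|G 1 - G 0| <= M 1 - M 0.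
Proof.
move=> GC MD G1M; rewrite ler_norml; apply/andP; split.
- have : - G 1 - M 1 <= - G 0 - M 0.
    apply: (@quadratic_nonincreasing (fun t => - G t - M t) (fun t => - G1 t - M1 t) (C + D)).
      move=> t s t01 s1.
      have := GC t s t01 s1; have := MD t s t01 s1.
      rewrite !ler_norml => /andP[? ?] /andP[? ?]; apply/andP; split; lra.
    by move=> t /G1M; rewrite ler_norml => /andP[? ?]; lra.
  by lra.
- have : G 1 - M 1 <= G 0 - M 0.
    apply: (@quadratic_nonincreasing (fun t => G t - M t) (fun t => G1 t - M1 t) (C + D)).
      move=> t s t01 s1.
      have := GC t s t01 s1; have := MD t s t01 s1.
      rewrite !ler_norml => /andP[? ?] /andP[? ?]; apply/andP; split; lra.
    by move=> t /G1M; rewrite ler_norml => /andP[? ?]; lra.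
  by lra.
Qed.

Context {V : normedModType R}.
Variables (u : V -> R) (u1 : V -> V -> R) (u2 : V -> V -> V -> R) (C K : R).
Hypotheses (uC : C21 u u1 u2 C)
  (uK : forall x h k l, `|u2 (x + h) k l - u2 x k l| <= K * `|h| * `|k| * `|l|).

Let u1Z x (a : R) h : u1 x (a *: h) = a * u1 x h.
Proof.
have u10 : u1 x 0 = 0.
  have := C21_lin1 uC x 1 0 0; rewrite !scale1r addr0 => e.
  by have := subrr (u1 x 0); rewrite {1}e addrK.
by have := C21_lin1 uC x a h 0; rewrite !addr0 u10 addr0.
Qed.

Let u2Z x (a : R) h k : u2 x (a *: h) k = a * u2 x h k.
Proof.
have u20 : u2 x 0 k = 0.
  have := C21_lin2l uC x 1 0 0 k; rewrite !scale1r addr0 => e.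
  by have := subrr (u2 x 0 k); rewrite {1}e addrK.
by have := C21_lin2l uC x a h 0 k; rewrite !addr0 u20 addr0.
Qed.

(** The majorant is the antiderivative of the Lipschitz bound K t |h|^2 |k| on the slope. *)
Lemma taylor1 x h k : `|u1 (x + h) k - u1 x k - u2 x h k| <= K / 2 * `|h| ^+ 2 * `|k|.
Proof.
have := @quadratic_mean_value (fun t => u1 (x + t *: h) k - t * u2 x h k)
  (fun t => u2 (x + t *: h) h k - u2 x h k)
  (fun t => K * `|h| ^+ 2 * `|k| * t ^+ 2 / 2) (fun t => K * `|h| ^+ 2 * `|k| * t)
  (C * `|h| ^+ 2 * `|k|) (`|K * `|h| ^+ 2 * `|k| |).
rewrite scale1r scale0r addr0 !mul1r !mul0r expr1n expr0n/= mulr0 mul0r mulr1 !subr0.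
rewrite [u1 (x + h) k - _ - _]addrAC [K / 2 * _]mulrAC [_ / 2 * _]mulrAC; apply.
- move=> t s t01 s1.
  have := C21_quad1 uC (x + t *: h) (s *: h) k.
  rewrite -[x + _ + _]addrA -scalerDl u2Z normrZ exprMn real_normK ?num_real// => H.
  rewrite [X in `|X|](_ : _ = u1 (x + (t + s) *: h) k - u1 (x + t *: h) k -
     s * u2 (x + t *: h) h k); last by ring.
  by rewrite (le_trans H)//; lra.
- move=> t s t01 s1.
  rewrite [X in `|X|](_ : _ = K * `|h| ^+ 2 * `|k| * (s ^+ 2 / 2)); last by field.
  rewrite normrM ler_wpM2l// ger0_norm; have := sqr_ge0 s; lra.
- move=> t /andP[t0 t1]; rewrite (le_trans (uK _ _ _ _))// normrZ ger0_norm//.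
  by rewrite le_eqVlt; apply/orP; left; apply/eqP; ring.
Qed.

(** The same comparison one order higher: [taylor1] bounds the slope by K t^2 |h|^3 / 2, whose
    integral gives the factor 1/6. *)
Lemma taylor2 x h : 0 <= K ->
  `|u (x + h) - u x - u1 x h - u2 x h h / 2| <= K / 6 * `|h| ^+ 3.
Proof.
move=> K0.
have := @quadratic_mean_value
  (fun t => u (x + t *: h) - t * u1 x h - t ^+ 2 * u2 x h h / 2)
  (fun t => u1 (x + t *: h) h - u1 x h - t * u2 x h h)
  (fun t => K * `|h| ^+ 3 * t ^+ 3 / 6) (fun t => K * `|h| ^+ 3 * t ^+ 2 / 2)
  (C * `|h| ^+ 2 + `|u2 x h h|) (K * `|h| ^+ 3).
rewrite scale1r scale0r addr0 !mul1r !mul0r !expr1n !expr0n/= mulr0 !mul0r mulr1 !subr0.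
rewrite (_ : u (x + h) - _ - _ - _ = u (x + h) - u x - u1 x h - u2 x h h / 2); last by ring.
rewrite [K / 6 * _]mulrAC; apply.
- move=> t s t01 s1.
  have := C21_quad0 uC (x + t *: h) (s *: h).
  rewrite -[x + _ + _]addrA -scalerDl u1Z normrZ exprMn real_normK ?num_real// => H.
  rewrite [X in `|X|](_ : _ = (u (x + (t + s) *: h) - u (x + t *: h) -
     s * u1 (x + t *: h) h) - s ^+ 2 / 2 * u2 x h h); last by field.
  rewrite (le_trans (ler_normB _ _))// normrM mulrDl lerD//.
    by rewrite (le_trans H)//; lra.
  rewrite mulrC ler_wpM2l// ger0_norm; have := sqr_ge0 s; lra.
- move=> t s /andP[t0 t1]; rewrite ler_norml => /andP[s1 s2].
  rewrite [X in `|X|](_ : _ = K * `|h| ^+ 3 * (s ^+ 2 * ((3 * t + s) / 6))); last by field.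
  rewrite normrM (@ger0_norm _ (K * _)) ?mulr_ge0 ?exprn_ge0// ler_wpM2l ?mulr_ge0 ?exprn_ge0//.
  rewrite normrM ger0_norm ?sqr_ge0// ler_piMr ?sqr_ge0// ler_norml; apply/andP; split; lra.
- move=> t /andP[t0 t1].
  have := taylor1 x (t *: h) h; rewrite u2Z normrZ ger0_norm// => H.
  rewrite (le_trans H)// le_eqVlt; apply/orP; left; apply/eqP; ring.
Qed.

(** An increment is at most the sharp linear term plus the crude quadratic remainder, which
    subdivision removes. *)
Lemma C21_sharp_lip1 (K2 : R) : (forall x h k, `|u2 x h k| <= K2 * `|h| * `|k|) ->
  forall x h k, `|u1 (x + h) k - u1 x k| <= K2 * `|h| * `|k|.
Proof.
move=> b2 x h k.
have := @lipschitz_of_quadratic _ _ _ (fun y => u1 y k) (K2 * `|k|) (C * `|k|).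
move=> /(_ _ x h); rewrite mulrAC; apply => {x h} x h.
have := C21_quad1 uC x h k; have := b2 x h k.
rewrite !ler_norml => /andP[? ?] /andP[? ?]; apply/andP; split; lra.
Qed.

Lemma C21_sharp_lip0 (K1 : R) : (forall x h, `|u1 x h| <= K1 * `|h|) ->
  forall x h, `|u (x + h) - u x| <= K1 * `|h|.
Proof.
move=> b1 x h; apply: (@lipschitz_of_quadratic _ _ _ _ _ C) => {x h} x h.
have := C21_quad0 uC x h; have := b1 x h.
rewrite !ler_norml => /andP[? ?] /andP[? ?]; apply/andP; split; lra.
Qed.

End Taylor.

(** * Expectations and inner products *)

Section Expectation.
Context d (T : measurableType d) (R : realType) (mu : probability T R).
Implicit Types f g : T -> R.

Definition intg f : Prop := mu.-integrable setT (EFin \o f).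
Definition Ex f : R := \int[mu]_x f x.

Lemma intg_meas f : intg f -> measurable_fun setT f.
Proof. by move=> /integrableP[/measurable_EFinP]. Qed.

Lemma intg_dom f g : measurable_fun setT f -> intg g -> (forall x, `|f x| <= g x) -> intg f.
Proof.
move=> mf ig fg; apply: (le_integrable measurableT _ _ ig).
  exact/measurable_EFinP.
by move=> x _ /=; rewrite lee_fin (le_trans (fg x))// ler_norm.
Qed.

Lemma intg_cst (r : R) : intg (fun=> r).
Proof. exact: finite_measure_integrable_cst. Qed.

Lemma intgD f g : intg f -> intg g -> intg (fun x => f x + g x).
Proof. by move=> fi gi; apply: (integrableD measurableT fi gi). Qed.

Lemma intgB f g : intg f -> intg g -> intg (fun x => f x - g x).
Proof. by move=> fi gi; apply: (integrableB measurableT fi gi). Qed.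

Lemma intgZ (r : R) f : intg f -> intg (fun x => r * f x).
Proof. by move=> fi; apply: (integrableZl measurableT r fi). Qed.

Lemma intg_norm f : intg f -> intg (fun x => `|f x|).
Proof. exact: integrable_norm. Qed.

Lemma ExD f g : intg f -> intg g -> Ex (fun x => f x + g x) = Ex f + Ex g.
Proof. exact: RintegralD. Qed.

Lemma ExB f g : intg f -> intg g -> Ex (fun x => f x - g x) = Ex f - Ex g.
Proof. exact: RintegralB. Qed.

Lemma ExZ (r : R) f : intg f -> Ex (fun x => r * f x) = r * Ex f.
Proof. exact: RintegralZl. Qed.

Lemma Ex_cst (r : R) : Ex (fun=> r) = r.
Proof.
rewrite /Ex Rintegral_cst// [X in fine X](_ : _ = 1%E) ?mulr1//.
exact: probability_setT.
Qed.

Lemma Ex_le f g : intg f -> intg g -> (forall x, f x <= g x) -> Ex f <= Ex g.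
Proof. by move=> fi gi fg; apply: le_Rintegral. Qed.

Lemma Ex_ge0 f : (forall x, 0 <= f x) -> 0 <= Ex f.
Proof. by move=> f0; apply: Rintegral_ge0. Qed.

Lemma Ex_norm f : intg f -> `|Ex f| <= Ex (fun x => `|f x|).
Proof. exact: le_normr_Rintegral. Qed.

Lemma eq_Ex f g : (forall x, f x = g x) -> Ex f = Ex g.
Proof. by move=> fg; apply: eq_Rintegral => x _. Qed.

Lemma intg_sum (I : Type) (r : seq I) (p : pred I) (f : I -> T -> R) :
  (forall i, p i -> intg (f i)) -> intg (fun x => \sum_(i <- r | p i) f i x).
Proof.
move=> fi; elim: r => [|i r ih].
  rewrite (_ : (fun _ => _) = fun=> 0); first exact: intg_cst.
  by apply/funext => x; rewrite big_nil.
have [pi|npi] := boolP (p i); last first.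
  rewrite (_ : (fun _ => _) = (fun x => \sum_(i <- r | p i) f i x))//.
  by apply/funext => x; rewrite big_cons (negbTE npi).
rewrite (_ : (fun _ => _) = (fun x => f i x + \sum_(i <- r | p i) f i x)).
  by apply: intgD => //; exact: fi.
by apply/funext => x; rewrite big_cons pi.
Qed.

Lemma Ex_sum (I : Type) (r : seq I) (p : pred I) (f : I -> T -> R) :
  (forall i, p i -> intg (f i)) ->
  Ex (fun x => \sum_(i <- r | p i) f i x) = \sum_(i <- r | p i) Ex (f i).
Proof.
move=> fi; elim: r => [|i r ih].
  rewrite big_nil -[RHS]Ex_cst; apply: eq_Ex => x; by rewrite big_nil.
rewrite big_cons; case: ifPn => pi; last first.
  by rewrite -ih; apply: eq_Ex => x; rewrite big_cons (negbTE pi).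
rewrite -ih -ExD; [|exact: fi|exact: intg_sum].
by apply: eq_Ex => x; rewrite big_cons pi.
Qed.

Lemma integralE_Ex f : intg f -> (\int[mu]_x (f x)%:E)%E = (Ex f)%:E.
Proof. by move=> fi; rewrite /Ex /Rintegral fineK//; exact: integrable_fin_num. Qed.

Lemma intg_lty f : measurable_fun setT f -> (forall x, 0 <= f x) ->
  (\int[mu]_x (f x)%:E < +oo)%E -> intg f.
Proof.
move=> mf f0 foo; apply/integrableP; split; first exact/measurable_EFinP.
by under eq_integral => x _ do rewrite /= ger0_norm//.
Qed.

Lemma intg_sqr f : measurable_fun setT f -> intg (fun x => f x ^+ 2) -> intg f.
Proof.
move=> mf f2; apply: (intg_dom mf (intgD (intg_cst 1) f2)) => x.
have := sqr_ge0 (`|f x| - 1); have : `|f x| ^+ 2 = f x ^+ 2 by rewrite real_normK ?num_real.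
have := normr_ge0 (f x); nra.
Qed.

Lemma intg_mul f g : measurable_fun setT f -> measurable_fun setT g ->
  intg (fun x => f x ^+ 2) -> intg (fun x => g x ^+ 2) -> intg (fun x => f x * g x).
Proof.
move=> mf mg f2 g2; apply: (intg_dom _ (intgD f2 g2)); first exact: measurable_funM.
move=> x; rewrite ler_norml; apply/andP; split; nra.
Qed.

(** Cauchy-Schwarz: the quadratic form in [key] is the expectation of a square, and is evaluated at
    (-c, a). *)
Lemma Ex_sqr_mul f g : measurable_fun setT f -> measurable_fun setT g ->
  intg (fun x => f x ^+ 2) -> intg (fun x => g x ^+ 2) ->
  `|Ex (fun x => f x * g x)| <=
  Num.sqrt (Ex (fun x => f x ^+ 2)) * Num.sqrt (Ex (fun x => g x ^+ 2)).
Proof.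
move=> mf mg f2 g2.
set a := Ex (fun x => f x ^+ 2); set b := Ex (fun x => g x ^+ 2).
set c := Ex (fun x => f x * g x).
have fg := intg_mul mf mg f2 g2.
have a0 : 0 <= a by apply: Ex_ge0 => x; exact: sqr_ge0.
have b0 : 0 <= b by apply: Ex_ge0 => x; exact: sqr_ge0.
have key (s t : R) : 0 <= s ^+ 2 * a + 2 * s * t * c + t ^+ 2 * b.
  have i1 := intgZ (s ^+ 2) f2; have i2 := intgZ (2 * s * t) fg.
  have i3 := intgZ (t ^+ 2) g2.
  rewrite -(ExZ (s ^+ 2) f2) -(ExZ (2 * s * t) fg) -(ExZ (t ^+ 2) g2).
  rewrite -(ExD i1 i2) -(ExD (intgD i1 i2) i3).
  apply: Ex_ge0 => x; rewrite [leRHS](_ : _ = (s * f x + t * g x) ^+ 2); last by ring.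
  exact: sqr_ge0.
rewrite -sqrtrM// -sqrtr_sqr ler_wsqrtr//.
have [a00|an0] := eqVneq a 0.
  rewrite a00 mul0r.
  have : c = 0.
    apply/eqP/negPn/negP => cn0.
    (* With a = 0 this choice makes the form equal to -1. *)
    have := key (- ((b + 1) / (2 * c))) 1.
    rewrite a00 !mulr0 mulr1 expr1n mul1r.
    rewrite (_ : _ + _ + b = -1)//; last by field.
    by rewrite lerNr oppr0 ler10.
  by move->; rewrite expr0n.
have := key (- c) a.
rewrite (_ : _ + _ + _ = a * (a * b - c ^+ 2)); last by ring.
by rewrite pmulr_rge0 ?lt_def ?an0// subr_ge0.
Qed.

End Expectation.

Section HilbertDot.
Context (R : realType) (H : hilbertType R).
Implicit Types x y z : H.

Lemma dotDr x y z : dot x (y + z) = dot x y + dot x z.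
Proof. by rewrite dotC dotDl dotC [dot z x]dotC. Qed.

Lemma dotZr (a : R) x y : dot x (a *: y) = a * dot x y.
Proof. by rewrite dotC dotZl dotC. Qed.

Lemma dotNr x y : dot x (- y) = - dot x y.
Proof. by rewrite -scaleN1r dotZr mulN1r. Qed.

Lemma dotBr x y z : dot x (y - z) = dot x y - dot x z.
Proof. by rewrite dotDr dotNr. Qed.

Lemma dot0l x : dot 0 x = 0 :> R.
Proof. by rewrite -(scale0r 0) dotZl mul0r. Qed.

Lemma normrD_sqr x y : `|x + y| ^+ 2 = `|x| ^+ 2 + 2 * dot x y + `|y| ^+ 2.
Proof. by rewrite -!dotxx dotDl !dotDr [dot y x]dotC; ring. Qed.

Lemma dot_le x y : `|dot x y| <= `|x| * `|y|.
Proof.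
have key (s t : R) : 0 <= s ^+ 2 * `|x| ^+ 2 + 2 * s * t * dot x y + t ^+ 2 * `|y| ^+ 2.
  have := sqr_ge0 (`|s *: x + t *: y|); rewrite normrD_sqr !normrZ !exprMn.
  by rewrite !real_normK ?num_real// dotZl dotZr !mulrA.
have [->|x0] := eqVneq x 0; first by rewrite dot0l !normr0 mul0r.
have x20 : 0 < `|x| ^+ 2 by rewrite exprn_gt0// normr_gt0.
rewrite -(@ler_pXn2r _ 2) ?nnegrE ?mulr_ge0// real_normK ?num_real// exprMn.
have := key (- dot x y) (`|x| ^+ 2).
rewrite (_ : _ + _ + _ = `|x| ^+ 2 * (`|x| ^+ 2 * `|y| ^+ 2 - dot x y ^+ 2)); last by ring.
by rewrite pmulr_rge0// subr_ge0.
Qed.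

Lemma lipschitz_cvg (V W : normedModType R) (f : V -> W) (C : R) :
  (forall x y : V, `|f x - f y| <= C * `|x - y|) -> continuous f.
Proof.
move=> fC x; apply/cvgrPdist_le => e e0.
have C0 : 0 < `|C| + 1 by rewrite ltr_wpDl.
near=> y.
rewrite (le_trans (fC _ _))// (le_trans (_ : _ <= (`|C| + 1) * `|x - y|))//.
  by rewrite ler_wpM2r// (le_trans (ler_norm _))// lerDl.
rewrite -ler_pdivlMl//; near: y.
by apply: cvgr_dist_le; rewrite ?mulr_gt0 ?invr_gt0.
Unshelve. all: by end_near. Qed.

Lemma dot_continuous x : continuous (dot x : H -> R).
Proof.
apply: (@lipschitz_cvg _ _ _ `|x|) => y z.
by rewrite -[- dot x z]mulN1r -dotZr scaleN1r -dotDr dot_le.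
Qed.

End HilbertDot.

(** * Borel measurability in a separable Hilbert space *)

Lemma separable_seq (R : realType) (H : normedModType R) : separable_space H ->
  exists s : nat -> H, forall x e, 0 < e -> exists n, `|x - s n| < e.
Proof.
move=> [D cD dD].
have [s sD] : exists s : nat -> H, D `<=` range s.
  have /pfcard_geP[->|[s]] := cD; first by exists (fun=> 0).
  by exists s => x /(@surj _ _ _ _ s)[n _ <-]; exists n.
exists s => x e e0.
have [||y [xy /sD[n _ ny]]] := dD (ball x e).
- by exists x; exact: ballxx.
- exact: ball_open.
by exists n; rewrite ny; move: xy; rewrite -ball_normE.
Qed.

Section BorelMeasurability.
Context (R : realType) (H : hilbertType R) (H_sep : separable_space H).
Context d (T : measurableType d).

Definition mfH (X : T -> H) : Prop := measurable_fun setT (X : T -> borel H).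

Lemma measurable_fun_gt (f : T -> R) : (forall a, measurable [set t | a < f t]) ->
  measurable_fun setT f.
Proof.
move=> mf; apply: (measurability _ (RGenOInfty.measurableE R)).
move=> _ [_ [a ->] <-]; rewrite setTI.
rewrite (_ : _ @^-1` _ = [set t | a < f t])//.
by apply/seteqP; split=> t /=; rewrite in_itv/= andbT.
Qed.

Lemma measurable_gt (f g : T -> R) : measurable_fun setT f -> measurable_fun setT g ->
  measurable [set t | f t < g t].
Proof.
move=> mf mg; have := measurable_fun_ltr mf mg.
move=> /(_ measurableT [set true]); rewrite setTI; apply.
by [].
Qed.

Lemma mfH_continuous (X : T -> H) (h : H -> R) : mfH X -> continuous h ->
  measurable_fun setT (fun t => h (X t)).
Proof.
move=> mX ch; apply: measurable_fun_gt => a.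
have := mX measurableT [set x | a < h x]; rewrite setTI; apply.
apply: sub_sigma_algebra => /=.
have : open (h @^-1` [set y | a < y]).
  by apply: open_comp => [x _|]; [exact: ch|exact: open_gt].
by [].
Qed.

Lemma mfH_norm (X : T -> H) a : mfH X -> measurable_fun setT (fun t => `|X t - a|).
Proof.
move=> mX; apply: (@mfH_continuous X (fun x => `|x - a|) mX) => x.
apply: (@continuous_comp _ _ _ (fun x => x - a) (fun x => `|x|)).
  by apply: continuousB; [exact: cvg_id|exact: cst_continuous].
exact: norm_continuous.
Qed.

Lemma mfH_norm0 (X : T -> H) : mfH X -> measurable_fun setT (fun t => `|X t|).
Proof.
by move=> /(mfH_norm 0); congr measurable_fun; apply/funext => t; rewrite subr0.
Qed.

(** In a separable space an open set is a countable union of balls centred in a dense sequence, so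
    distances to fixed points decide Borel measurability. *)
Lemma mfH_of_norm (X : T -> H) :
  (forall a, measurable_fun setT (fun t => `|X t - a|)) -> mfH X.
Proof.
move=> mX; have [s sP] := separable_seq H_sep.
apply: (@measurability _ _ T (borel H) setT X (@open H)) => [//|_ [U oU <-]]; rewrite setTI.
pose P n m := `[< ball (s n) m.+1%:R^-1 `<=` U >].
rewrite (_ : _ @^-1` _ = \bigcup_n \bigcup_m
    (if P n m then [set t | `|X t - s n| < m.+1%:R^-1] else set0)).
  apply: bigcupT_measurable => n; apply: bigcupT_measurable => m.
  by case: ifP => // _; exact: measurable_gt.
apply/seteqP; split=> t /=.
- move=> Ut.
  have /nbhs_ballP[e /= e0 eU] : nbhs (X t) U by exact: open_nbhs_nbhs.
  (* The radius 1 / (m + 1) is at most e / 2, so a ball of this radius that contains [X t] lies in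
     the ball of radius e. *)
  pose m := Num.truncn (2 / e).
  have me : m.+1%:R^-1 <= e / 2.
    rewrite -(invrK (e / 2)) lef_pV2 ?posrE ?ltr0n ?invr_gt0 ?divr_gt0//.
    by rewrite invf_div ltW// truncnS_gt.
  have [n nX] := sP (X t) m.+1%:R^-1 ltac:(by rewrite invr_gt0).
  exists n => //; exists m => //; rewrite (_ : P n m)//.
  apply/asboolP => y; rewrite -ball_normE /ball_/= => yn; apply: eU.
  rewrite -ball_normE /ball_/=.
  rewrite -(subrKA (s n)) (le_lt_trans (ler_normD _ _))//.
  rewrite (splitr e) ltr_leD// ?(lt_le_trans nX)// ltW// (lt_le_trans yn)//.
- move=> [n _ [m _]]; case: ifPn => // /asboolP + /= nX; apply.
  by rewrite -ball_normE /ball_/= distrC.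
Qed.

Lemma measurable_countable_choice (f : nat -> T -> R) (I : T -> nat) :
  (forall n, measurable_fun setT (f n)) -> (forall n, measurable [set t | I t = n]) ->
  measurable_fun setT (fun t => f (I t) t).
Proof.
move=> mf mI; apply: measurable_fun_gt => a.
rewrite (_ : [set _ | _] = \bigcup_n ([set t | I t = n] `&` [set t | a < f n t])).
  apply: bigcupT_measurable => n; apply: measurableI => //.
  by apply: measurable_gt.
apply/seteqP; split=> t /=; first by exists (I t).
by move=> [n _ [/= <-]].
Qed.

Lemma measurable_first (p : nat -> pred T) (ex : forall t, exists n, p n t) :
  (forall n, measurable [set t | p n t]) ->
  forall n, measurable [set t | ex_minn (ex t) = n].
Proof.
move=> mp n.
rewrite (_ : [set _ | _] = [set t | p n t] `&` \bigcap_(m < n) ~` [set t | p m t]).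
  apply: measurableI => //; apply: bigcap_measurableType => m _; exact: measurableC.
apply/seteqP; split=> t /=.
  case: ex_minnP => m pm mmin <-; split=> // k /= km pk.
  by have := mmin k pk; rewrite leqNgt km.
move=> [pn nn]; case: ex_minnP => m pm mmin; apply/eqP; rewrite eqn_leq mmin//= leqNgt.
by apply/negP => mn; exact: (nn m mn).
Qed.

(** [X] is replaced by the first term of a dense sequence within 1 / (k + 1) of it: a countably
    valued approximation, for which measurability is checked value by value. Continuity in the point
    gives the limit. *)
Lemma caratheodory (f : H -> T -> R) (X : T -> H) :
  (forall t, continuous (f ^~ t)) -> (forall x, measurable_fun setT (f x)) ->
  mfH X -> measurable_fun setT (fun t => f (X t) t).
Proof.
move=> cf mf mX; have [s sP] := separable_seq H_sep.
have ex k t : exists n, `|X t - s n| < k.+1%:R^-1 by apply: sP; rewrite invr_gt0.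
pose Xk k t := s (ex_minn (ex k t)).
have XkX t : Xk ^~ t @ \oo --> X t.
  apply/cvgrPdist_lt => e e0; near=> k.
  rewrite /Xk; case: ex_minnP => m mk _; rewrite (lt_trans mk)//.
  by near: k; exact: near_infty_natSinv_lt (PosNum e0).
apply: (@measurable_fun_cvg _ _ _ _ (fun k t => f (Xk k t) t)).
  move=> k; rewrite /Xk.
  apply: (@measurable_countable_choice (fun n => f (s n)) (fun t => ex_minn (ex k t))); first by move=> n; exact: mf.
  apply: (@measurable_first (fun n t => `|X t - s n| < k.+1%:R^-1) (ex k)) => n.
  by apply: measurable_gt => //; exact: mfH_norm.
by move=> t _; exact: (cvg_comp (Xk ^~ t) (f ^~ t) (XkX t) (cf t _)).
Unshelve. all: by end_near. Qed.

Lemma mfH_caratheodory (f : H -> T -> H) (X : T -> H) :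
  (forall t, continuous (f ^~ t)) -> (forall x, mfH (f x)) ->
  mfH X -> mfH (fun t => f (X t) t).
Proof.
move=> cf mf mX; apply: mfH_of_norm => a.
apply: (@caratheodory (fun x t => `|f x t - a|)) => // [t|x]; last exact: mfH_norm.
move=> x; apply: (@continuous_comp _ _ _ (fun x => f x t - a) (fun x => `|x|)).
  by apply: continuousB; [exact: cf|exact: cst_continuous].
exact: norm_continuous.
Qed.

(* Pettis: [|x| > a >= 0] iff [<x, d> > a |d|] for some [d] in a dense sequence. *)
Lemma mfH_pettis (X : T -> H) : (forall h, measurable_fun setT (fun t => dot (X t) h)) ->
  mfH X.
Proof.
move=> mX; have [s sP] := separable_seq H_sep.
have mn : measurable_fun setT (fun t => `|X t|).
  apply: measurable_fun_gt => a; have [a0|a0] := ltP a 0.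
    rewrite (_ : [set _ | _] = setT)//; apply/seteqP; split=> t//= _.
    exact: lt_le_trans a0 _.
  rewrite (_ : [set _ | _] = \bigcup_n [set t | a * `|s n| < dot (X t) (s n)]).
    by apply: bigcupT_measurable => n; apply: measurable_gt => //; exact: mX.
  apply/seteqP; split=> t /=.
    (* A distance r from [X t] to [s n] costs at most r |X t| in the inner product and a r on the
       other side; r < e yields r (|X t| + a) < |X t| (|X t| - a). *)
    move=> aX; pose e := (`|X t| - a) * `|X t| / (`|X t| + a + 1).
    have X0 : 0 < `|X t| by exact: le_lt_trans aX.
    have p0 : 0 < `|X t| + a + 1 by rewrite ltr_wpDl// addr_ge0.
    have e0 : 0 < e by rewrite divr_gt0// mulr_gt0// subr_gt0.
    have [n nX] := sP (X t) e e0; exists n => //=.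
    have -> : dot (X t) (s n) = `|X t| ^+ 2 - dot (X t) (X t - s n).
      by rewrite dotBr dotxx; ring.
    have := dot_le (X t) (X t - s n); rewrite ler_norml => /andP[_ le1].
    have le2 : `|s n| <= `|X t| + `|X t - s n|.
      by rewrite -[in leLHS](subrK (X t) (s n)) addrC (le_trans (ler_normD _ _))// distrC.
    move: nX; rewrite /e ltr_pdivlMr// => nX.
    have := normr_ge0 (X t - s n).
    set x := `|X t| in X0 aX le1 le2 nX *; set y := `|X t - s n| in le1 le2 nX *.
    move=> y0; have := ler_wpM2l a0 le2; nra.
  move=> [n _ /= an]; have := dot_le (X t) (s n); rewrite ler_norml => /andP[_ le1].
  have := lt_le_trans an le1; have [->|sn0] := eqVneq (s n) 0.
    by rewrite normr0 !mulr0 ltxx.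
  by rewrite ltr_pM2r// normr_gt0.
apply: mfH_of_norm => a.
have : measurable_fun setT (fun t => Num.sqrt (`|X t| ^+ 2 - 2 * dot (X t) a + `|a| ^+ 2)).
  have ms : measurable_fun setT (Num.sqrt : R -> R).
    by apply: continuous_measurable_fun; exact: sqrt_continuous.
  apply: (measurableT_comp ms).
  apply: measurable_funD => //; apply: measurable_funB.
    exact: measurable_funX.
  by apply: measurable_funM => //; exact: mX.
congr measurable_fun; apply/funext => t.
have -> : `|X t| ^+ 2 - 2 * dot (X t) a + `|a| ^+ 2 = `|X t - a| ^+ 2.
  by rewrite normrD_sqr normrN dotNr; ring.
by rewrite sqrtr_sqr normr_id.
Qed.

(** A gradient is not assumed continuous in the point, so [caratheodory] cannot be applied to [g].
    Its inner products with h are limits of difference quotients of [F t], which is continuous, and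
    [mfH_pettis] concludes. This is what makes V measurable along random iterates. *)
Lemma mfH_gradient (F : T -> H -> R) (g : T -> H -> H) (X : T -> H) :
  (forall t x, is_gradient (F t) x (g t x)) ->
  (forall x, measurable_fun setT (F ^~ x)) ->
  mfH X -> mfH (fun t => g t (X t)).
Proof.
move=> Fg mF mX; apply: mfH_pettis => h.
have mFX v : measurable_fun setT (fun t => F t (X t + v)).
  apply: (@caratheodory (fun x t => F t (x + v))) => // t x.
  apply: (@continuous_comp _ _ _ (fun x => x + v) (F t)).
    by apply: continuousD; [exact: cvg_id|exact: cst_continuous].
  apply: differentiable_continuous; have [] := Fg t (x + v); done.
apply: (@measurable_fun_cvg _ _ _ _
  (fun n t => n.+1%:R * (F t (X t + n.+1%:R^-1 *: h) - F t (X t + 0)))).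
  by move=> n; apply: measurable_funM => //; apply: measurable_funB; exact: mFX.
move=> t _; have [dF dFE] := Fg t (X t).
apply/cvgrPdist_le => e e0; rewrite -dFE.
have h0 : 0 < `|h| + 1 by rewrite ltr_wpDl.
have [dl d0 dlP] := differentiable_eps dF (divr_gt0 e0 h0).
near=> n.
have n0 : 0 < n.+1%:R :> R by rewrite ltr0n.
have /dlP : `|n.+1%:R^-1 *: h| < dl.
  rewrite normrZ gtr0_norm ?invr_gt0//.
  rewrite (@le_lt_trans _ _ (n.+1%:R^-1 * (`|h| + 1)))//.
    by rewrite ler_wpM2l ?invr_ge0 ?ler0n// lerDl.
  rewrite -ltr_pdivlMr//; near: n.
  exact: near_infty_natSinv_lt (PosNum (divr_gt0 d0 h0)).
rewrite addr0 linearZ/=.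
set D := F t _ - F t (X t).
rewrite distrC normrZ gtr0_norm ?invr_gt0// => dD; rewrite distrC.
have -> : n.+1%:R * D - 'd (F t) (X t) h =
   n.+1%:R * (D - n.+1%:R^-1 *: 'd (F t) (X t) h).
  rewrite [RHS]mulrBr (_ : n.+1%:R^-1 *: 'd (F t) (X t) h = n.+1%:R^-1 * 'd (F t) (X t) h)//.
  by rewrite mulrA divff ?gt_eqF// mul1r.
rewrite normrM gtr0_norm// -ler_pdivlMl// distrC (le_trans dD)//.
rewrite mulrCA ler_wpM2l ?invr_ge0 ?ler0n// ltW// mulrAC ltr_pdivrMr// ltr_pM2l//.
by rewrite ltrDl.
Unshelve. all: by end_near. Qed.

End BorelMeasurability.

Section BorelClosure.
Context (R : realType) (H : hilbertType R) (H_sep : separable_space H).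
Context d (T : measurableType d).
Implicit Types X Y : T -> H.

Lemma mfH_comp X (h : H -> H) : mfH X -> continuous h -> mfH (fun t => h (X t)).
Proof.
move=> mX ch; apply: mfH_of_norm => // a.
apply: (@mfH_continuous _ _ _ _ X (fun x => `|h x - a|)) => // x.
apply: (@continuous_comp _ _ _ (fun x => h x - a) (fun x => `|x|)).
  by apply: continuousB; [exact: ch|exact: cst_continuous].
exact: norm_continuous.
Qed.

Lemma mfH_cst (x : H) : mfH (fun _ : T => x).
Proof. exact: measurable_cst. Qed.

(** Addition is not a function of one Borel variable: [mfH_caratheodory] is used with [X] as the
    random point and [Y] as the random parameter. *)
Lemma mfHD X Y : mfH X -> mfH Y -> mfH (fun t => X t + Y t).
Proof.
move=> mX mY; apply: (mfH_caratheodory H_sep (f := fun x t => x + Y t)) => // [t x|x].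
  by apply: continuousD; [exact: cvg_id|exact: cst_continuous].
apply: mfH_of_norm => // a.
rewrite (_ : (fun _ => _) = (fun t => `|Y t - (a - x)|)); first exact: mfH_norm.
by apply/funext => t; rewrite opprB addrA [Y t + x]addrC.
Qed.

Lemma mfHZ (c : T -> R) X : measurable_fun setT c -> mfH X -> mfH (fun t => c t *: X t).
Proof.
move=> mc mX; apply: (mfH_caratheodory H_sep (f := fun x t => c t *: x)) => // [t x|x].
  exact: scaler_continuous.
apply: mfH_of_norm => // a.
have ch : continuous (fun r : R => `|r *: x - a|).
  move=> r; apply: (@continuous_comp _ _ _ (fun r : R => r *: x - a) (fun x => `|x|)).
    by apply: continuousB; [exact: scalel_continuous|exact: cst_continuous].
  exact: norm_continuous.
exact: (measurableT_comp (continuous_measurable_fun ch)).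
Qed.

Lemma mfHB X Y : mfH X -> mfH Y -> mfH (fun t => X t - Y t).
Proof.
move=> mX mY; have := mfHD mX (mfHZ (measurable_cst (-1 : R)) mY).
by congr mfH; apply/funext => t /=; rewrite scaleN1r.
Qed.

Lemma mfH_sum (I : Type) (r : seq I) (p : pred I) (X : I -> T -> H) :
  (forall i, p i -> mfH (X i)) -> mfH (fun t => \sum_(i <- r | p i) X i t).
Proof.
move=> mX; elim: r => [|i r ih].
  rewrite (_ : (fun _ => _) = fun=> 0); first exact: mfH_cst.
  by apply/funext => x; rewrite big_nil.
have [pi|npi] := boolP (p i); last first.
  rewrite (_ : (fun _ => _) = (fun x => \sum_(i <- r | p i) X i x))//.
  by apply/funext => x; rewrite big_cons (negbTE npi).
rewrite (_ : (fun _ => _) = (fun x => X i x + \sum_(i <- r | p i) X i x)).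
  by apply: mfHD => //; exact: mX.
by apply/funext => x; rewrite big_cons pi.
Qed.

End BorelClosure.

(** * Fubini's theorem for independent sigma-algebras *)

Section IndependentSystems.
Context d (T : measurableType d) (R : realType) (P : probability T R).
Variables G1 G2 : set (set T).
Hypotheses (G1m : G1 `<=` measurable) (G2m : G2 `<=` measurable).
Hypotheses (G1T : G1 setT) (G2T : G2 setT).
Hypotheses (G1I : setI_closed G1) (G2I : setI_closed G2).
Hypothesis G12 : forall A B, G1 A -> G2 B -> P (A `&` B) = (P A * P B)%E.

(** Uniqueness of finite measures on a pi-system, for the restriction of [P] to A and the multiple
    P(A) of [P]. *)
Let pi_extend (G : set (set T)) (A : set T) : G `<=` measurable -> G setT -> setI_closed G ->
  measurable A -> (forall B, G B -> P (A `&` B) = (P A * P B)%E) ->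
  forall B, <<s G >> B -> P (A `&` B) = (P A * P B)%E.
Proof.
move=> Gm GT GI mA GA B sB.
have PA0 : 0 <= fine (P A) by exact: fine_ge0.
have PAfin : P A \is a fin_num by exact: fin_num_measure.
have e1 : (NngNum PA0)%:num%:E = P A by rewrite /= fineK.
have cov : \bigcup_(k : nat) [set: T] = setT by rewrite bigcup_const//; exists 0%N.
rewrite -e1 setIC.
apply: (@g_sigma_algebra_measure_unique _ R T G Gm (fun=> setT) (fun=> GT) cov
  (mrestr P mA) (mscale (NngNum PA0) P) GI _ _ B sB).
- by move=> C GC; rewrite /= /mrestr /mscale e1 setIC GA.
- by move=> _; rewrite /= /mrestr setTI -ge0_fin_numE// fin_num_measure.
Qed.

Let mG1 E : <<s G1 >> E -> measurable E.
Proof. by apply: smallest_sub => //; exact: sigma_algebra_measurable. Qed.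
Let mG2 E : <<s G2 >> E -> measurable E.
Proof. by apply: smallest_sub => //; exact: sigma_algebra_measurable. Qed.

Lemma indep_sigma A B : <<s G1 >> A -> <<s G2 >> B -> P (A `&` B) = (P A * P B)%E.
Proof.
move=> sA sB.
rewrite setIC muleC; apply: (pi_extend G1m G1T G1I) => //; first exact: mG2.
move=> C GC; rewrite setIC muleC; apply: (pi_extend G2m G2T G2I) => //; first exact: G1m.
by move=> D GD; exact: G12.
Qed.

Let T1 := g_sigma_algebraType G1.
Let T2 := g_sigma_algebraType G2.

Lemma measurable_sub1 : measurable_fun setT (id : T -> T1).
Proof. by move=> _ A sA; rewrite setTI; exact: mG1. Qed.
Lemma measurable_sub2 : measurable_fun setT (id : T -> T2).
Proof. by move=> _ A sA; rewrite setTI; exact: mG2. Qed.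

(** By independence the law of the diagonal map is the product of the restrictions of [P] to the two
    sigma-algebras. A function f (w, w) is then integrated by Fubini, with no conditional
    expectations. *)
Let diag (w : T) : T1 * T2 := (w, w).
Let mdiag : measurable_fun setT diag.
Proof. by apply: measurable_fun_pair; [exact: measurable_sub1|exact: measurable_sub2]. Qed.

Let id1 : {mfun T >-> T1} := HB.pack (id : T -> T1) (isMeasurableFun.Build _ _ _ _ _ measurable_sub1).
Let id2 : {mfun T >-> T2} := HB.pack (id : T -> T2) (isMeasurableFun.Build _ _ _ _ _ measurable_sub2).
Let idd : {mfun T >-> (T1 * T2)%type} := HB.pack diag (isMeasurableFun.Build _ _ _ _ _ mdiag).
Let P1 : probability T1 R := distribution P id1.
Let P2 : probability T2 R := distribution P id2.

Let law X : measurable X -> (P1 \x P2)%E X = distribution P idd X.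
Proof.
move=> mX; apply: product_measure_unique => // A B mA mB.
rewrite /distribution/= /pushforward/= -indep_sigma//.
Qed.

Lemma indep_tonelli (f : T1 * T2 -> R) : measurable_fun setT f -> (forall p, 0 <= f p) ->
  (\int[P]_w (f (w, w))%:E = \int[P]_w1 \int[P]_w2 (f (w1, w2))%:E)%E.
Proof.
move=> mf f0.
have mEf : measurable_fun setT (EFin \o f) by exact/measurable_EFinP.
have f0' p : (0 <= (EFin \o f) p)%E by rewrite lee_fin.
transitivity (\int[distribution P idd]_p (f p)%:E)%E.
  by rewrite (ge0_integral_distribution idd mEf f0').
transitivity (\int[(P1 \x P2)%E]_p (f p)%:E)%E.
  by apply: eq_measure_integral => A mA _; exact/esym/law.
rewrite (fubini_tonelli1 (EFin \o f))//.
have mF := measurable_fun_fubini_tonelli_F (m2 := P2) (EFin \o f) mEf f0'.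
rewrite (ge0_integral_distribution id1)//; last first.
  by move=> y; apply: integral_ge0 => z _; exact: f0'.
apply: eq_integral => w1 _ /=.
rewrite /fubini_F (ge0_integral_distribution id2)//.
exact: measurableT_comp.
Qed.

Let indep_fubini_ge0 (f : T1 * T2 -> R) : measurable_fun setT f -> (forall p, 0 <= f p) ->
  (forall w1 : T, intg P (fun w2 : T => f (w1, w2))) -> intg P (fun w : T => f (w, w)) ->
  intg P (fun w1 : T => Ex P (fun w2 : T => f (w1, w2))) /\
  Ex P (fun w : T => f (w, w)) = Ex P (fun w1 : T => Ex P (fun w2 : T => f (w1, w2))).
Proof.
move=> mf f0 if1 ifd.
have E1 (w1 : T) : (\int[P]_w2 (f (w1, w2))%:E = (Ex P (fun w2 => f (w1, w2)))%:E)%E.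
  exact: integralE_Ex.
have ton := indep_tonelli mf f0; rewrite (integralE_Ex ifd) in ton.
rewrite (eq_integral (fun w1 : T => (Ex P (fun w2 => f (w1, w2)))%:E)) in ton; last first.
  by move=> w1 _; rewrite E1.
have i1 : intg P (fun w1 : T => Ex P (fun w2 => f (w1, w2))).
  apply: intg_lty; last by rewrite -ton ltry.
    have mEf : measurable_fun setT (EFin \o f) by exact/measurable_EFinP.
    have f0' p : (0 <= (EFin \o f) p)%E by rewrite lee_fin.
    have mF := measurable_fun_fubini_tonelli_F (m2 := P2) (EFin \o f) mEf f0'.
    have := measurableT_comp mF measurable_sub1.
    move=> /(measurableT_comp (@fine_measurable R setT measurableT)).
    congr measurable_fun; apply/funext => w1 /=; rewrite /fubini_F.
    by rewrite (ge0_integral_distribution id2)//; exact: measurableT_comp.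
  by move=> w1; apply: Ex_ge0.
split=> //; apply: EFin_inj.
by rewrite ton integralE_Ex.
Qed.

(** Reduction to the nonnegative functions |f| and |f| + f. *)
Lemma indep_fubini (f : T1 * T2 -> R) : measurable_fun setT f ->
  (forall w1 : T, intg P (fun w2 : T => f (w1, w2))) -> intg P (fun w : T => f (w, w)) ->
  intg P (fun w1 : T => Ex P (fun w2 : T => f (w1, w2))) /\
  Ex P (fun w : T => f (w, w)) = Ex P (fun w1 : T => Ex P (fun w2 : T => f (w1, w2))).
Proof.
move=> mf if1 ifd.
have mn : measurable_fun setT (fun p => `|f p|) by exact: measurableT_comp.
have [i1 e1] := indep_fubini_ge0 mn (fun=> normr_ge0 _) (fun w1 => intg_norm (if1 w1)) (intg_norm ifd).
have s0 p : 0 <= `|f p| + f p by rewrite -lerBlDr sub0r; have := ler_norm (- f p); rewrite normrN.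
have [i2 e2] := indep_fubini_ge0 (measurable_funD mn mf) s0
  (fun w1 => intgD (intg_norm (if1 w1)) (if1 w1)) (intgD (intg_norm ifd) ifd).
have key (w1 : T) : Ex P (fun w2 => f (w1, w2)) =
    Ex P (fun w2 => `|f (w1, w2)| + f (w1, w2)) - Ex P (fun w2 => `|f (w1, w2)|).
  by rewrite (ExD (intg_norm (if1 w1)) (if1 w1)); ring.
split.
  rewrite (_ : (fun _ => _) = (fun w1 => Ex P (fun w2 => `|f (w1, w2)| + f (w1, w2)) -
    Ex P (fun w2 => `|f (w1, w2)|))); first exact: intgB.
  by apply/funext => w1; rewrite key.
by rewrite (eq_Ex _ key) ExB// -e1 -e2 (ExD (intg_norm ifd) ifd); ring.
Qed.

End IndependentSystems.

(** * Independent blocks of random variables *)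

Section Cylinders.
Context (I : eqType) d' (S : measurableType d') (T : Type).
Variable X : I -> T -> S.

(** A pi-system generating the sigma-algebra of the coordinates in [J]. Its members have the form
    that occurs in [mutually_independent], so disjoint blocks are independent on generators. *)
Definition cyl (J : {pred I}) : set (set T) :=
  [set C | exists (s : seq I) (A : I -> set S), [/\ uniq s, {subset s <= J},
     forall i, measurable (A i) & C = \bigcap_(i in [set` s]) (X i @^-1` A i)]].

Lemma cylT J : cyl J setT.
Proof.
exists [::], (fun=> setT); split=> //.
by apply/seteqP; split=> // t _ i.
Qed.

Lemma cyl_coord J i A : i \in J -> measurable A -> cyl J (X i @^-1` A).
Proof.
move=> iJ mA; exists [:: i], (fun=> A); split=> //.
  by move=> j; rewrite inE => /eqP ->.
apply/seteqP; split=> t /=; first by move=> tA j /=; rewrite inE => /eqP ->.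
by apply; rewrite /= inE.
Qed.

(** The index lists are merged; a coordinate constrained in only one of them gets the full space
    from the other. *)
Lemma cylI J : setI_closed (cyl J).
Proof.
move=> _ _ [s [A [us sJ mA ->]]] [r [B [ur rJ mB ->]]].
exists (undup (s ++ r)), (fun i => (if i \in s then A i else setT) `&` (if i \in r then B i else setT)).
split=> [||i|]; first exact: undup_uniq.
- by move=> i; rewrite mem_undup mem_cat => /orP[/sJ|/rJ].
- by apply: measurableI; case: ifP.
apply/seteqP; split=> t /=.
  by move=> [tA tB] i /= _; split; case: ifPn => // ?; [exact: tA|exact: tB].
move=> tAB; split=> i /= ii.
  by have [] := tAB i; rewrite /= ?mem_undup ?mem_cat ?ii.
by have [] := tAB i; rewrite /= ?mem_undup ?mem_cat ?ii ?orbT.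
Qed.

End Cylinders.

Lemma cyl_measurable (I : eqType) d' (S : measurableType d') d (T : measurableType d)
    (X : I -> T -> S) (J : {pred I}) :
  (forall i, i \in J -> measurable_fun setT (X i)) -> cyl X J `<=` measurable.
Proof.
move=> mX _ [s [A [us sJ mA ->]]].
apply: fin_bigcap_measurable; first exact: finite_seq.
move=> i /= /sJ iJ; rewrite -[X in measurable X]setTI; exact: mX.
Qed.

Lemma measurable_cyl_coord (I : eqType) d' (S : measurableType d') (T : pointedType)
    (X : I -> T -> S) (J : {pred I}) i : i \in J ->
  measurable_fun setT (X i : g_sigma_algebraType (cyl X J) -> S).
Proof.
move=> iJ _ A mA; rewrite setTI; apply: sub_sigma_algebra; exact: cyl_coord.
Qed.

Section Blocks.
Context (I : eqType) d' (S : measurableType d') d (T : measurableType d)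
  (R : realType) (P : probability T R) (X : I -> {RV P >-> S}).
Variables (J J1 J2 : {pred I}).
Hypotheses (X_indep : mutually_independent J X) (J1J : {subset J1 <= J})
  (J2J : {subset J2 <= J}) (J12 : forall i, i \in J1 -> i \notin J2).

Let G1 := cyl (fun i => X i : T -> S) J1.
Let G2 := cyl (fun i => X i : T -> S) J2.
Let mX i : measurable_fun setT (X i : T -> S). Proof. by []. Qed.

Let cyl_indep A B : G1 A -> G2 B -> P (A `&` B) = (P A * P B)%E.
Proof.
move=> [s [A' [us sJ mA ->]]] [r [B' [ur rJ mB ->]]].
have srd i : i \in s -> i \in r = false.
  by move=> /sJ /J12; apply: contraNF => /rJ.
pose C i := if i \in s then A' i else B' i.
have mC i : measurable (C i) by rewrite /C; case: ifP.
have usr : uniq (s ++ r).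
  rewrite cat_uniq us ur andbT/=; apply/hasPn => i ir; apply/negP => /= is_.
  by rewrite srd in ir.
have srJ : {subset s ++ r <= J}.
  by move=> i; rewrite mem_cat => /orP[/sJ/J1J|/rJ/J2J].
have := X_indep usr srJ mC.
rewrite big_cat/= (X_indep us (fun i is_ => J1J (sJ i is_)) mA).
rewrite (X_indep ur (fun i ir => J2J (rJ i ir)) mB).
rewrite (eq_big_seq (fun i => P (X i @^-1` A' i))); last first.
  by move=> i is_; rewrite /C is_.
rewrite [X in (_ * X)%E](eq_big_seq (fun i => P (X i @^-1` B' i))); last first.
  move=> i ir; rewrite /C; case: ifPn => // is_; by rewrite srd in ir.
move=> <-; congr (P _); apply/seteqP; split=> t /=.
  move=> [tA tB] i /=; rewrite mem_cat /C; case: ifPn => [is_ _|_ /= ir]; first exact: tA.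
  exact: tB.
move=> tC; split=> i /= ii.
  by have := tC i; rewrite /= mem_cat ii /C ii; apply.
have := tC i; rewrite /= mem_cat ii orbT /C; case: ifPn => [is_|_]; last exact.
by rewrite srd in ii.
Qed.

Let T1 := g_sigma_algebraType G1.
Let T2 := g_sigma_algebraType G2.

Let m1 : G1 `<=` measurable.
Proof. by apply: cyl_measurable => i _; exact: mX. Qed.
Let m2 : G2 `<=` measurable.
Proof. by apply: cyl_measurable => i _; exact: mX. Qed.

Lemma block_measurable1 d1 (U : measurableType d1) (f : T -> U) :
  measurable_fun setT (f : T1 -> U) -> measurable_fun setT f.
Proof. by move=> mf; exact: (measurableT_comp mf (measurable_sub1 m1)). Qed.

(** The two arguments separate the roles of one outcome: the first feeds the variables in [J1], the
    second those in [J2]. Freezing the first amounts to conditioning on [J1]. *)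
Lemma block_fubini (f : T -> T -> R) :
  measurable_fun setT (fun p : T1 * T2 => f p.1 p.2) ->
  (forall w1, intg P (f w1)) -> intg P (fun w => f w w) ->
  intg P (fun w1 => Ex P (f w1)) /\ Ex P (fun w => f w w) = Ex P (fun w1 => Ex P (f w1)).
Proof.
move=> mf if1 ifd.
exact: (indep_fubini m1 m2 (cylT _ _) (cylT _ _) (@cylI _ _ _ _ _ _) (@cylI _ _ _ _ _ _) cyl_indep mf).
Qed.

Lemma block_intg (f : T -> T -> R) :
  measurable_fun setT (fun p : T1 * T2 => f p.1 p.2) -> (forall w1 w2, 0 <= f w1 w2) ->
  (forall w1, intg P (f w1)) -> intg P (fun w1 => Ex P (f w1)) -> intg P (fun w => f w w).
Proof.
move=> mf f0 if1 ife; apply: intg_lty => //.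
  have mp := measurable_fun_pair (measurable_sub1 m1) (measurable_sub2 m2).
  exact: (measurableT_comp mf mp).
have := indep_tonelli m1 m2 (cylT _ _) (cylT _ _) (@cylI _ _ _ _ _ _) (@cylI _ _ _ _ _ _) cyl_indep mf.
move=> /(_ (fun p => f0 p.1 p.2)) /= ->.
rewrite (eq_integral (fun w1 => (Ex P (f w1))%:E)); last by move=> w1 _; rewrite integralE_Ex.
by rewrite integralE_Ex// ltry.
Qed.

End Blocks.

(** * Moments of the normal distribution *)

Section NormalMoments.
Context {R : realType}.
Notation leb := (@lebesgue_measure R).
Variable nu : probability R R.
Hypothesis nuE : forall A, measurable A -> nu A = normal_prob (0 : R) 1 A.
Notation p := (normal_pdf (0 : R) 1).

Let integral_normal_indic E : measurable E ->
  (\int[nu]_x (\1_E x)%:E = \int[leb]_x (\1_E x * p x)%:E)%E.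
Proof.
move=> mE; rewrite integral_indic//= setIT nuE// /normal_prob integral_mkcond/=.
apply: eq_integral => x _; rewrite !patchE indicE.
by case: ifPn => xE; rewrite ?mul1r ?mul0r.
Qed.

Import HBNNSimple.

Let integral_normal_nnsfun (f : {nnsfun R >-> R}) :
  (\int[nu]_x (f x)%:E = \int[leb]_x (f x * p x)%:E)%E.
Proof.
have mp : measurable_fun setT p by exact: measurable_normal_pdf.
have p0 x : 0 <= p x by exact: normal_pdf_ge0.
have mfr r : measurable (f @^-1` [set r]) by exact: measurable_sfunP.
have mi r : measurable_fun setT (\1_(f @^-1` [set r]) : R -> R) by exact: measurable_indic.
have mri r : measurable_fun setT (fun x => r * \1_(f @^-1` [set r]) x).
  exact: measurable_funM.
under [LHS]eq_integral do rewrite fimfunE -fsumEFin//.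
rewrite [LHS]ge0_integral_fsum//; last 2 first.
  - by move=> r; apply/measurable_EFinP; exact: mri.
  - by move=> n x _; rewrite EFinM nnfun_muleindic_ge0.
under [RHS]eq_integral => x _.
  rewrite EFinM fimfunE -fsumEFin// ge0_mule_fsuml; last first.
    by move=> r; rewrite EFinM nnfun_muleindic_ge0.
  over.
rewrite [RHS]ge0_integral_fsum//; last 2 first.
  - move=> r; under eq_fun do rewrite -EFinM.
    by apply/measurable_EFinP; exact: (measurable_funM (mri r) mp).
  - by move=> n x _; rewrite mule_ge0 ?lee_fin// -lee_fin EFinM nnfun_muleindic_ge0.
apply: eq_fsbigr => r _.
under [RHS]eq_integral do rewrite EFinM -muleA -!EFinM EFinM.
have [r0|r0] := leP 0 r; last first.
  rewrite (_ : f @^-1` [set r] = set0).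
    rewrite !integral0_eq//.
    + by move=> x _; rewrite indic0 ?(mul0r, mulr0, mule0).
    + by move=> x _; rewrite indic0 ?(mul0r, mulr0, mule0).
  apply/seteqP; split=> // x /= fx; have : 0 <= f x by []. rewrite fx.
  by rewrite leNgt r0.
under [LHS]eq_integral do rewrite EFinM.
rewrite [LHS]ge0_integralZl//; last first.
  by apply/measurable_EFinP; exact: mi.
rewrite [RHS]ge0_integralZl//; [|by apply/measurable_EFinP; exact: (measurable_funM (mi r) mp)|
  by move=> x _; rewrite lee_fin mulr_ge0].
by congr (_ * _)%E; apply: integral_normal_indic; exact: mfr.
Qed.

(** [nu] is known only through its values on sets, so the density enters through simple functions
    and monotone convergence. *)
Lemma integral_normal (f : R -> R) : measurable_fun setT f -> (forall x, 0 <= f x) ->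
  (\int[nu]_x (f x)%:E = \int[leb]_x (f x * p x)%:E)%E.
Proof.
move=> mf f0.
have mEf : measurable_fun setT (EFin \o f) by exact/measurable_EFinP.
have mp : measurable_fun setT p by exact: measurable_normal_pdf.
have p0 x : 0 <= p x by exact: normal_pdf_ge0.
have f0' x : (0 <= (EFin \o f) x)%E by rewrite lee_fin.
pose f_ := nnsfun_approx measurableT mEf.
have mfn n : measurable_fun setT (f_ n) by [].
have ndf m n x : (m <= n)%N -> f_ m x <= f_ n x.
  by move=> mn; exact/lefP/nd_nnsfun_approx.
have fE x : (f x)%:E = limn (EFin \o f_ ^~ x).
  by apply/esym/cvg_lim => //; exact: cvg_nnsfun_approx.
transitivity (lim (\int[nu]_x (f_ n x)%:E @[n --> \oo])%E).
  rewrite -monotone_convergence//=.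
  - by apply: eq_integral => x _; exact: fE.
  - by move=> n; apply/measurable_EFinP; exact: mfn.
  - by move=> n ? _; rewrite lee_fin.
  - by move=> ? _ ? ? mn; rewrite lee_fin; exact: ndf.
rewrite (_ : (fun n => _) = (fun n => (\int[leb]_x (f_ n x * p x)%:E)%E)); last first.
  by apply/funext => n; exact: integral_normal_nnsfun.
rewrite -monotone_convergence//=.
- apply: eq_integral => x _; apply/cvg_lim => //.
  under eq_fun do rewrite EFinM; rewrite EFinM.
  apply: cvgeZr => //; exact: cvg_nnsfun_approx.
- by move=> n; apply/measurable_EFinP; exact: (measurable_funM (mfn n) mp).
- by move=> n ? _; rewrite lee_fin mulr_ge0.
- by move=> x _ ? ? mn; rewrite lee_fin ler_wpM2r//; exact: ndf.
Qed.

Let pE x : p x = normal_peak 1 * expR (- x ^+ 2 / 2).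
Proof.
by rewrite normal_pdfE ?oner_eq0// /normal_fun subr0 expr1n.
Qed.

Let p_derive (x : R) : is_derive x (1 : R) p (- x * p x).
Proof.
pose q : {poly R} := (- 2^-1) *: 'X^2.
have qE y : q.[y] = - y ^+ 2 / 2 by rewrite /q hornerZ hornerXn; ring.
have dq := is_derive_poly q x.
have de := @is_derive1_comp _ expR (fun y => q.[y]) x _ _ (is_derive_expR _) dq.
have dz := @is_deriveZ _ _ _ _ (normal_peak 1) x 1 _ de.
have -> : p = normal_peak 1 \*: (expR \o (fun y => q.[y])).
  by apply/funext => y; rewrite pE /= qE.
apply: (is_derive_eq dz).
rewrite -[LHS]/(normal_peak 1 * (expR q.[x] * q^`().[x])).
have -> : q^`().[x] = - x.
  by rewrite /q derivZ derivXn hornerZ hornerMn hornerX/=; field.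
rewrite -[RHS]/(- x * (normal_peak 1 * expR q.[x])); ring.
Qed.

Let F m (x : R) := x ^+ m * p x.
Let f m (x : R) := (m%:R * x ^+ m.-1 - x ^+ m.+1) * p x.

Let F_derive m (x : R) : is_derive x (1 : R) (F m) (f m x).
Proof.
have dX : is_derive x (1 : R) (fun y : R => y ^+ m) (m%:R * x ^+ m.-1).
  have -> : (fun y : R => y ^+ m) = horner 'X^m by apply/funext => y; rewrite hornerXn.
  by apply: (is_derive_eq (is_derive_poly 'X^m x)); rewrite derivXn hornerMn hornerXn mulr_natl.
apply: (is_derive_eq (is_deriveM dX (p_derive x))).
rewrite -[LHS]/(x ^+ m * (- x * p x) + p x * (m%:R * x ^+ m.-1)) /f exprS; ring.
Qed.

Let pc : continuous p.
Proof. by apply: continuous_normal_pdf; rewrite oner_eq0. Qed.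

Let Xp_continuous m : continuous (fun x : R => x ^+ m * p x).
Proof. by move=> x; apply: cvgM; [exact: exprn_continuous|exact: pc]. Qed.

Let B n : set R := `[- n%:R, n%:R]%classic.

Let intB m n : leb.-integrable (B n) (EFin \o (fun x => x ^+ m * p x)).
Proof.
apply: continuous_compact_integrable; first exact: segment_compact.
by apply: continuous_subspaceT; exact: Xp_continuous.
Qed.

Let J m n := \int[leb]_(x in B n) (x ^+ m * p x).

Let mB n : measurable (B n). Proof. exact: measurable_itv. Qed.

(** Integration by parts on [-n, n], as [f m] is the derivative of [F m]. For m = 0 the factor
    [m%:R] cancels the term with the truncated predecessor. *)
Let J_rec m n : (0 < n)%N -> m%:R * J m.-1 n - J m.+1 n = F m n%:R - F m (- n%:R).
Proof.
move=> n0.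
have nn : - n%:R < n%:R :> R by rewrite gtrN// ltr0n.
have := @continuous_FTC2 R (f m) (F m) (- n%:R) n%:R nn.
have fc : continuous (f m).
  have -> : f m = (fun x => m%:R * (x ^+ m.-1 * p x) - x ^+ m.+1 * p x).
    by apply/funext => x; rewrite /f; ring.
  move=> x; apply: cvgB; last exact: Xp_continuous.
  by apply: cvgM; [exact: cvg_cst|exact: Xp_continuous].
have Fc : continuous (F m) by exact: Xp_continuous.
move=> /(_ (continuous_subspaceT fc)) e.
have {}e : (\int[leb]_(x in B n) (f m x)%:E = (F m n%:R)%:E - (F m (- n%:R))%:E)%E.
  apply: e.
    split; first by move=> x _; have [] := F_derive m x.
      by apply: cvg_at_right_filter; exact: Fc.
    by apply: cvg_at_left_filter; exact: Fc.
  by move=> x _; rewrite derive1E; have [_ ->] := F_derive m x.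
rewrite /J -RintegralZl; [|exact: mB|exact: intB].
rewrite -RintegralB; [|exact: mB| |exact: intB]; last first.
  have i1 := intB m.-1 n.
  exact: (@integrableZl _ _ R leb (B n) (mB n) m%:R _ i1).
transitivity (fine (\int[leb]_(x in B n) (f m x)%:E)); last by rewrite e.
by congr fine; apply: eq_integral => x _; rewrite /f mulrBl mulrA.
Qed.

Let p0 x : 0 <= p x. Proof. exact: normal_pdf_ge0. Qed.
Let mp : measurable_fun setT p. Proof. exact: measurable_normal_pdf. Qed.

Let mXp m : measurable_fun setT (fun x : R => x ^+ m * p x).
Proof. by apply: continuous_measurable_fun; exact: Xp_continuous. Qed.

Let mX m : measurable_fun setT (fun x : R => x ^+ m).
Proof. by apply: continuous_measurable_fun; exact: exprn_continuous. Qed.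

Let Bcover : \bigcup_n B n = setT.
Proof.
apply/seteqP; split=> // x _; exists (Num.truncn `|x|).+1 => //.
by rewrite /B/= in_itv/= -ler_norml ltW// truncnS_gt.
Qed.

Let ndB : nondecreasing_seq B.
Proof.
move=> m n mn; apply/subsetPset => x; rewrite /B/= !in_itv/= => /andP[a b].
have mn' : m%:R <= n%:R :> R by rewrite ler_nat.
by rewrite (le_trans _ a) ?lerN2// (le_trans b).
Qed.

Let even_pow_ge0 m (x : R) : 0 <= x ^+ m.*2.
Proof. by rewrite -mul2n exprM exprn_ge0// sqr_ge0. Qed.

Let J_cvg m : (J m.*2 n)%:E @[n --> \oo] --> (\int[nu]_x (x ^+ m.*2)%:E)%E.
Proof.
rewrite (integral_normal (mX m.*2) (even_pow_ge0 m)).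
rewrite -Bcover.
have e n : (J m.*2 n)%:E = (\int[leb]_(x in B n) (x ^+ m.*2 * p x)%:E)%E.
  by rewrite /J /Rintegral fineK//; exact: (@integrable_fin_num _ _ R leb (B n) (mB n) _ (intB m.*2 n)).
under eq_fun do rewrite e.
apply: ge0_nondecreasing_set_cvg_integral => //.
- by move=> n; apply/measurable_EFinP/measurable_funTS; exact: mXp.
- by move=> n x _; rewrite lee_fin mulr_ge0.
Qed.


Let F_opp m n : F m (- n%:R) = (-1) ^+ m * F m n%:R.
Proof. by rewrite /F mulrA -exprMn mulN1r !pE sqrrN. Qed.

Let J0_cvg : J 0 n @[n --> \oo] --> (1 : R).
Proof.
have := @J_cvg 0.
rewrite (_ : (\int[nu]_x _)%E = 1%E); last first.
  transitivity (\int[nu]_x (cst 1%E x))%E; first by apply: eq_integral.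
  by rewrite integral_cst// mul1e; exact: probability_setT.
by move/fine_cvgP => [_].
Qed.

Let nF_cvg : F 1 n%:R @[n --> \oo] --> (0 : R).
Proof.
pose c : R := normal_peak 1; have c0 : 0 <= c by exact: normal_peak_ge0.
apply/cvgrPdist_le => e e0; near=> n.
have n0 : 0 < n%:R :> R by rewrite ltr0n; near: n; exact: nbhs_infty_gt.
rewrite sub0r normrN ger0_norm; last by rewrite /F expr1 mulr_ge0// ltW.
(* From exp y >= 1 + y >= y at y = n^2 / 2. *)
have pn : p n%:R <= c * (2 / n%:R ^+ 2).
  rewrite pE ler_wpM2l// mulNr expRN -[leRHS]invf_div lef_pV2 ?posrE ?expR_gt0 ?divr_gt0 ?exprn_gt0//.
  by rewrite (le_trans _ (expR_ge1Dx _))// lerDr.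
rewrite /F expr1 (le_trans (ler_wpM2l (ltW n0) pn))//.
rewrite [leLHS](_ : _ = 2 * c / n%:R); last by clearbody c; field; rewrite gt_eqF.
rewrite ler_pdivrMr// -ler_pdivrMl// ltW// mulrC.
near: n; exact: nbhs_infty_gtr.
Unshelve. all: by end_near. Qed.

Lemma normal_moment2 : (\int[nu]_x (x ^+ 2)%:E = 1)%E.
Proof.
have c := @J_cvg 1.
have e : J 2 n @[n --> \oo] --> (1 : R).
  have h : (fun n => J 0 n - 2 * F 1 n%:R) @ \oo --> (1 : R).
    have e1 : (1 : R) = 1 - 2 * 0 by ring.
    rewrite [X in _ --> X]e1.
    by apply: cvgB; [exact: J0_cvg|apply: cvgM; [exact: cvg_cst|exact: nF_cvg]].
  apply: cvg_trans h; apply: near_eq_cvg; near=> n.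
  have n0 : (0 < n)%N by near: n; exact: nbhs_infty_gt.
  by have := J_rec 1 n0; rewrite F_opp /=; lra.
have : (J 2 n)%:E @[n --> \oo] --> 1%:E by apply: cvg_EFin => //; exact: nearW.
by move=> /(cvg_unique _ c); apply.
Unshelve. all: by end_near. Qed.

(** An upper bound is enough: the boundary terms in [J_rec] are nonnegative, so J 4 <= 3 J 2 <= 3 J
    0 <= 3 on every interval. *)
Lemma normal_moment4 : (\int[nu]_x (x ^+ 4)%:E <= 3%:E)%E.
Proof.
have c := @J_cvg 2.
rewrite -(cvg_lim _ c)//; apply: lime_le; first by apply/cvg_ex; eexists; exact: c.
near=> n; have n0 : (0 < n)%N by near: n; exact: nbhs_infty_gt.
have r0 m : 0 <= F m n%:R by rewrite mulr_ge0// exprn_ge0.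
have J0 : J 0 n <= 1.
  rewrite -lee_fin /J /Rintegral fineK//; last first.
    exact: (@integrable_fin_num _ _ R leb (B n) (mB n) _ (intB 0 n)).
  rewrite -[leRHS](@integral_normal_pdf R 0 1).
  under [leLHS]eq_integral do rewrite expr0 mul1r.
  have mpE : measurable_fun setT (fun x => (p x)%:E) by apply/measurable_EFinP; exact: mp.
  apply: (@ge0_subset_integral _ _ R leb (B n) setT (mB n) measurableT _ mpE) => // x _.
  by rewrite lee_fin.
rewrite lee_fin.
have := J_rec 1 n0; have := J_rec 3 n0; rewrite !F_opp /=.
have := r0 1%N; have := r0 3%N; rewrite /=; lra.
Unshelve. all: by end_near. Qed.

Lemma normal_intg m : (m <= 4)%N -> intg nu (fun x : R => x ^+ m).
Proof.
move=> m4.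
have i4 : intg nu (fun x : R => x ^+ 4).
  apply: intg_lty; [exact: mX|exact: (even_pow_ge0 2)|].
  by rewrite (le_lt_trans normal_moment4)// ltry.
apply: (@intg_dom _ _ R nu _ _ _ (intgD (intg_cst nu 1) i4)) => [|x]; first exact: mX.
rewrite normrX.
have x4 : x ^+ 4 = `|x| ^+ 4 by rewrite -normrX ger0_norm//; exact: (even_pow_ge0 2).
rewrite x4; have [x1|x1] := leP `|x| 1.
  by rewrite (le_trans (exprn_ile1 m (normr_ge0 x) x1))// lerDl exprn_ge0.
by rewrite (le_trans (ler_weXn2l (ltW x1) m4))// lerDr.
Qed.

(** The truncated moments vanish by [J_rec] at 0 and 2, where the boundary terms cancel by symmetry;
    dominated convergence removes the truncation. *)
Lemma normal_odd m : (m < 4)%N -> odd m -> Ex nu (fun x : R => x ^+ m) = 0.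
Proof.
move=> m4 om.
have J0 n : (0 < n)%N -> J m n = 0.
  move=> n0; have := J_rec 0 n0; have := J_rec 2 n0; rewrite !F_opp /=.
  by move: m om m4 => [|[|[|[|]]]]//= _ _; lra.
have ia := intg_norm (normal_intg (ltnW m4)).
have mabs : measurable_fun setT (fun x : R => `|x ^+ m|).
  by apply: measurableT_comp => //; exact: mX.
have il : leb.-integrable setT (fun x => (`|x ^+ m| * p x)%:E).
  apply/integrableP; split.
    by apply/measurable_EFinP; exact: (measurable_funM mabs mp).
  under eq_integral do rewrite /= ger0_norm ?mulr_ge0//.
  rewrite -(integral_normal mabs)//.
  by rewrite integralE_Ex// ltry.
have mXpE : measurable_fun setT (fun x : R => (x ^+ m * p x)%:E) by apply/measurable_EFinP; exact: mXp.
have lebE : (\int[leb]_x (x ^+ m * p x)%:E = 0)%E.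
  pose g n := (fun x => (x ^+ m * p x)%:E) \_ (B n).
  have gE n : (0 < n)%N -> (\int[leb]_x (g n x) = 0)%E.
    move=> n0; rewrite -integral_mkcond.
    rewrite -[LHS]fineK; last exact: (@integrable_fin_num _ _ R leb (B n) (mB n) _ (intB m n)).
    by rewrite -[X in X%:E]/(J m n) J0.
  have gm n : measurable_fun setT (g n).
    by apply/(measurable_restrictT _ (mB n)); exact: measurable_funTS.
  have gx (x : R) : setT x -> g ^~ x @ \oo --> (x ^+ m * p x)%:E.
    move=> _; have [n _ xn] : (\bigcup_n B n) x by rewrite Bcover.
    apply: cvg_near_cst; near=> k; rewrite /g patchE mem_set//.
    have /ndB : (n <= k)%N by near: k; exact: nbhs_infty_ge.
    by move/subsetPset; apply.
  have gb n (x : R) : setT x -> (`|g n x| <= (`|x ^+ m| * p x)%:E)%E.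
    move=> _; rewrite /g patchE; case: ifPn => _; last by rewrite abse0 lee_fin mulr_ge0.
    by rewrite /= lee_fin normrM (ger0_norm (p0 x)).
  have gf (x : R) : setT x -> (`|x ^+ m| * p x)%:E \is a fin_num by [].
  have gc := @dominated_cvg _ _ R leb setT measurableT g _ _ gm gx gf il gb.
  apply: (cvg_unique _ gc); first exact: ereal_hausdorff.
  apply: cvg_near_cst; near=> k; apply: gE.
  by near: k; exact: nbhs_infty_gt.
(* [integral_normal] asks for a nonnegative integrand, hence the sum of x^m and its absolute
   value. *)
have pos (x : R) : 0 <= `|x ^+ m| + x ^+ m by rewrite -lerBlDr sub0r; have := ler_norm (- x ^+ m); rewrite normrN.
have := integral_normal (measurable_funD mabs (mX m)) pos.
under [X in _ = X -> _]eq_integral do rewrite mulrDl EFinD.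
rewrite integralD//; last first.
  apply: (le_integrable measurableT _ _ il) => // x _.
  by rewrite /= !lee_fin !normrM normr_id.
rewrite lebE adde0 -(integral_normal mabs)//.
have ix := normal_intg (ltnW m4).
rewrite (integralE_Ex (intgD ia ix)) (integralE_Ex ia) (ExD ia ix) => -[]; lra.
Unshelve. all: by end_near. Qed.

End NormalMoments.

(** * Finite Gaussian sums in a Hilbert space *)

Lemma eq_intg d (T : measurableType d) (R : realType) (P : probability T R) (f g : T -> R) :
  (forall w, f w = g w) -> intg P g -> intg P f.
Proof. by move=> /funext ->. Qed.

Lemma intg_pow4D d (T : measurableType d) (R : realType) (P : probability T R) (f g : T -> R) :
  measurable_fun setT f -> measurable_fun setT g ->
  intg P (fun w => f w ^+ 4) -> intg P (fun w => g w ^+ 4) ->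
  intg P (fun w => (f w + g w) ^+ 4).
Proof.
move=> mf mg f4 g4.
apply: (intg_dom _ (intgZ 8 (intgD f4 g4))) => [|w].
  by apply: measurable_funX; exact: measurable_funD.
rewrite ger0_norm; last by rewrite (_ : 4 = 2 * 2)%N// exprM sqr_ge0.
have sq (a b : R) : (a + b) ^+ 2 <= 2 * (a ^+ 2 + b ^+ 2) by have := sqr_ge0 (a - b); lra.
have e4 (a : R) : a ^+ 4 = (a ^+ 2) ^+ 2 by rewrite -exprM.
have s1 := sq (f w) (g w); have s2 := sq (f w ^+ 2) (g w ^+ 2).
have := sqr_ge0 (f w + g w); rewrite !e4; nra.
Qed.

Lemma intg_pow_le d (T : measurableType d) (R : realType) (P : probability T R) (f : T -> R) m :
  (m <= 4)%N -> measurable_fun setT f -> intg P (fun w => f w ^+ 4) ->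
  intg P (fun w => f w ^+ m).
Proof.
move=> m4 mf f4; apply: (intg_dom _ (intgD (intg_cst P 1) f4)) => [|w].
  exact: measurable_funX.
rewrite normrX.
have x4 : f w ^+ 4 = `|f w| ^+ 4.
  by rewrite -normrX ger0_norm// (_ : 4 = 2 * 2)%N// exprM sqr_ge0.
rewrite x4; have [x1|x1] := leP `|f w| 1.
  by rewrite (le_trans (exprn_ile1 m (normr_ge0 _) x1))// lerDl exprn_ge0.
by rewrite (le_trans (ler_weXn2l (ltW x1) m4))// lerDr.
Qed.

Lemma big_ord_condS (V : nmodType) (p : pred nat) (F : nat -> V) N :
  \sum_(i < N.+1 | p i) F i = \sum_(i < N | p i) F i + (if p N then F N else 0).
Proof. by rewrite big_mkcond big_ord_recr/= -big_mkcond. Qed.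

Lemma big_ord_cond_split (V : nmodType) (p : pred nat) (F : nat -> V) N M : (N <= M)%N ->
  \sum_(i < M | p i) F i =
  \sum_(i < N | p i) F i + \sum_(i < M | p i) (if (i < N)%N then 0 else F i).
Proof.
move=> NM; rewrite [in RHS]big_mkcond (big_ord_widen M (fun i => if p i then F i else 0) NM).
rewrite [in RHS]big_mkcond/= [X in _ = _ + X]big_mkcond/= -big_split/= [LHS]big_mkcond/=.
by apply: eq_bigr => j _; case: (p j); case: (j < N)%N; rewrite ?addr0 ?add0r.
Qed.

Section IndependentProduct.
Context (I : eqType) d' (S : measurableType d') d (T : measurableType d)
  (R : realType) (P : probability T R) (X : I -> {RV P >-> S}).
Variables (J J1 J2 : {pred I}).
Hypotheses (X_indep : mutually_independent J X) (J1J : {subset J1 <= J})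
  (J2J : {subset J2 <= J}) (J12 : forall i, i \in J1 -> i \notin J2).

Lemma indep_mul (f g : T -> R) :
  measurable_fun setT (f : g_sigma_algebraType (cyl (fun i => X i : T -> S) J1) -> R) ->
  measurable_fun setT (g : g_sigma_algebraType (cyl (fun i => X i : T -> S) J2) -> R) ->
  intg P f -> intg P g ->
  intg P (fun w => f w * g w) /\ Ex P (fun w => f w * g w) = Ex P f * Ex P g.
Proof.
move=> mf mg fi gi.
have mfst := measurableT_comp mf (@measurable_fst _ _ _ (g_sigma_algebraType (cyl (fun i => X i : T -> S) J2))).
have msnd := measurableT_comp mg (@measurable_snd _ _ (g_sigma_algebraType (cyl (fun i => X i : T -> S) J1)) _).
have i1 w1 : intg P (fun w2 => f w1 * g w2) by exact: intgZ.
have E1 w1 : Ex P (fun w2 => f w1 * g w2) = f w1 * Ex P g by exact: ExZ.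
have ifg : intg P (fun w => f w * g w).
  apply: (intg_dom (g := fun w => `|f w * g w|)) => //.
    exact: (measurable_funM (intg_meas fi) (intg_meas gi)).
  apply: (@block_intg _ _ _ _ _ _ _ _ _ _ _ X_indep J1J J2J J12 (fun w1 w2 => `|f w1 * g w2|)).
  - by apply: measurableT_comp => //; exact: measurable_funM.
  - by [].
  - by move=> w1; exact: intg_norm.
  - have -> : (fun w1 => Ex P (fun w2 => `|f w1 * g w2|)) =
        (fun w1 => Ex P (fun w => `|g w|) * `|f w1|).
      apply/funext => w1; rewrite mulrC -ExZ; last exact: intg_norm.
      by apply: eq_Ex => w2; rewrite normrM.
    by apply: intgZ; exact: intg_norm.
split=> //.
have [_ ->] := @block_fubini _ _ _ _ _ _ _ _ _ _ _ X_indep J1J J2J J12 (fun w1 w2 => f w1 * g w2)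
  (measurable_funM mfst msnd) i1 ifg.
rewrite (eq_Ex _ E1) [RHS]mulrC -ExZ//.
by apply: eq_Ex => w; rewrite mulrC.
Qed.

End IndependentProduct.

Section GaussianSums.
Context (R : realType) (H : hilbertType R) (H_sep : separable_space H)
  dO (Omega : measurableType dO) (P : probability Omega R) (idx : pred nat)
  (xi : nat -> nat -> {RV P >-> R}).
Hypothesis xi_iid : iid (I := (nat * nat)%type) [pred q | idx q.2]
     (fun q => xi q.1 q.2) (normal_prob 0 1).

Let nu k i := distribution P (xi k i).

Let nuE k i : idx i -> forall A, measurable A -> nu k i A = normal_prob (0 : R) 1 A.
Proof. by move=> ii A mA; have [_ l] := xi_iid; exact: (l (k, i) ii A mA). Qed.

Lemma distribution_intg d1 (S : measurableType d1) (X : {RV P >-> S}) (f : S -> R) :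
  measurable_fun setT f -> intg (distribution P X) f ->
  intg P (fun w => f (X w)) /\ Ex P (fun w => f (X w)) = Ex (distribution P X) f.
Proof.
move=> mf fi.
have mEf : measurable_fun setT (EFin \o f) by exact/measurable_EFinP.
have mfX : measurable_fun setT (fun w => f (X w)) by exact: (measurableT_comp mf).
have i1 : intg P (fun w => f (X w)).
  apply: (intg_dom (g := fun w => `|f (X w)|)) => //.
  apply: intg_lty => //; first exact: measurableT_comp.
  have mn : measurable_fun setT (fun x => `|f x|%:E).
    by apply/measurable_EFinP; exact: measurableT_comp.
  rewrite -[X in (X < _)%E](ge0_integral_distribution X mn (fun=> normr_ge0 _)).
  by rewrite (integralE_Ex (intg_norm fi)) ltry.
split=> //.
by rewrite /Ex /Rintegral; congr fine; rewrite -[LHS](integral_distribution mEf i1).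
Qed.

Let mXn m : measurable_fun setT (fun x : R => x ^+ m).
Proof. by apply: continuous_measurable_fun; exact: exprn_continuous. Qed.

Lemma xi_intg k i m : idx i -> (m <= 4)%N -> intg P (fun w => xi k i w ^+ m).
Proof.
move=> ii m4; have [] // := distribution_intg (X := xi k i) (mXn m).
exact: normal_intg (nuE k ii) _ m4.
Qed.

Let xi_ExE k i m : idx i -> (m <= 4)%N ->
  Ex P (fun w => xi k i w ^+ m) = Ex (nu k i) (fun x => x ^+ m).
Proof.
move=> ii m4; have [] // := distribution_intg (X := xi k i) (mXn m).
exact: normal_intg (nuE k ii) _ m4.
Qed.

Lemma xi_odd k i m : idx i -> (m < 4)%N -> odd m -> Ex P (fun w => xi k i w ^+ m) = 0.
Proof.
move=> ii m4 om; rewrite xi_ExE ?(ltnW m4)//; exact: normal_odd (nuE k ii) _ m4 om.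
Qed.

Lemma xi_moment2 k i : idx i -> Ex P (fun w => xi k i w ^+ 2) = 1.
Proof.
move=> ii; rewrite xi_ExE//; apply: EFin_inj; rewrite -integralE_Ex.
  exact: normal_moment2 (nuE k ii).
exact: normal_intg (nuE k ii) _ _.
Qed.

Lemma xi_moment4 k i : idx i -> Ex P (fun w => xi k i w ^+ 4) <= 3.
Proof.
move=> ii; rewrite xi_ExE// -lee_fin -integralE_Ex.
  exact: normal_moment4 (nuE k ii).
exact: normal_intg (nuE k ii) _ _.
Qed.

Definition gsum k (c : nat -> H) N w := \sum_(i < N | idx i) xi k i w *: c i.

Lemma gsumS k c N w : gsum k c N.+1 w =
  gsum k c N w + (if idx N then xi k N w *: c N else 0).
Proof. exact: (big_ord_condS idx (fun i => xi k i w *: c i)). Qed.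

(* The coordinates generating the noise of step [k], truncated at [N]. *)
Definition block k N : {pred nat * nat} := [pred q | [&& q.1 == k, (q.2 < N)%N & idx q.2]].

Local Notation sub J := (g_sigma_algebraType (cyl (fun q : nat * nat => xi q.1 q.2 : Omega -> R) J)).

Lemma xi_sub (J : {pred nat * nat}) k i : (k, i) \in J ->
  measurable_fun setT (xi k i : sub J -> R).
Proof. by move=> kJ; exact: (measurable_cyl_coord (X := fun q : nat * nat => xi q.1 q.2 : Omega -> R) kJ). Qed.

Lemma gsum_sub (J : {pred nat * nat}) k c N : {subset block k N <= J} ->
  mfH (gsum k c N : sub J -> H).
Proof.
move=> sJ; apply: (mfH_sum H_sep) => i ii.
have kJ : (k, nat_of_ord i) \in J by apply: sJ; rewrite unfold_in /= eqxx ltn_ord ii.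
by apply: (mfHZ H_sep); [exact: (xi_sub kJ)|exact: mfH_cst].
Qed.

Lemma gsum_mfH k c N : mfH (gsum k c N).
Proof.
by apply: (mfH_sum H_sep) => i ii; apply: (mfHZ H_sep) => //; exact: mfH_cst.
Qed.

(** Induction on N: the new coordinate is independent of the sum so far and its odd moments vanish.
    With C = |c N|^2, A = |a|^2 and s the sum of squares so far, the fourth moment grows by at most
    6 C (A + s) + 3 C^2, which fits into the square because s carries the factor 3. *)
Lemma gsum_moments k (a : H) c N :
  [/\ intg P (fun w => `|a + gsum k c N w| ^+ 4),
     Ex P (fun w => `|a + gsum k c N w| ^+ 2) = `|a| ^+ 2 + \sum_(i < N | idx i) `|c i| ^+ 2
   & Ex P (fun w => `|a + gsum k c N w| ^+ 4) <=
      (`|a| ^+ 2 + 3 * \sum_(i < N | idx i) `|c i| ^+ 2) ^+ 2].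
Proof.
elim: N => [|N [i4 e2 e4]].
  have e w : a + gsum k c 0 w = a by rewrite /gsum big_ord0 addr0.
  rewrite big_ord0 mulr0 !addr0; split.
  - by rewrite (_ : (fun _ => _) = fun=> `|a| ^+ 4); [exact: intg_cst|apply/funext => w; rewrite e].
  - by under eq_Ex do rewrite e; rewrite Ex_cst.
  - by under eq_Ex do rewrite e; rewrite Ex_cst -exprM.
have [iN|iN] := boolP (idx N); last first.
  have e w : gsum k c N.+1 w = gsum k c N w by rewrite gsumS (negbTE iN) addr0.
  have eS : gsum k c N.+1 = gsum k c N by apply/funext.
  by rewrite eS (big_ord_condS idx (fun i => `|c i| ^+ 2)) (negbTE iN) addr0.
set Z := fun w => a + gsum k c N w in i4 e2 e4 *.
set s := \sum_(i < N | idx i) `|c i| ^+ 2 in e2 e4 *.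
pose J1 := block k N; pose J2 : {pred nat * nat} := [pred q | q == (k, N)].
have J1J : {subset J1 <= [pred q : nat * nat | idx q.2]} by move=> q /and3P[].
have J2J : {subset J2 <= [pred q : nat * nat | idx q.2]} by move=> q /eqP ->.
have J12 q : q \in J1 -> q \notin J2.
  by move=> /and3P[_ qN _]; apply: contraL qN => /eqP ->; rewrite ltnn.
have [indep _] := xi_iid.
have mZ1 : mfH (Z : sub J1 -> H).
  by apply: (mfHD H_sep); [exact: mfH_cst|apply: gsum_sub].
have mZ : mfH Z by apply: (mfHD H_sep); [exact: mfH_cst|exact: gsum_mfH].
have kJ2 : (k, N) \in J2 by rewrite unfold_in /=.
have mx := xi_sub kJ2.
have mnZ1 := mfH_norm0 mZ1; have mnZ := mfH_norm0 mZ.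
have mdZ1 : measurable_fun setT (fun w : sub J1 => dot (c N) (Z w)).
  by apply: (mfH_continuous mZ1); exact: dot_continuous.
have mdZ : measurable_fun setT (fun w => dot (c N) (Z w)).
  by apply: (mfH_continuous mZ); exact: dot_continuous.
have iZ m : (m <= 4)%N -> intg P (fun w => `|Z w| ^+ m) by move=> m4; exact: intg_pow_le.
have dZ w : `|dot (c N) (Z w)| <= `|c N| * `|Z w| by exact: dot_le.
have ix m : (m <= 4)%N -> intg P (fun w => xi k N w ^+ m) by move=> ?; exact: xi_intg.
have mul m (f : Omega -> R) : (m <= 4)%N -> measurable_fun setT (f : sub J1 -> R) -> intg P f ->
    intg P (fun w => f w * xi k N w ^+ m) /\
    Ex P (fun w => f w * xi k N w ^+ m) = Ex P f * Ex P (fun w => xi k N w ^+ m).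
  move=> m4 mf fi.
  apply: (indep_mul indep J1J J2J J12 mf _ fi (ix m m4)).
  by apply: measurable_funX; exact: mx.
have idZ : intg P (fun w => dot (c N) (Z w)).
  apply: (intg_dom mdZ (intgZ `|c N| (iZ 1%N isT))) => w; rewrite expr1; exact: dZ.
have idZZ : intg P (fun w => `|Z w| ^+ 2 * dot (c N) (Z w)).
  apply: (intg_dom _ (intgZ `|c N| (iZ 3%N isT))) => [|w].
    by apply: measurable_funM => //; exact: measurable_funX.
  rewrite normrM normrX normr_id [leRHS](_ : _ = `|Z w| ^+ 2 * (`|c N| * `|Z w|)); last by ring.
  by rewrite ler_wpM2l ?exprn_ge0.
have idZ2 : intg P (fun w => dot (c N) (Z w) ^+ 2).
  apply: (intg_dom _ (intgZ (`|c N| ^+ 2) (iZ 2%N isT))) => [|w].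
    exact: measurable_funX.
  by rewrite normrX -exprMn ler_pXn2r ?nnegrE ?mulr_ge0.
have [a1i a1e] := mul 1%N _ isT mdZ1 idZ.
have [a2i a2e] := mul 2%N _ isT (measurable_cst (`|c N| ^+ 2)) (intg_cst P _).
have [b1i b1e] := mul 1%N _ isT (measurable_funM (measurable_funX 2 mnZ1) mdZ1) idZZ.
have [b2i b2e] := mul 2%N _ isT (measurable_funX 2 mdZ1) idZ2.
have [b3i b3e] := mul 2%N _ isT (measurable_funX 2 mnZ1) (iZ 2%N isT).
have [b4i b4e] := mul 3%N _ isT mdZ1 idZ.
have o1 : Ex P (fun w => xi k N w ^+ 1) = 0 by exact: xi_odd.
have o3 : Ex P (fun w => xi k N w ^+ 3) = 0 by exact: xi_odd.
have x2 : Ex P (fun w => xi k N w ^+ 2) = 1 by exact: xi_moment2.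
have x4 : Ex P (fun w => xi k N w ^+ 4) <= 3 by exact: xi_moment4.
have cc0 : 0 <= `|c N| by [].
set cc := `|c N| in a2i a2e dZ cc0 *.
have E2 w : `|a + gsum k c N.+1 w| ^+ 2 = `|Z w| ^+ 2 +
    (2 * (dot (c N) (Z w) * xi k N w ^+ 1) + cc ^+ 2 * xi k N w ^+ 2).
  rewrite gsumS iN addrA -/(Z w) normrD_sqr dotZr normrZ exprMn real_normK ?num_real//.
  by rewrite [dot (Z w) _]dotC expr1 -/cc; ring.
(* Each term after the first is a constant times a function of the earlier coordinates times a power
   of the new one, as [mul] requires. *)
have E4 w : `|a + gsum k c N.+1 w| ^+ 4 = `|Z w| ^+ 4 +
    (4 * (`|Z w| ^+ 2 * dot (c N) (Z w) * xi k N w ^+ 1) +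
    (4 * (dot (c N) (Z w) ^+ 2 * xi k N w ^+ 2) +
    (2 * cc ^+ 2 * (`|Z w| ^+ 2 * xi k N w ^+ 2) +
    (4 * cc ^+ 2 * (dot (c N) (Z w) * xi k N w ^+ 3) + cc ^+ 4 * xi k N w ^+ 4)))).
  by rewrite (exprM _ 2 2) E2; ring.
have j1 := intgZ 4 b1i; have j2 := intgZ 4 b2i; have j3 := intgZ (2 * cc ^+ 2) b3i.
have j4 := intgZ (4 * cc ^+ 2) b4i; have j5 := intgZ (cc ^+ 4) (ix 4 isT).
rewrite (big_ord_condS idx (fun i => `|c i| ^+ 2)) iN -/s -/cc; split.
- apply: (eq_intg E4).
  by apply: intgD => //; do 4 apply: intgD => //.
- rewrite (eq_Ex _ E2) ExD//; [|exact: iZ|by apply: intgD => //; exact: intgZ].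
  rewrite ExD//; last exact: intgZ.
  by rewrite ExZ// a1e a2e o1 x2 e2 Ex_cst; ring.
- rewrite (eq_Ex _ E4) ExD//; last by do 4 apply: intgD => //.
  rewrite ExD//; last by do 3 apply: intgD => //.
  rewrite ExD//; last by do 2 apply: intgD => //.
  rewrite ExD//; last by apply: intgD => //.
  rewrite ExD// !ExZ//; last exact: ix.
  rewrite b1e b2e b3e b4e o1 o3 x2 e2 !mulr0 !mulr1 add0r add0r.
  have le1 : Ex P (fun w => dot (c N) (Z w) ^+ 2) <= cc ^+ 2 * (`|a| ^+ 2 + s).
    rewrite -e2 -ExZ; last exact: iZ.
    apply: Ex_le => // [|w]; first by apply: intgZ; exact: iZ.
    by rewrite -[leLHS]ger0_norm ?sqr_ge0// normrX -exprMn ler_pXn2r ?nnegrE ?mulr_ge0.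
  have s0 : 0 <= s by apply: sumr_ge0 => i _; exact: exprn_ge0.
  have c40 : 0 <= cc ^+ 4 by exact: exprn_ge0.
  have := ler_wpM2l c40 x4.
  have c2 : cc ^+ 4 = cc ^+ 2 * cc ^+ 2 by rewrite -exprD.
  have c20 : 0 <= cc ^+ 2 by exact: exprn_ge0.
  have a20 : 0 <= `|a| ^+ 2 by exact: exprn_ge0.
  rewrite c2 in c40 *; move: (cc ^+ 2) (`|a| ^+ 2) le1 c40 c20 a20 e4 => C A.
  nra.
Qed.

End GaussianSums.

(** * Averaging over a random smooth map *)

Section C21_sub.
Context (R : realType) (V W : normedModType R).
Variables (u : V -> W) (u1 : V -> V -> W) (u2 : V -> V -> V -> W) (C : R).
Hypothesis uC : C21 u u1 u2 C.

Lemma C21_sub1 x a b : u1 x (a - b) = u1 x a - u1 x b.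
Proof. by rewrite addrC -scaleN1r (C21_lin1 uC) scaleN1r addrC. Qed.
Lemma C21_sub2l x a b c : u2 x (a - b) c = u2 x a c - u2 x b c.
Proof. by rewrite addrC -scaleN1r (C21_lin2l uC) scaleN1r addrC. Qed.
Lemma C21_sub2r x a b c : u2 x c (a - b) = u2 x c a - u2 x c b.
Proof. by rewrite addrC -scaleN1r (C21_lin2r uC) scaleN1r addrC. Qed.

Lemma C21_dist0 x y : `|u x - u y| <= C * `|x - y|.
Proof. by have := C21_lip0 uC y (x - y); rewrite [y + _]addrC subrK. Qed.
Lemma C21_dist1 x y h : `|u1 x h - u1 y h| <= C * `|x - y| * `|h|.
Proof. by have := C21_lip1 uC y (x - y) h; rewrite [y + _]addrC subrK. Qed.
Lemma C21_dist2 x y h k : `|u2 x h k - u2 y h k| <= C * `|x - y| * `|h| * `|k|.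
Proof. by have := C21_lip2 uC y (x - y) h k; rewrite [y + _]addrC subrK. Qed.

End C21_sub.

Section ExpectationC21.
Context d (T : measurableType d) (R : realType) (P : probability T R).

Lemma Ex_mul_le (f g : T -> R) (a b : R) :
  measurable_fun setT f -> measurable_fun setT g ->
  intg P (fun x => f x ^+ 2) -> intg P (fun x => g x ^+ 2) ->
  0 <= a -> 0 <= b -> Ex P (fun x => f x ^+ 2) <= a ^+ 2 -> Ex P (fun x => g x ^+ 2) <= b ^+ 2 ->
  Ex P (fun x => f x * g x) <= a * b.
Proof.
move=> mf mg f2 g2 a0 b0 fa gb.
apply: le_trans (ler_norm _) _; apply: le_trans (Ex_sqr_mul mf mg f2 g2) _.
have sq (z y : R) : 0 <= y -> z <= y ^+ 2 -> Num.sqrt z <= y.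
  by move=> y0 zy; rewrite -(ger0_norm y0) -sqrtr_sqr ler_wsqrtr.
by apply: ler_pM; rewrite ?sqrtr_ge0// sq.
Qed.

Lemma Ex_le_sqrt (f : T -> R) (a : R) : measurable_fun setT f ->
  intg P (fun x => f x ^+ 2) -> 0 <= a -> Ex P (fun x => f x ^+ 2) <= a ^+ 2 ->
  Ex P f <= a.
Proof.
move=> mf f2 a0 fa.
have e1 : (fun x : T => (1 : R) ^+ 2) = fun=> 1 by apply/funext => x; rewrite expr1n.
have := @Ex_mul_le f (fun=> 1) a 1 mf (measurable_cst _) f2.
rewrite e1 Ex_cst expr1n mulr1 => /(_ (intg_cst P 1) a0 ler01 fa (lexx _)).
by under eq_Ex do rewrite mulr1.
Qed.

Context (V : normedModType R) (f : T -> V -> R) (f1 : T -> V -> V -> R)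
  (f2 : T -> V -> V -> V -> R) (C : T -> R).
Hypotheses (fC : forall w, C21 (f w) (f1 w) (f2 w) (C w)) (iC : intg P C)
  (if0 : forall x, intg P (f ^~ x))
  (mf1 : forall x h, measurable_fun setT (fun w => f1 w x h))
  (mf2 : forall x h k, measurable_fun setT (fun w => f2 w x h k)).

Lemma C21_intg1 x h : intg P (fun w => f1 w x h).
Proof.
apply: (intg_dom (mf1 x h) (intgZ `|h| iC)) => w; rewrite mulrC; exact: (C21_bd1 (fC w)).
Qed.

Lemma C21_intg2 x h k : intg P (fun w => f2 w x h k).
Proof.
apply: (intg_dom (mf2 x h k) (intgZ (`|h| * `|k|) iC)) => w; rewrite mulrC mulrA.
exact: (C21_bd2 (fC w)).
Qed.

(** Differentiation under the expectation reduces to integrability of [C]: every field of [C21] is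
    linear in the function and its derivatives, or a bound proportional to [C w]. *)
Lemma C21_Ex : C21 (fun x => Ex P (f ^~ x)) (fun x h => Ex P (fun w => f1 w x h))
  (fun x h k => Ex P (fun w => f2 w x h k)) (Ex P C).
Proof.
have i1 := C21_intg1; have i2 := C21_intg2.
have bound (g : T -> R) (a : R) : intg P g -> (forall w, `|g w| <= C w * a) -> `|Ex P g| <= Ex P C * a.
  move=> ig gC; rewrite (le_trans (Ex_norm ig))// mulrC -ExZ//.
  apply: Ex_le => [||w]; [exact: intg_norm|exact: intgZ|by rewrite mulrC].
split.
- move=> x a h k.
  rewrite -[a *: Ex P _]/(a * Ex P _) -ExZ// -ExD//; last exact: intgZ.
  by apply: eq_Ex => w; rewrite (C21_lin1 (fC w)).
- move=> x a h k l.
  rewrite -[a *: Ex P _]/(a * Ex P _) -ExZ// -ExD//; last exact: intgZ.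
  by apply: eq_Ex => w; rewrite (C21_lin2l (fC w)).
- move=> x a h k l.
  rewrite -[a *: Ex P _]/(a * Ex P _) -ExZ// -ExD//; last exact: intgZ.
  by apply: eq_Ex => w; rewrite (C21_lin2r (fC w)).
- by move=> x h; apply: bound => // w; exact: (C21_bd1 (fC w)).
- by move=> x h k; rewrite -mulrA; apply: bound => // w; rewrite mulrA; exact: (C21_bd2 (fC w)).
- move=> x h; rewrite -ExB//; apply: bound; first exact: intgB.
  by move=> w; exact: (C21_lip0 (fC w)).
- move=> x h k; rewrite -ExB// -mulrA; apply: bound; first exact: intgB.
  by move=> w; rewrite mulrA; exact: (C21_lip1 (fC w)).
- move=> x h k l; rewrite -ExB// -!(mulrA (Ex P C)); apply: bound; first exact: intgB.
  by move=> w; rewrite !mulrA; exact: (C21_lip2 (fC w)).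
- move=> x h; have i01 := intgB (if0 (x + h)) (if0 x).
  rewrite -ExB// -ExB//; apply: bound; first exact: intgB.
  by move=> w; exact: (C21_quad0 (fC w)).
- move=> x h k; have i01 := intgB (i1 (x + h) k) (i1 x k).
  rewrite -ExB// -ExB// -mulrA; apply: bound; first exact: intgB.
  by move=> w; rewrite mulrA; exact: (C21_quad1 (fC w)).
Qed.

End ExpectationC21.

Section RandomMap.
Context (R : realType) (H : hilbertType R) (H_sep : separable_space H)
  d (T : measurableType d) (P : probability T R).
Variables (f : T -> H -> H) (f1 : T -> H -> H -> H) (f2 : T -> H -> H -> H -> H) (L : T -> R).
Hypotheses (fL : forall w, C21 (f w) (f1 w) (f2 w) (L w)) (L1 : forall w, 1 <= L w)
  (mL : measurable_fun setT L) (iL : intg P (fun w => L w ^+ 4))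
  (mf : forall x, mfH (f ^~ x)) (mf1 : forall x h, mfH (fun w => f1 w x h))
  (mf2 : forall x h k, mfH (fun w => f2 w x h k))
  (ifn : forall x, intg P (fun w => `|f w x|)).
(** Constants for moments of the random derivatives; they do not involve the pathwise [L], and they
    are what survives in the sharp bounds. *)
Variables (c al e2 e3 : R).
Hypotheses (c0 : 0 <= c) (al1 : 1 <= al) (e20 : 0 <= e2) (e30 : 0 <= e3).
Hypothesis moment2 : forall x h, Ex P (fun w => `|f1 w x h| ^+ 2) <= (c * `|h|) ^+ 2.
Hypothesis moment4 : forall x h, Ex P (fun w => `|f1 w x h| ^+ 4) <= al * `|h| ^+ 4.
Hypothesis second2 : forall x h k, Ex P (fun w => `|f2 w x h k| ^+ 2) <= (e2 * `|h| * `|k|) ^+ 2.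
Hypothesis third2 : forall x h k l,
  Ex P (fun w => `|f2 w (x + h) k l - f2 w x k l| ^+ 2) <= (e3 * `|h| * `|k| * `|l|) ^+ 2.

Let L0 w : 0 <= L w. Proof. exact: le_trans (L1 w). Qed.

Let iLm m : (m <= 4)%N -> intg P (fun w => L w ^+ m).
Proof. by move=> m4; exact: intg_pow_le. Qed.

Let dominated (g : T -> H) (a : R) : mfH g -> (forall w, `|g w| <= L w * a) ->
  forall m, (m <= 4)%N -> intg P (fun w => `|g w| ^+ m).
Proof.
move=> mg gL m m4.
apply: (intg_dom _ (intgZ (a ^+ m) (iLm m4))) => [|w].
  by apply: measurable_funX; exact: mfH_norm0.
have ga := gL w.
rewrite normrX normr_id -exprMn mulrC; apply: lerXn2r; rewrite ?nnegrE//.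
exact: le_trans ga.
Qed.

Let i1 x h m : (m <= 4)%N -> intg P (fun w => `|f1 w x h| ^+ m).
Proof. by apply: (dominated (mf1 x h)) => w; exact: (C21_bd1 (fL w)). Qed.

Let i2 x h k m : (m <= 4)%N -> intg P (fun w => `|f2 w x h k| ^+ m).
Proof.
by apply: (dominated (a := `|h| * `|k|) (mf2 x h k)) => w; rewrite mulrA; exact: (C21_bd2 (fL w)).
Qed.

Let mf2B x h k l : mfH (fun w => f2 w (x + h) k l - f2 w x k l).
Proof. by apply: mfHB. Qed.

Let i3 x h k l m : (m <= 4)%N -> intg P (fun w => `|f2 w (x + h) k l - f2 w x k l| ^+ m).
Proof.
apply: (dominated (a := `|h| * `|k| * `|l|) (mf2B x h k l)) => w.
rewrite !mulrA; exact: (C21_lip2 (fL w)).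
Qed.

Let E1 x h : Ex P (fun w => `|f1 w x h|) <= c * `|h|.
Proof.
by apply: Ex_le_sqrt; [exact: mfH_norm0|exact: i1|exact: mulr_ge0|exact: moment2].
Qed.

Let E11 x h k : Ex P (fun w => `|f1 w x h| * `|f1 w x k|) <= c ^+ 2 * `|h| * `|k|.
Proof.
have -> : c ^+ 2 * `|h| * `|k| = (c * `|h|) * (c * `|k|) by ring.
by apply: Ex_mul_le; rewrite ?mulr_ge0 ?moment2//; do ?[exact: i1|exact: mfH_norm0].
Qed.

Let E21 x h k l : Ex P (fun w => `|f2 w x h k| * `|f1 w x l|) <= e2 * c * `|h| * `|k| * `|l|.
Proof.
have -> : e2 * c * `|h| * `|k| * `|l| = (e2 * `|h| * `|k|) * (c * `|l|) by ring.
by apply: Ex_mul_le; rewrite ?mulr_ge0 ?moment2 ?second2//; do ?[exact: i1|exact: i2|exact: mfH_norm0].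
Qed.

Let E2 x h k : Ex P (fun w => `|f2 w x h k|) <= e2 * `|h| * `|k|.
Proof.
by apply: Ex_le_sqrt; rewrite ?mulr_ge0 ?second2//; do ?[exact: i2|exact: mfH_norm0].
Qed.

Let E3 x h k l : Ex P (fun w => `|f2 w (x + h) k l - f2 w x k l|) <= e3 * `|h| * `|k| * `|l|.
Proof.
by apply: Ex_le_sqrt; rewrite ?mulr_ge0 ?third2//; do ?[exact: i3|exact: mfH_norm0].
Qed.

Let m1 x h : measurable_fun setT (fun w => `|f1 w x h|).
Proof. exact: mfH_norm0. Qed.
Let m2 x h k : measurable_fun setT (fun w => `|f2 w x h k|).
Proof. exact: mfH_norm0. Qed.

Let i11 x h k : intg P (fun w => `|f1 w x h| * `|f1 w x k|).
Proof. by apply: intg_mul => //; exact: i1. Qed.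
Let i21 x h k l : intg P (fun w => `|f2 w x h k| * `|f1 w x l|).
Proof. by apply: intg_mul => //; [exact: i2|exact: i1]. Qed.

Let i111 x h k l : intg P (fun w => `|f1 w x h| * `|f1 w x k| * `|f1 w x l|).
Proof.
apply: (intg_dom _ (intgZ (`|h| * `|k| * `|l|) (iLm (isT : 3 <= 4)%N))) => [|w].
  by apply: measurable_funM => //; exact: measurable_funM.
rewrite !normrM !normr_id.
rewrite (_ : _ * L w ^+ 3 = L w * `|h| * (L w * `|k|) * (L w * `|l|)); last by ring.
by do 2 ?[apply: ler_pM; rewrite ?mulr_ge0//]; exact: (C21_bd1 (fL w)).
Qed.

(* [x y z <= (x^4 + y^4 + z^4 + 1) / 4] for the normalised norms. *)
Let E111 x h k l : Ex P (fun w => `|f1 w x h| * `|f1 w x k| * `|f1 w x l|) <=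
  al * `|h| * `|k| * `|l|.
Proof.
have zero y : y = 0 -> forall w, `|f1 w x y| = 0.
  move=> -> w; apply/eqP; rewrite eq_le normr_ge0 andbT.
  by rewrite (le_trans (C21_bd1 (fL w) _ _))// normr0 mulr0.
have [/zero h0|h0] := eqVneq h 0.
  rewrite (eq_Ex P (g := fun=> 0)) ?Ex_cst; last by move=> w; rewrite h0 !mul0r.
  by rewrite !mulr_ge0// (le_trans _ al1).
have [/zero k0|k0] := eqVneq k 0.
  rewrite (eq_Ex P (g := fun=> 0)) ?Ex_cst; last by move=> w; rewrite k0 mulr0 !mul0r.
  by rewrite !mulr_ge0// (le_trans _ al1).
have [/zero l0|l0] := eqVneq l 0.
  rewrite (eq_Ex P (g := fun=> 0)) ?Ex_cst; last by move=> w; rewrite l0 mulr0.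
  by rewrite !mulr_ge0// (le_trans _ al1).
have ph : 0 < `|h| by rewrite normr_gt0.
have pk : 0 < `|k| by rewrite normr_gt0.
have pl : 0 < `|l| by rewrite normr_gt0.
set p := `|h| * `|k| * `|l|.
have p0 : 0 < p by rewrite !mulr_gt0.
have amgm (a b r : R) : a * b * r <= (a ^+ 4 + b ^+ 4 + r ^+ 4 + 1) / 4.
  have := sqr_ge0 (a * b - r); have := sqr_ge0 (a ^+ 2 - b ^+ 2); have := sqr_ge0 (r ^+ 2 - 1).
  lra.
have j y : y != 0 -> intg P (fun w => `|y| ^- 4 * `|f1 w x y| ^+ 4) /\
    Ex P (fun w => `|y| ^- 4 * `|f1 w x y| ^+ 4) <= al.
  move=> y0; have y40 : 0 < `|y| ^+ 4 by rewrite exprn_gt0// normr_gt0.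
  split; first by apply: intgZ; exact: i1.
  rewrite ExZ; last exact: i1.
  by rewrite ler_pdivrMl// mulrC; exact: moment4.
have [jh Eh] := j h h0; have [jk Ek] := j k k0; have [jl El] := j l l0.
have j1 := intgD jh jk; have j2 := intgD j1 jl; have j3 := intgD j2 (intg_cst P 1).
have -> : al * `|h| * `|k| * `|l| = p * al by rewrite /p; ring.
apply: (@le_trans _ _ (p * (4^-1 * Ex P (fun w => `|h| ^- 4 * `|f1 w x h| ^+ 4 +
   `|k| ^- 4 * `|f1 w x k| ^+ 4 + `|l| ^- 4 * `|f1 w x l| ^+ 4 + 1)))).
  rewrite -ExZ// -ExZ; last exact: intgZ.
  apply: Ex_le => //; first by do 2 apply: intgZ.
  move=> w; have := amgm (`|f1 w x h| / `|h|) (`|f1 w x k| / `|k|) (`|f1 w x l| / `|l|).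
  rewrite !expr_div_n => am.
  rewrite -ler_pdivrMl//.
  rewrite (_ : p^-1 * _ = `|f1 w x h| / `|h| * (`|f1 w x k| / `|k|) * (`|f1 w x l| / `|l|)).
    by rewrite (le_trans am)// le_eqVlt; apply/orP; left; apply/eqP; ring.
  by rewrite /p; field; rewrite !gt_eqF.
rewrite ler_wpM2l ?(ltW p0)// (ExD j2 (intg_cst P 1)) (ExD j1 jl) (ExD jh jk) Ex_cst.
rewrite ler_pdivrMl// (_ : 4 * al = al + al + al + al); last by ring.
by rewrite !lerD.
Qed.

Section Step.
Variables (u : H -> R) (u1 : H -> H -> R) (u2 : H -> H -> H -> R) (C K1 K2 K3 : R).
Hypotheses (uC : C21 u u1 u2 C) (C0 : 0 <= C) (K10 : 0 <= K1) (K20 : 0 <= K2) (K30 : 0 <= K3)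
  (uK1 : forall x h, `|u1 x h| <= K1 * `|h|)
  (uK2 : forall x h k, `|u2 x h k| <= K2 * `|h| * `|k|)
  (uK3 : forall x h k l, `|u2 (x + h) k l - u2 x k l| <= K3 * `|h| * `|k| * `|l|).

Definition avg x := Ex P (fun w => u (f w x)).
Definition avg1 x h := Ex P (fun w => comp1 u1 (f w) (f1 w) x h).
Definition avg2 x h k := Ex P (fun w => comp2 u1 u2 (f w) (f1 w) (f2 w) x h k).

Let u_cont : continuous u.
Proof. exact: (lipschitz_cvg (C21_dist0 uC)). Qed.

Let u1_contl h : continuous (u1 ^~ h).
Proof.
apply: (@lipschitz_cvg _ _ _ _ (C * `|h|)) => x y; rewrite mulrAC; exact: (C21_dist1 uC).
Qed.

Let u1_contr x : continuous (u1 x).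
Proof.
apply: (@lipschitz_cvg _ _ _ _ C) => h k; rewrite -(C21_sub1 uC); exact: (C21_bd1 uC).
Qed.

Let u2_cont0 h k : continuous (fun x => u2 x h k).
Proof.
apply: (@lipschitz_cvg _ _ _ _ (C * `|h| * `|k|)) => x y.
have := C21_dist2 uC x y h k.
by rewrite (_ : C * `|h| * `|k| * _ = C * `|x - y| * `|h| * `|k|)//; ring.
Qed.

Let u2_contl x k : continuous (fun h => u2 x h k).
Proof.
apply: (@lipschitz_cvg _ _ _ _ (C * `|k|)) => h l.
by rewrite -(C21_sub2l uC) mulrAC; exact: (C21_bd2 uC).
Qed.

Let u2_contr x h : continuous (u2 x h).
Proof.
apply: (@lipschitz_cvg _ _ _ _ (C * `|h|)) => k l.
by rewrite -(C21_sub2r uC); exact: (C21_bd2 uC).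
Qed.

Let mu1 (X Y : T -> H) : mfH X -> mfH Y -> measurable_fun setT (fun w => u1 (X w) (Y w)).
Proof.
move=> mX mY; apply: (caratheodory H_sep (f := fun x w => u1 x (Y w)) _ _ mX) => [w|x].
  exact: u1_contl.
by apply: (mfH_continuous mY); exact: u1_contr.
Qed.

(** [caratheodory] once for the base point and once for the first direction; the last direction is
    plain continuity. *)
Let mu2 (X Y Z : T -> H) : mfH X -> mfH Y -> mfH Z ->
  measurable_fun setT (fun w => u2 (X w) (Y w) (Z w)).
Proof.
move=> mX mY mZ.
apply: (caratheodory H_sep (f := fun x w => u2 x (Y w) (Z w)) _ _ mX) => [w|x].
  exact: u2_cont0.
apply: (caratheodory H_sep (f := fun y w => u2 x y (Z w)) _ _ mY) => [w|y].
  exact: u2_contl.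
by apply: (mfH_continuous mZ); exact: u2_contr.
Qed.

Lemma intg_avg x : intg P (fun w => u (f w x)).
Proof.
have mu : measurable_fun setT (fun w => u (f w x)) by exact: (mfH_continuous (mf x)).
apply: (intg_dom mu (intgD (intg_cst P `|u 0|) (intgZ C (ifn x)))) => w.
rewrite -[X in `|X|](subrK (u 0)) addrC (le_trans (ler_normD _ _))// lerD2l.
by have := C21_dist0 uC (f w x) 0; rewrite subr0.
Qed.

Let m_comp1 x h : measurable_fun setT (fun w => comp1 u1 (f w) (f1 w) x h).
Proof. exact: mu1. Qed.

Let m_comp2 x h k : measurable_fun setT (fun w => comp2 u1 u2 (f w) (f1 w) (f2 w) x h k).
Proof. by apply: measurable_funD; [exact: mu2|exact: mu1]. Qed.

Let compC w := C21_comp uC (fL w) (L1 w) C0.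

Let i_comp2 x h k : intg P (fun w => comp2 u1 u2 (f w) (f1 w) (f2 w) x h k).
Proof.
exact: (C21_intg2 compC (intgZ (6 * C) (iLm (isT : 3 <= 4)%N)) m_comp2).
Qed.

Let i_comp1 x h : intg P (fun w => comp1 u1 (f w) (f1 w) x h).
Proof.
exact: (C21_intg1 compC (intgZ (6 * C) (iLm (isT : 3 <= 4)%N)) m_comp1).
Qed.

Lemma avg_C21 : C21 avg avg1 avg2 (6 * C * Ex P (fun w => L w ^+ 3)).
Proof.
have := C21_Ex compC (intgZ (6 * C) (iLm (isT : 3 <= 4)%N)) intg_avg m_comp1 m_comp2.
by rewrite ExZ//; exact: iLm.
Qed.

Lemma avg_sharp1 x h : `|avg1 x h| <= c * K1 * `|h|.
Proof.
rewrite (le_trans (Ex_norm (i_comp1 x h)))//.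
have i0 := i1 x h (isT : 1 <= 4)%N.
apply: (@le_trans _ _ (Ex P (fun w => K1 * `|f1 w x h| ^+ 1))).
  by apply: Ex_le => [||w]; [exact: intg_norm|exact: intgZ|rewrite expr1; exact: uK1].
rewrite ExZ//; under eq_Ex do rewrite expr1.
by rewrite mulrAC [leRHS]mulrC ler_wpM2l// E1.
Qed.

Lemma avg_sharp2 x h k : `|avg2 x h k| <= (c ^+ 2 * K2 + e2 * K1) * `|h| * `|k|.
Proof.
rewrite (le_trans (Ex_norm (i_comp2 x h k)))//.
have j2 : intg P (fun w => `|f2 w x h k|) by exact: (i2 x h k (isT : 1 <= 4)%N).
have j := intgD (intgZ K2 (i11 x h k)) (intgZ K1 j2).
apply: (le_trans (Ex_le (intg_norm (i_comp2 x h k)) j _)).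
  by move=> w; rewrite (le_trans (ler_normD _ _))// lerD// mulrA.
rewrite ExD; [|exact: intgZ|exact: intgZ].
rewrite !ExZ//.
have := ler_wpM2l K20 (E11 x h k); have := ler_wpM2l K10 (E2 x h k); lra.
Qed.

(** [comp2_lip] in expectation. The crude remainder with L^3 is integrable and quadratic in h, so
    [lipschitz_of_quadratic] drops it and the moment constants remain. The factor 3 counts the ways
    to pair a second with a first derivative. *)
Lemma avg_sharp3 x h k l : `|avg2 (x + h) k l - avg2 x k l| <=
  (al * K3 + 3 * (e2 * c) * K2 + e3 * K1) * `|h| * `|k| * `|l|.
Proof.
pose C' := (K3 + 5 * K2) * Ex P (fun w => L w ^+ 3) * (`|k| * `|l|).
pose A := (al * K3 + 3 * (e2 * c) * K2 + e3 * K1) * (`|k| * `|l|).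
have := @lipschitz_of_quadratic _ _ _ (fun y => avg2 y k l) A C'.
move=> /(_ _ x h); rewrite (_ : A * `|h| = (al * K3 + 3 * (e2 * c) * K2 + e3 * K1)
  * `|h| * `|k| * `|l|); last by rewrite /A; ring.
apply => {x h} x h.
rewrite -ExB// (le_trans (Ex_norm (intgB (i_comp2 _ _ _) (i_comp2 _ _ _))))//.
have j0 := i111 x h k l.
have j1 := i21 x h k l; have j2 := i21 x h l k; have j3 := i21 x k l h.
have j4 : intg P (fun w => `|f2 w (x + h) k l - f2 w x k l|).
  exact: (i3 x h k l (isT : 1 <= 4)%N).
have j5 := iLm (isT : 3 <= 4)%N.
have s1 := intgZ K3 j0; have s2 := intgZ K2 (intgD (intgD j1 j2) j3).
have s3 := intgZ K1 j4; have s4 := intgZ ((K3 + 5 * K2) * (`|h| ^+ 2 * `|k| * `|l|)) j5.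
have s := intgD (intgD (intgD s1 s2) s3) s4.
apply: (le_trans (Ex_le (intg_norm (intgB (i_comp2 _ _ _) (i_comp2 _ _ _))) s _)).
  move=> w; have := @comp2_lip _ _ _ u u1 u2 C (f w) (f1 w) (f2 w) (L w) uC (fL w) (L1 w)
    K1 K2 K3 K10 K20 K30 uK1 uK2 (C21_sharp_lip1 uC uK2) uK3 x h k l.
  move=> /le_trans; apply; rewrite le_eqVlt; apply/orP; left; apply/eqP; ring.
rewrite (ExD (intgD (intgD s1 s2) s3) s4) (ExD (intgD s1 s2) s3) (ExD s1 s2).
rewrite (ExZ _ j0) (ExZ _ (intgD (intgD j1 j2) j3)) (ExZ _ j4) (ExZ _ j5).
rewrite (ExD (intgD j1 j2) j3) (ExD j1 j2).
have b0 := ler_wpM2l K30 (E111 x h k l); have b4 := ler_wpM2l K10 (E3 x h k l).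
have b1 := ler_wpM2l K20 (E21 x h k l); have b2 := ler_wpM2l K20 (E21 x h l k).
have b3 := ler_wpM2l K20 (E21 x k l h).
rewrite /A /C'; move: (Ex P (fun w => L w ^+ 3)) => l3; lra.
Qed.

End Step.
End RandomMap.

Section OrthonormalSums.
Context d (T : measurableType d) (R : realType) (P : probability T R)
  (H : hilbertType R) (idx : pred nat) (z : nat -> T -> R).
Hypotheses (mz : forall i, idx i -> measurable_fun setT (z i))
  (z2 : forall i, idx i -> intg P (fun w => z i w ^+ 2))
  (zz : forall i j, idx i -> idx j -> Ex P (fun w => z i w * z j w) = (i == j)%:R).
Variables (Q : H -> H -> R) (C : R).
Hypotheses (Ql : forall (a : R) x y v, Q (a *: x + y) v = a * Q x v + Q y v)
  (Qr : forall (a : R) x y v, Q v (a *: x + y) = a * Q v x + Q v y).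

Let Ql0 v : Q 0 v = 0.
Proof. by have := Ql 1 0 0 v; rewrite scale1r addr0 mul1r => /eqP; rewrite -subr_eq subrr eq_sym => /eqP. Qed.
Let Qr0 v : Q v 0 = 0.
Proof. by have := Qr 1 0 0 v; rewrite scale1r addr0 mul1r => /eqP; rewrite -subr_eq subrr eq_sym => /eqP. Qed.

Let izz i j : idx i -> idx j -> intg P (fun w => z i w * z j w).
Proof. by move=> ii jj; apply: intg_mul; [exact: mz|exact: mz|exact: z2|exact: z2]. Qed.

Lemma bilinear_suml (I : Type) (r : seq I) (p : pred I) (c : I -> R) (x : I -> H) v :
  Q (\sum_(i <- r | p i) c i *: x i) v = \sum_(i <- r | p i) c i * Q (x i) v.
Proof.
elim: r => [|i r ih]; first by rewrite !big_nil Ql0.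
by rewrite !big_cons; case: ifP => // _; rewrite Ql ih.
Qed.

Lemma bilinear_sumr (I : Type) (r : seq I) (p : pred I) (c : I -> R) (x : I -> H) v :
  Q v (\sum_(i <- r | p i) c i *: x i) = \sum_(i <- r | p i) c i * Q v (x i).
Proof.
elim: r => [|i r ih]; first by rewrite !big_nil Qr0.
by rewrite !big_cons; case: ifP => // _; rewrite Qr ih.
Qed.

(** Stated for any orthonormal [z] because it serves twice: for the Gaussian coordinates under [P]
    and for the basis of L^2 under [mu]. That the right-hand side does not see [z] is the matching
    of covariances. *)
Lemma orthonormal_bilinear (c : nat -> H) N :
  intg P (fun w => Q (\sum_(i < N | idx i) z i w *: c i) (\sum_(i < N | idx i) z i w *: c i)) /\
  Ex P (fun w => Q (\sum_(i < N | idx i) z i w *: c i) (\sum_(i < N | idx i) z i w *: c i)) =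
  \sum_(i < N | idx i) Q (c i) (c i).
Proof.
have e w : Q (\sum_(i < N | idx i) z i w *: c i) (\sum_(i < N | idx i) z i w *: c i) =
   \sum_(i < N | idx i) \sum_(j < N | idx j) Q (c i) (c j) * (z i w * z j w).
  rewrite bilinear_suml; apply: eq_bigr => i _.
  rewrite bilinear_sumr mulr_sumr; apply: eq_bigr => j _; ring.
have ij (i j : 'I_N) : idx i -> idx j -> intg P (fun w => Q (c i) (c j) * (z i w * z j w)).
  by move=> ii jj; apply: intgZ; exact: izz.
split.
  apply: (eq_intg e); apply: intg_sum => i ii; apply: intg_sum => j jj; exact: ij.
rewrite (eq_Ex _ e) Ex_sum; last by move=> i ii; apply: intg_sum => j jj; exact: ij.
apply: eq_bigr => i ii; rewrite Ex_sum; last by move=> j jj; exact: ij.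
rewrite (bigD1 i)//= big1 ?addr0; last first.
  move=> j /andP[jj ji]; rewrite ExZ; last exact: izz.
  by rewrite zz// (_ : (nat_of_ord i == j) = false) ?mulr0// eq_sym; exact: negbTE.
by rewrite ExZ; [rewrite zz// eqxx mulr1|exact: izz].
Qed.

End OrthonormalSums.

(** * The noise has the same law at every step *)

Section GaussianNoise.
Context (R : realType) (H : hilbertType R) (H_sep : separable_space H)
  dO (Omega : measurableType dO) (P : probability Omega R) (idx : pred nat)
  (xi : nat -> nat -> {RV P >-> R}).
Hypothesis xi_iid : iid (I := (nat * nat)%type) [pred q | idx q.2]
     (fun q => xi q.1 q.2) (normal_prob 0 1).

Lemma xi_orthonormal k i j : idx i -> idx j ->
  Ex P (fun w => xi k i w * xi k j w) = (i == j)%:R.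
Proof.
move=> ii jj; have [<-|ij] := eqVneq i j.
  by rewrite -(xi_moment2 xi_iid k ii); apply: eq_Ex => w; rewrite expr2.
pose J1 : {pred nat * nat} := [pred q | q == (k, i)].
pose J2 : {pred nat * nat} := [pred q | q == (k, j)].
have [indep _] := xi_iid.
have J1J : {subset J1 <= [pred q : nat * nat | idx q.2]} by move=> q /eqP ->.
have J2J : {subset J2 <= [pred q : nat * nat | idx q.2]} by move=> q /eqP ->.
have J12 q : q \in J1 -> q \notin J2.
  by move=> /eqP ->; rewrite unfold_in /= xpair_eqE eqxx.
have k1 : (k, i) \in J1 by rewrite unfold_in /=.
have k2 : (k, j) \in J2 by rewrite unfold_in /=.
have ix l : idx l -> intg P (fun w => xi k l w).
  by move=> ll; have := xi_intg xi_iid k ll (isT : 1 <= 4)%N; apply: eq_intg => w; rewrite expr1.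
have [_ ->] := indep_mul indep J1J J2J J12 (xi_sub k1) (xi_sub k2) (ix i ii) (ix j jj).
have -> : Ex P (xi k i) = 0.
  by rewrite -(xi_odd xi_iid k ii (isT : 1 < 4)%N isT); apply: eq_Ex => w; rewrite expr1.
by rewrite mul0r.
Qed.

(** All coordinates of one step form a single random element of a path space. Its sigma-algebra is
    generated by the coordinates in [idx] only, those whose law is prescribed. *)
Let coord : nat -> (nat -> R) -> R := fun i z => z i.
Local Notation path := (g_sigma_algebraType (cyl coord idx)).
Let Y k (w : Omega) : path := fun i => xi k i w.

Let Y_cyl k (s : seq nat) (A : nat -> set R) :
  Y k @^-1` (\bigcap_(i in [set` s]) (coord i @^-1` A i)) =
  \bigcap_(i in [set` s]) (xi k i @^-1` A i).
Proof. by []. Qed.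

Let mY k : measurable_fun setT (Y k).
Proof.
apply: (@measurability _ _ Omega path setT (Y k) (cyl coord idx)) => //.
move=> _ [_ [s [A [us sJ mA ->]]] <-]; rewrite setTI Y_cyl.
apply: fin_bigcap_measurable; first exact: finite_seq.
by move=> i _; rewrite -[X in measurable X]setTI; exact: measurable_funP.
Qed.

Let YRV k : {mfun Omega >-> path} := HB.pack (Y k) (isMeasurableFun.Build _ _ _ _ _ (mY k)).

Let Y_law_cyl k C : cyl coord idx C -> P (Y k @^-1` C) = P (Y 0 @^-1` C).
Proof.
move=> [s [A [us sJ mA ->]]]; have [indep law] := xi_iid.
suff key l : P (Y l @^-1` (\bigcap_(i in [set` s]) (coord i @^-1` A i))) =
    (\prod_(i <- s) normal_prob (0 : R) 1 (A i))%E by rewrite !key.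
have usl : uniq [seq (l, i) | i <- s] by rewrite map_inj_uniq// => i j [].
have sl : {subset [seq (l, i) | i <- s] <= [pred q : nat * nat | idx q.2]}.
  by move=> q /mapP[i /sJ ii ->].
have := indep _ (fun q : nat * nat => A q.2) usl sl (fun q => mA q.2).
rewrite big_map/= => e.
rewrite (eq_big_seq (fun i => P (xi l i @^-1` A i))); last first.
  by move=> i is_; rewrite -(law (l, i) (sJ i is_) _ (mA i)).
rewrite -e Y_cyl; congr (P _); apply/seteqP; split=> w /=.
  by move=> wA q /mapP[i is_ ->]; exact: wA.
by move=> wA i is_; apply: (wA (l, i)); apply: map_f.
Qed.

Let Y_law k A : measurable A -> distribution P (YRV k) A = distribution P (YRV 0) A.
Proof.
move=> mA.
have cov : \bigcup_(k : nat) [set: path] = setT by rewrite bigcup_const//; exists 0%N.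
apply: (@measure_unique _ R path (cyl coord idx) (fun=> setT) erefl (@cylI _ _ _ _ _ _)
  (fun=> cylT _ _) cov (distribution P (YRV k)) (distribution P (YRV 0)) _ _ A mA).
- by move=> C; exact: Y_law_cyl.
- by move=> _; rewrite -ge0_fin_numE// fin_num_measure.
Qed.

(** Equal probabilities on cylinders determine the law on paths. A statement about step k thus
    reduces to step 0, whose noise defines the Markov operator. *)
Lemma noise_law k (F : (nat -> R) -> R) :
  measurable_fun setT (F : path -> R) -> intg P (fun w => F (Y 0 w)) ->
  intg P (fun w => F (Y k w)) /\ Ex P (fun w => F (Y k w)) = Ex P (fun w => F (Y 0 w)).
Proof.
move=> mF iF.
have mEF : measurable_fun setT (EFin \o F : path -> \bar R) by exact/measurable_EFinP.
have i0 : intg (distribution P (YRV 0)) F.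
  apply: (@intg_dom _ path R (distribution P (YRV 0)) F (fun z : path => `|F z|)) => //.
  have mn : measurable_fun setT (fun z : path => `|F z|) by exact: measurableT_comp.
  apply: intg_lty => //.
  have mE : measurable_fun setT (fun z : path => `|F z|%:E) by exact/measurable_EFinP.
  rewrite (ge0_integral_distribution (YRV 0) mE (fun=> normr_ge0 _)).
  by rewrite [X in (X < _)%E](integralE_Ex (intg_norm iF)) ltry.
have ik : intg (distribution P (YRV k)) F.
  move: i0; rewrite /intg => /integrableP[m1 i0]; apply/integrableP; split=> //.
  rewrite (eq_measure_integral (distribution P (YRV 0)))// => A mA _; exact: Y_law.
have [i0' e0] := distribution_intg mF i0.
have [ik' ek] := distribution_intg mF ik.
split; first exact: ik'.
rewrite [LHS]ek [RHS]e0 /Ex /Rintegral; congr fine.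
by apply: eq_measure_integral => A mA _; exact: Y_law.
Qed.

End GaussianNoise.

(** * Square-integrable functions and Bochner means *)

Section L2Functions.
Context d (T : measurableType d) (R : realType) (mu : probability T R).

Lemma L2_meas (u : L2 mu) : measurable_fun setT (u : T -> R).
Proof. by have /andP[] := LfunP (u : LfunType mu (lee1n 2)); rewrite inE. Qed.

Lemma L2_sqr (u : L2 mu) : intg mu (fun x => u x ^+ 2).
Proof. exact: (Lfun2_integrable_sqr (LfunP (u : LfunType mu (lee1n 2)))). Qed.

Lemma L2_funD (u v : L2 mu) x : L2_fun (u + v) x = L2_fun u x + L2_fun v x.
Proof. by []. Qed.

Lemma L2_funN (u : L2 mu) x : L2_fun (- u) x = - L2_fun u x.
Proof. by []. Qed.

Lemma L2_fun_sum (I : Type) (r : seq I) (p : pred I) (u : I -> L2 mu) x :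
  L2_fun (\sum_(i <- r | p i) u i) x = \sum_(i <- r | p i) L2_fun (u i) x.
Proof.
elim: r => [|i r ih]; first by rewrite !big_nil.
rewrite !big_cons; case: (p i) => //.
by rewrite -ih.
Qed.

(** The entry point for totality of the basis: indicators are expanded first, and H-valued functions
    follow by approximation. *)
Lemma indic_L2 (A : set T) : measurable A -> exists u : L2 mu, forall x, L2_fun u x = \1_A x.
Proof.
move=> mA.
have fA : (\1_A : T -> R) \in Lfun mu 2%:E.
  apply/andP; rewrite !inE; split; first exact: measurable_indic.
  rewrite /= /finite_norm unlock; apply: poweR_lty.
  rewrite (_ : (\int[mu]_x _)%E = (\int[mu]_x (\1_A x)%:E)%E); last first.
    apply: eq_integral => x _; rewrite /= indicE; case: (x \in A).
      by rewrite normr1 ?poweR_EFin powR1.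
    by rewrite normr0 ?poweR_EFin powR0// pnatr_eq0.
  by rewrite integral_indic// setIT -ge0_fin_numE// fin_num_measure.
by exists (Lfun_Sub (lee1n 2) fA : LfunType mu (lee1n 2)).
Qed.

End L2Functions.

Section Dominated.
Context d (T : measurableType d) (R : realType) (P : probability T R).

Lemma Ex_dominated_cvg (f : nat -> T -> R) (f' g : T -> R) :
  (forall n, measurable_fun setT (f n)) -> measurable_fun setT f' -> intg P g ->
  (forall n x, `|f n x| <= g x) -> (forall x, f ^~ x @ \oo --> f' x) ->
  Ex P (f n) @[n --> \oo] --> Ex P f'.
Proof.
move=> mf mf' ig fg ff.
have := @dominated_cvg _ _ R P setT measurableT (fun n x => (f n x)%:E) (fun x => (f' x)%:E)
  (fun x => (g x)%:E).
move=> /(_ (fun n => iffRL (measurable_EFinP _ _) (mf n))) h.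
have {}h : (\int[P]_x (f n x)%:E)%E @[n --> \oo] --> (\int[P]_x (f' x)%:E)%E.
  apply: h => //; first by move=> x _; apply: cvg_EFin => //; [exact: nearW|exact: ff].
  by move=> n x _; rewrite lee_fin.
have if' : intg P f'.
  apply: (intg_dom mf' ig) => x.
  have c : `|f n x| @[n --> \oo] --> `|f' x| by apply: cvg_norm; exact: ff.
  rewrite -(cvg_lim _ c)//; apply: limr_le; first by apply/cvg_ex; eexists; exact: c.
  by apply: nearW => n; exact: fg.
rewrite (integralE_Ex if') in h.
by move/fine_cvgP : h => [].
Qed.

End Dominated.

Section BochnerMean.
Context d (T : measurableType d) (R : realType) (mu : probability T R)
  (H : hilbertType R) (H_sep : separable_space H).
Variables (f : T -> H) (m : H) (fm : bochner_mean mu f m).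

Lemma bochner_mfH : mfH f. Proof. by case: fm. Qed.

(** On simple functions a bounded functional commutes with the integral. Its values at these
    integrals converge both to [L m] and to the mean of [L (f x)]. *)
Lemma bochner_mean_linear (L : H -> R) (C : R) :
  (forall (a : R) x y, L (a *: x + y) = a * L x + L y) -> (forall x, `|L x| <= C * `|x|) ->
  intg mu (fun x => L (f x)) /\ Ex mu (fun x => L (f x)) = L m.
Proof.
move=> Ll LC; have [mf [s [ms sf sm]]] := fm.
have Lc : continuous L.
  apply: (@lipschitz_cvg _ _ _ _ C) => x y.
  by rewrite -mulN1r addrC -Ll scaleN1r [- y + x]addrC.
have L0 : L 0 = 0.
  by have := Ll 1 0 0; rewrite scale1r addr0 mul1r => /eqP; rewrite -subr_eq subrr eq_sym => /eqP.
have Lsum (I : Type) (r : seq I) (c : I -> R) (x : I -> H) :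
    L (\sum_(i <- r) c i *: x i) = \sum_(i <- r) c i * L (x i).
  by elim: r => [|i r ih]; rewrite ?big_nil// !big_cons Ll ih.
pose g n x := \sum_(p <- s n) (\1_(p.1) x : R) *: p.2.
have mg n : mfH (g n).
  rewrite /g; under eq_fun do rewrite big_seq_cond.
  apply: (mfH_sum H_sep) => p /andP[ps _]; apply: (mfHZ H_sep); last exact: mfH_cst.
  by apply: measurable_indic; exact: ms ps.
have i1 n p : p \in s n -> intg mu (\1_(p.1)).
  move=> ps; apply: (intg_dom _ (intg_cst mu 1)) => [|x]; first by apply: measurable_indic; exact: ms ps.
  by rewrite indicE normr_nat; case: (_ \in _); rewrite ?mulr0n ?mulr1n ?ler01.
have iLg n : intg mu (fun x => L (g n x)) /\
    Ex mu (fun x => L (g n x)) = L (\sum_(p <- s n) fine (mu p.1) *: p.2).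
  have e x : L (g n x) = \sum_(p <- s n | p \in s n) L p.2 * (\1_(p.1) x).
    by rewrite Lsum big_seq; apply: eq_bigr => p _; rewrite mulrC.
  split; first by apply: (eq_intg e); apply: intg_sum => p ps; apply: intgZ; exact: i1 ps.
  rewrite (eq_Ex _ e) Ex_sum; last by move=> p ps; apply: intgZ; exact: i1 ps.
  rewrite Lsum [RHS]big_seq; apply: eq_bigr => p ps; rewrite ExZ; last exact: i1 ps.
  by rewrite mulrC /Ex /Rintegral integral_indic ?setIT//; exact: ms ps.
have mfg n : measurable_fun setT (fun x => `|f x - g n x|).
  by apply: mfH_norm0; exact: (mfHB H_sep).
have /(@fine_cvgP _ _ _ _ _ 0)[ifg cfg] := sf.
(* Convergence to 0 in the extended reals makes the distances integrable only from some n on. *)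
have ie : \forall n \near \oo, intg mu (fun x => `|f x - g n x|).
  apply: filterS ifg => n fin; apply: intg_lty => //.
  by rewrite -ge0_fin_numE//; apply: integral_ge0.
have mLf : measurable_fun setT (fun x => L (f x)) by exact: (mfH_continuous mf).
have LB x y : L (x - y) = L x - L y by rewrite addrC -scaleN1r Ll mulN1r addrC.
have iLf : intg mu (fun x => L (f x)).
  have [n _ /(_ n (leqnn n)) ien] := ie.
  apply: (intg_dom mLf (intgD (intgZ C ien) (intg_norm (iLg n).1))) => x.
  rewrite -[X in `|X|](subrK (L (g n x))) (le_trans (ler_normD _ _))// lerD2r.
  by rewrite -LB.
split=> //.
have c1 : L (\sum_(p <- s n) fine (mu p.1) *: p.2) @[n --> \oo] --> L m.
  exact: (cvg_comp _ _ sm (Lc m)).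
have c2 : L (\sum_(p <- s n) fine (mu p.1) *: p.2) @[n --> \oo] --> Ex mu (fun x => L (f x)).
  apply/cvgrPdist_le => e e0.
  have C0 : 0 < `|C| + 1 by rewrite ltr_wpDl.
  have /cvgrPdist_le/(_ _ (divr_gt0 e0 C0)) cd := cfg.
  near=> n.
  have ien : intg mu (fun x => `|f x - g n x|) by near: n.
  rewrite -(iLg n).2 -ExB//; last exact: (iLg n).1.
  rewrite (le_trans (Ex_norm (intgB iLf (iLg n).1)))//.
  rewrite (le_trans (_ : _ <= Ex mu (fun x => (`|C| + 1) * `|f x - g n x|)))//.
    apply: Ex_le; [exact: (intg_norm (intgB iLf (iLg n).1))|exact: intgZ|move=> x].
    rewrite -LB (le_trans (LC _))// ler_wpM2r// (le_trans (ler_norm _))// lerDl//.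
  rewrite ExZ// -ler_pdivlMl// mulrC.
  have : `|0 - fine (\int[mu]_x (`|f x - g n x|)%:E)%E| <= e / (`|C| + 1) by near: n.
  by rewrite sub0r normrN; apply: le_trans; exact: ler_norm.
exact: (cvg_unique _ c2 c1).
Unshelve. all: by end_near. Qed.

End BochnerMean.

(** * Orthonormal expansions *)

Section SquareIntegrable.
Context (R : realType) (H : hilbertType R) (H_sep : separable_space H)
  d (T : measurableType d) (P : probability T R).
Implicit Types f g : T -> H.

Lemma normrD_sqr_le (x y : H) : `|x + y| ^+ 2 <= 2 * `|x| ^+ 2 + 2 * `|y| ^+ 2.
Proof.
have h : `|x + y| ^+ 2 <= (`|x| + `|y|) ^+ 2 by rewrite lerXn2r ?nnegrE ?addr_ge0// ler_normD.
apply: le_trans h _; have := sqr_ge0 (`|x| - `|y|); lra.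
Qed.

Lemma intg_sqrD f g : mfH f -> mfH g ->
  intg P (fun w => `|f w| ^+ 2) -> intg P (fun w => `|g w| ^+ 2) ->
  intg P (fun w => `|f w + g w| ^+ 2) /\
  Ex P (fun w => `|f w + g w| ^+ 2) <=
    2 * Ex P (fun w => `|f w| ^+ 2) + 2 * Ex P (fun w => `|g w| ^+ 2).
Proof.
move=> mf mg f2 g2.
have i : intg P (fun w => 2 * `|f w| ^+ 2 + 2 * `|g w| ^+ 2) by apply: intgD; exact: intgZ.
have j : intg P (fun w => `|f w + g w| ^+ 2).
  apply: (intg_dom _ i) => [|w].
    by apply: measurable_funX; apply: mfH_norm0; exact: mfHD.
  by rewrite ger0_norm ?sqr_ge0// normrD_sqr_le.
split=> //; rewrite -!ExZ// -ExD; try exact: intgZ.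
by apply: Ex_le => // w; exact: normrD_sqr_le.
Qed.

Lemma intg_sqrB f g : mfH f -> mfH g ->
  intg P (fun w => `|f w| ^+ 2) -> intg P (fun w => `|g w| ^+ 2) ->
  intg P (fun w => `|f w - g w| ^+ 2) /\
  Ex P (fun w => `|f w - g w| ^+ 2) <=
    2 * Ex P (fun w => `|f w| ^+ 2) + 2 * Ex P (fun w => `|g w| ^+ 2).
Proof.
move=> mf mg f2 g2.
have mNg : mfH (fun w => - g w).
  by have := mfHB H_sep (@mfH_cst R H _ T 0) mg; congr mfH; apply/funext => w; rewrite sub0r.
have eN w : `|- g w| ^+ 2 = `|g w| ^+ 2 by rewrite normrN.
have [] := intg_sqrD mf mNg f2 (eq_intg eN g2).
by rewrite (eq_Ex P eN).
Qed.

Section BilinearLimit.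
Variables (Q : H -> H -> R) (C : R).
Hypotheses (Ql : forall (a : R) x y v, Q (a *: x + y) v = a * Q x v + Q y v)
  (Qr : forall (a : R) x y v, Q v (a *: x + y) = a * Q v x + Q v y)
  (QC : forall x y, `|Q x y| <= C * `|x| * `|y|).

Lemma bilinear_dist x y :
  `|Q x x - Q y y| <= C * (2 * (`|x - y| * `|x|) + `|x - y| ^+ 2).
Proof.
have QBl a b v : Q (a - b) v = Q a v - Q b v by rewrite addrC -scaleN1r Ql mulN1r addrC.
have QBr a b v : Q v (a - b) = Q v a - Q v b by rewrite addrC -scaleN1r Qr mulN1r addrC.
have -> : Q x x - Q y y = Q (x - y) x + Q x (x - y) - Q (x - y) (x - y).
  by rewrite !QBl !QBr; ring.
rewrite (le_trans (ler_normB _ _))//.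
rewrite (_ : C * _ = (C * `|x - y| * `|x| + C * `|x| * `|x - y|) + C * `|x - y| * `|x - y|).
  by rewrite lerD// (le_trans (ler_normD _ _))// lerD.
by rewrite expr2; ring.
Qed.

Lemma bilinear_mfH f : mfH f -> measurable_fun setT (fun w => Q (f w) (f w)).
Proof.
move=> mf; apply: (mfH_continuous mf (h := fun x => Q x x)) => x.
apply/cvgrPdist_le => e e0.
pose K := `|C| * (2 * `|x| + 1) + 1.
have K0 : 0 < K by rewrite ltr_wpDl// mulr_ge0// addr_ge0// mulr_ge0.
near=> y.
have xy1 : `|x - y| <= 1 by near: y; apply: cvgr_dist_le.
have xye : `|x - y| <= K^-1 * e.
  by near: y; apply: cvgr_dist_le; rewrite ?mulr_gt0 ?invr_gt0.
rewrite (le_trans (bilinear_dist _ _))//.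
rewrite (le_trans (_ : _ <= K * `|x - y|))//; last by rewrite -ler_pdivlMl.
rewrite /K; have := normr_ge0 (x - y); have := normr_ge0 x; have := ler_norm C.
have := normr_ge0 C.
move: (`|x - y|) (`|x|) (`|C|) xy1 => r a c r1 c0 Cc a0 r0.
apply: (@le_trans _ _ (c * (2 * (r * a) + r ^+ 2))).
  by apply: ler_wpM2r => //; rewrite addr_ge0// ?sqr_ge0// !mulr_ge0.
apply: (@le_trans _ _ (c * (2 * (r * a) + r))).
  by apply: ler_wpM2l => //; rewrite lerD2l expr2 ler_piMl.
have -> : (c * (2 * a + 1) + 1) * r = c * (2 * (r * a) + r) + r by ring.
by rewrite lerDl.
Unshelve. all: by end_near. Qed.

Lemma bilinear_intg f : mfH f -> intg P (fun w => `|f w| ^+ 2) ->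
  intg P (fun w => Q (f w) (f w)).
Proof.
move=> mf f2; apply: (intg_dom (bilinear_mfH mf) (intgZ C f2)) => w.
by rewrite (le_trans (QC _ _))// expr2 mulrA.
Qed.

(** [bilinear_dist] controls the difference pathwise, and Cauchy-Schwarz turns convergence in L^2
    into convergence of the expectations. *)
Lemma bilinear_cvg f (fN : nat -> T -> H) : mfH f -> (forall N, mfH (fN N)) ->
  intg P (fun w => `|f w| ^+ 2) -> (forall N, intg P (fun w => `|fN N w| ^+ 2)) ->
  Ex P (fun w => `|f w - fN N w| ^+ 2) @[N --> \oo] --> (0 : R) ->
  Ex P (fun w => Q (fN N w) (fN N w)) @[N --> \oo] --> Ex P (fun w => Q (f w) (f w)).
Proof.
move=> mf mfN f2 fN2 c.
pose r N := Ex P (fun w => `|f w - fN N w| ^+ 2).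
pose b := Ex P (fun w => `|f w| ^+ 2).
have mr N : mfH (fun w => f w - fN N w) by exact: mfHB.
have r2 N : intg P (fun w => `|f w - fN N w| ^+ 2) by have [] := intg_sqrB mf (mfN N) f2 (fN2 N).
have bound N : `|Ex P (fun w => Q (f w) (f w)) - Ex P (fun w => Q (fN N w) (fN N w))| <=
    `|C| * (2 * (Num.sqrt (r N) * Num.sqrt b) + r N).
  have i1 := bilinear_intg mf f2; have i2 := bilinear_intg (mfN N) (fN2 N).
  have mr0 := mfH_norm0 (mr N); have mf0 := mfH_norm0 mf.
  have i3 := intg_mul mr0 mf0 (r2 N) f2.
  rewrite -ExB// (le_trans (Ex_norm (intgB i1 i2)))//.
  have i4 := intgD (intgZ 2 i3) (r2 N).
  apply: (@le_trans _ _ (Ex P (fun w => `|C| * (2 * (`|f w - fN N w| * `|f w|) + `|f w - fN N w| ^+ 2)))).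
    apply: Ex_le; [exact: (intg_norm (intgB i1 i2))|exact: intgZ|move=> w].
    rewrite (le_trans (bilinear_dist _ _))// ler_wpM2r ?ler_norm//.
  rewrite ExZ// ler_wpM2l// ExD//; last exact: intgZ.
  rewrite lerD2r ExZ// ler_wpM2l//.
  exact: le_trans (ler_norm _) (Ex_sqr_mul mr0 mf0 (r2 N) f2).
apply/subr_cvg0; rewrite -[X in _ --> X]oppr0.
under eq_fun do rewrite -opprB; apply: cvgN; apply/cvgr0Pnorm_le => e e0 /=.
have lim : `|C| * (2 * (Num.sqrt (r N) * Num.sqrt b) + r N) @[N --> \oo] --> (0 : R).
  rewrite -(mulr0 `|C|); apply: cvgMr; rewrite -[X in _ --> X](addr0 0).
  apply: cvgD => //; rewrite -(mulr0 2); apply: cvgMr; rewrite -(mul0r (Num.sqrt b)).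
  apply: cvgMl; rewrite -(sqrtr0 R).
  apply: continuous_cvg => //; exact: sqrt_continuous.
move/cvgr0Pnorm_le : lim => /(_ e e0); apply: filterS => N h.
by apply: le_trans (bound N) _; apply: le_trans (ler_norm _) h.
Qed.

End BilinearLimit.

Lemma dot_lin_l (a : R) (x y v : H) : dot (a *: x + y) v = a * dot x v + dot y v.
Proof. by rewrite dotDl dotZl. Qed.
Lemma dot_lin_r (a : R) (x y v : H) : dot v (a *: x + y) = a * dot v x + dot v y.
Proof. by rewrite dotDr dotZr. Qed.

End SquareIntegrable.

Section OrthonormalSeries.
Context (R : realType) (H : hilbertType R) (H_sep : separable_space H)
  d (T : measurableType d) (P : probability T R) (idx : pred nat) (z : nat -> T -> R).
Hypotheses (mz : forall i, idx i -> measurable_fun setT (z i))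
  (z2 : forall i, idx i -> intg P (fun w => z i w ^+ 2))
  (zz : forall i j, idx i -> idx j -> Ex P (fun w => z i w * z j w) = (i == j)%:R).

Definition osum (c : nat -> H) N w := \sum_(i < N | idx i) z i w *: c i.

Lemma osum_mfH c N : mfH (osum c N).
Proof. by apply: mfH_sum => // i ii; apply: mfHZ => //; [exact: mz|exact: mfH_cst]. Qed.

Lemma osum_sqr c N : intg P (fun w => `|osum c N w| ^+ 2) /\
  Ex P (fun w => `|osum c N w| ^+ 2) = \sum_(i < N | idx i) `|c i| ^+ 2.
Proof.
have e w : `|osum c N w| ^+ 2 = dot (osum c N w) (osum c N w) by rewrite dotxx.
have [i E] := orthonormal_bilinear mz z2 zz (@dot_lin_l R H) (@dot_lin_r R H) c N.
split; first exact: (eq_intg e).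
by rewrite (eq_Ex P e) E; apply: eq_bigr => k _; rewrite dotxx.
Qed.

Definition expands (f : T -> H) (c : nat -> H) : Prop :=
  [/\ mfH f, intg P (fun w => `|f w| ^+ 2) &
      Ex P (fun w => `|f w - osum c N w| ^+ 2) @[N --> \oo] --> (0 : R)].

Lemma expands_bilinear f c (Q : H -> H -> R) (C : R) : expands f c ->
  (forall (a : R) x y v, Q (a *: x + y) v = a * Q x v + Q y v) ->
  (forall (a : R) x y v, Q v (a *: x + y) = a * Q v x + Q v y) ->
  (forall x y, `|Q x y| <= C * `|x| * `|y|) ->
  \sum_(i < N | idx i) Q (c i) (c i) @[N --> \oo] --> Ex P (fun w => Q (f w) (f w)).
Proof.
move=> [mf f2 fc] Ql Qr QC.
have := bilinear_cvg H_sep Ql Qr QC mf (osum_mfH c) f2 (fun N => (osum_sqr c N).1) fc.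
by under eq_fun => N do rewrite (orthonormal_bilinear mz z2 zz Ql Qr c N).2.
Qed.

Lemma expands_sqr f c : expands f c ->
  \sum_(i < N | idx i) `|c i| ^+ 2 @[N --> \oo] --> Ex P (fun w => `|f w| ^+ 2).
Proof.
move=> fc.
have dot_bd (x y : H) : `|dot x y| <= 1 * `|x| * `|y| by rewrite mul1r dot_le.
have := expands_bilinear fc (@dot_lin_l R H) (@dot_lin_r R H) dot_bd.
under eq_fun do under eq_bigr do rewrite dotxx.
by under eq_Ex do rewrite dotxx.
Qed.

(** Pythagoras: the remainder expands with the first N coefficients set to 0, and [expands_sqr]
    applies to it. *)
Lemma expands_tail f c N : expands f c ->
  intg P (fun w => `|f w - osum c N w| ^+ 2) /\
  Ex P (fun w => `|f w - osum c N w| ^+ 2) =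
    Ex P (fun w => `|f w| ^+ 2) - \sum_(i < N | idx i) `|c i| ^+ 2.
Proof.
move=> fc; have [mf f2 cf] := fc.
have [s2 _] := osum_sqr c N.
have [i _] := intg_sqrB H_sep mf (osum_mfH c N) f2 s2.
split=> //.
pose c' i := if (i < N)%N then 0 else c i.
have fc' : expands (fun w => f w - osum c N w) c'.
  split=> //; first by apply: mfHB => //; exact: osum_mfH.
  apply: cvg_trans cf; apply: near_eq_cvg; near=> M.
  have NM : (N <= M)%N by near: M; exact: nbhs_infty_ge.
  apply: eq_Ex => w; rewrite /osum (big_ord_cond_split idx (fun i => z i w *: c i) NM) opprD addrA.
  congr (`|_ - _| ^+ 2); apply: eq_bigr => j _; rewrite /c'; case: ifP => //; by rewrite scaler0.
have c1 := expands_sqr fc'.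
have c2 : \sum_(i < M | idx i) `|c' i| ^+ 2 @[M --> \oo] -->
    Ex P (fun w => `|f w| ^+ 2) - \sum_(i < N | idx i) `|c i| ^+ 2.
  have h : (\sum_(i < M | idx i) `|c i| ^+ 2 - \sum_(i < N | idx i) `|c i| ^+ 2) @[M --> \oo] -->
      Ex P (fun w => `|f w| ^+ 2) - \sum_(i < N | idx i) `|c i| ^+ 2.
    by apply: cvgB; [exact: expands_sqr|exact: cvg_cst].
  apply: cvg_trans h; apply: near_eq_cvg; near=> M.
  have NM : (N <= M)%N by near: M; exact: nbhs_infty_ge.
  rewrite (big_ord_cond_split idx (fun i => `|c i| ^+ 2) NM) /= addrAC subrr add0r.
  by apply: eq_bigr => j _; rewrite /c'; case: ifP => //; rewrite normr0 expr0n.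
exact: (cvg_unique _ c1 c2).
Unshelve. all: by end_near. Qed.

End OrthonormalSeries.

(** * Expansion of H-valued functions in the basis of L^2 *)

Section Parseval.
Context (R : realType) (H : hilbertType R) (H_sep : separable_space H)
  d (T : measurableType d) (mu : probability T R) (e : l2basis mu).

Let idx := l2idx e.
Let z i : T -> R := l2vec e i.

Lemma l2vec_meas i : idx i -> measurable_fun setT (z i).
Proof. by move=> _; exact: L2_meas. Qed.
Lemma l2vec_sqr i : idx i -> intg mu (fun w => z i w ^+ 2).
Proof. by move=> _; exact: L2_sqr. Qed.
Lemma l2vec_orthonormal i j : idx i -> idx j -> Ex mu (fun w => z i w * z j w) = (i == j)%:R.
Proof. exact: l2basis_orthonormal. Qed.

Let osumZ c N := osum_mfH H_sep l2vec_meas c N.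
Let osum2 (c : nat -> H) N := osum_sqr l2vec_meas l2vec_sqr l2vec_orthonormal c N.

(** Membership in the closed span of the products of basis functions with vectors in L^2(mu; H). One
    sequence [h] serves all N >= [N0], so that two approximations can be compared at a common N. *)
Definition spanned (f : T -> H) : Prop :=
  [/\ mfH f, intg mu (fun w => `|f w| ^+ 2) &
    forall dl : R, 0 < dl -> exists N0 (h : nat -> H), forall N, (N0 <= N)%N ->
      Ex mu (fun w => `|f w - osum idx z h N w| ^+ 2) <= dl].

Lemma spanned_ext f g : (forall w, f w = g w) -> spanned f -> spanned g.
Proof. by move=> /funext ->. Qed.

Lemma spannedD f g : spanned f -> spanned g -> spanned (fun w => f w + g w).
Proof.
move=> [mf f2 sf] [mg g2 sg]; split.
- exact: mfHD.
- by have [] := intg_sqrD H_sep mf mg f2 g2.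
move=> dl dl0; have dl40 : 0 < dl / 4 by rewrite divr_gt0.
have [N1 [h1 hN1]] := sf _ dl40; have [N2 [h2 hN2]] := sg _ dl40.
exists (maxn N1 N2), (fun i => h1 i + h2 i) => N; rewrite geq_max => /andP[n1 n2].
have [r1 _] := intg_sqrB H_sep mf (osumZ h1 N) f2 (osum2 h1 N).1.
have [r2 _] := intg_sqrB H_sep mg (osumZ h2 N) g2 (osum2 h2 N).1.
have [_ E] := intg_sqrD H_sep (mfHB H_sep mf (osumZ h1 N)) (mfHB H_sep mg (osumZ h2 N)) r1 r2.
rewrite (eq_Ex mu (g := fun w => `|(f w - osum idx z h1 N w) + (g w - osum idx z h2 N w)| ^+ 2)).
  apply: (le_trans E); have := hN1 _ n1; have := hN2 _ n2; lra.
move=> w; congr (`|_| ^+ 2); rewrite addrACA -opprD; congr (_ - _).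
by rewrite /osum -big_split/=; apply: eq_bigr => i _; rewrite scalerDr.
Qed.

Lemma spanned_cvg f (fN : nat -> T -> H) : mfH f -> intg mu (fun w => `|f w| ^+ 2) ->
  (forall n, spanned (fN n)) ->
  Ex mu (fun w => `|f w - fN n w| ^+ 2) @[n --> \oo] --> (0 : R) -> spanned f.
Proof.
move=> mf f2 sfN c; split=> // dl dl0; have dl40 : 0 < dl / 4 by rewrite divr_gt0.
have /cvgr0Pnorm_le/(_ _ dl40)[n _ /(_ n (leqnn n)) cn] := c.
have [mfn fn2 sfn] := sfN n; have [N0 [h hN]] := sfn _ dl40.
exists N0, h => N N0N.
have [r1 _] := intg_sqrB H_sep mf mfn f2 fn2.
have [r2 _] := intg_sqrB H_sep mfn (osumZ h N) fn2 (osum2 h N).1.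
have [_ E] := intg_sqrD H_sep (mfHB H_sep mf mfn) (mfHB H_sep mfn (osumZ h N)) r1 r2.
rewrite (eq_Ex mu (g := fun w => `|(f w - fN n w) + (fN n w - osum idx z h N w)| ^+ 2)); last first.
  by move=> w; rewrite addrA subrK.
apply: (le_trans E); have := hN _ N0N; have := le_trans (ler_norm _) cn; lra.
Qed.

(** The scalar expansion of the indicator, multiplied by the vector x. *)
Lemma spanned_indic A (x : H) : measurable A -> spanned (fun w => (\1_A w : R) *: x).
Proof.
move=> mA; have [u uA] := indic_L2 mu mA.
have mf : mfH (fun w => (\1_A w : R) *: x).
  by apply: (mfHZ H_sep); [exact: measurable_indic|exact: mfH_cst].
split=> //.
  apply: (intg_dom _ (intg_cst mu (`|x| ^+ 2))) => [|w].
    by apply: measurable_funX; exact: mfH_norm0.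
  rewrite normrX normr_id normrZ exprMn indicE.
  by case: (_ \in _); rewrite ?normr1 ?normr0 ?expr1n ?mul1r// expr0n mul0r sqr_ge0.
move=> dl dl0.
pose a N : L2 mu := u - \sum_(i < N | idx i) l2dot u (l2vec e i) *: l2vec e i.
have aw N w : L2_fun (a N) w = \1_A w - \sum_(i < N | idx i) l2dot u (l2vec e i) * z i w.
  by rewrite /a L2_funD L2_funN L2_fun_sum uA.
have lim : l2norm (a N) ^+ 2 * `|x| ^+ 2 @[N --> \oo] --> (0 : R).
  rewrite -(mul0r (`|x| ^+ 2)); apply: cvgMl; under eq_fun do rewrite expr2.
  by have := cvgM (l2basis_total e u) (l2basis_total e u); rewrite mulr0; exact.
have /cvgr0Pnorm_le/(_ _ dl0)[N0 _ hN] := lim.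
exists N0, (fun i => l2dot u (l2vec e i) *: x) => N N0N.
apply: le_trans _ (le_trans (ler_norm _) (hN N N0N)).
rewrite /l2norm sqr_sqrtr; last by apply: Ex_ge0 => w; rewrite -expr2 sqr_ge0.
rewrite mulrC -ExZ; last by have := L2_sqr (a N); apply: eq_intg => w; rewrite expr2.
rewrite le_eqVlt; apply/orP; left; apply/eqP/eq_Ex => w.
rewrite -expr2 aw -[(_ - _) ^+ 2](real_normK (num_real _)) -exprMn mulrC -normrZ.
congr (`|_| ^+ 2); rewrite scalerBl; congr (_ - _).
by rewrite scaler_suml; apply: eq_bigr => i _; rewrite scalerA mulrC.
Qed.

Section Nearest.
Variables (f : T -> H) (mf : mfH f) (f2 : intg mu (fun w => `|f w| ^+ 2)).
Variable s : nat -> H.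
Hypothesis sP : forall x e, 0 < e -> exists n, `|x - s n| < e.

(* The best approximation of [f w] among [0, s 0, ..., s (n - 1)]. *)
Fixpoint nearest n (w : T) : H :=
  if n is m.+1 then (if `|f w - s m| < `|f w - nearest m w| then s m else nearest m w) else 0.

(** An arbitrary A is part of the claim because passing from n to n + 1 splits A according to which
    candidate is nearer. *)
Let nearest_spanned n : forall A, measurable A -> spanned (fun w => (\1_A w : R) *: nearest n w).
Proof.
elim: n => [|n ih] A mA; first exact: spanned_indic.
pose B := [set w | `|f w - s n| < `|f w - nearest n w|].
have mn : mfH (nearest n).
  have [+ _ _] := ih setT measurableT.
  by congr mfH; apply/funext => w; rewrite indicE in_setT scale1r.
have mB : measurable B by apply: measurable_gt; apply: mfH_norm0; apply: mfHB => //; exact: mfH_cst.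
have := spannedD (spanned_indic (s n) (measurableI _ _ mA mB)) (ih _ (measurableD mA mB)).
apply: spanned_ext => w /=.
have -> : (`|f w - s n| < `|f w - nearest n w|) = (w \in B).
  by apply/idP/idP; rewrite inE.
by rewrite !indicE in_setI in_setD; case: (w \in A); case: (w \in B);
  rewrite /= ?scale0r ?scale1r ?addr0 ?add0r.
Qed.

(** 0 is among the candidates, so the error is dominated by |f|; density of [s] makes it tend to 0
    pointwise. *)
Lemma spanned_sqr : spanned f.
Proof.
have sn n : spanned (nearest n).
  by have := nearest_spanned n measurableT; apply: spanned_ext => w; rewrite indicE in_setT scale1r.
have mono n w : `|f w - nearest n.+1 w| <= `|f w - nearest n w|.
  by rewrite /=; case: ifPn => // /ltW.
have mono' w m n : (m <= n)%N -> `|f w - nearest n w| <= `|f w - nearest m w|.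
  move=> /subnK <-; elim: (n - m)%N => // k ih; rewrite addSn.
  exact: le_trans (mono _ _) ih.
apply: (spanned_cvg mf f2 sn).
have := @Ex_dominated_cvg _ _ R mu (fun n w => `|f w - nearest n w| ^+ 2) (fun=> 0)
  (fun w => `|f w| ^+ 2).
rewrite Ex_cst; apply => //.
- by move=> n; have [mn _ _] := sn n; apply: measurable_funX; apply: mfH_norm0; exact: mfHB.
- move=> n w; rewrite normrX normr_id lerXn2r ?nnegrE//.
  by have := mono' w 0%N n (leq0n n); rewrite /= subr0.
move=> w; apply/cvgr0Pnorm_le => ep ep0.
(* An error that is at most 1 and at most [ep] has a square at most [ep]. *)
have ep10 : 0 < Num.min 1 ep by rewrite lt_min ltr01.
have [n sn'] := sP (f w) ep10.
exists n.+1 => // k /= nk.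
rewrite normrX normr_id.
have h : `|f w - nearest k w| <= Num.min 1 ep.
  apply: le_trans (mono' w _ _ nk) _; apply: le_trans _ (ltW sn') => /=.
  by case: ifPn => //; rewrite -leNgt.
move: h; rewrite le_min => /andP[h1 h2].
by rewrite expr2 (le_trans _ h2)// ler_piMl.
Qed.

End Nearest.

(** For each N the vectors [c i] minimise the L^2 distance among all sums of this length, by the
    formula in [coef]; density of such sums then suffices. Coefficients are given through inner
    products, the form in which a Bochner mean is accessible. *)
Lemma parseval (f : T -> H) (c : nat -> H) : mfH f -> intg mu (fun w => `|f w| ^+ 2) ->
  (forall i h, idx i -> Ex mu (fun w => z i w * dot (f w) h) = dot (c i) h) ->
  expands mu idx z f c.
Proof.
move=> mf f2 fc; split=> //.
have [s sP] := separable_seq H_sep.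
have [_ _ sf] := spanned_sqr mf f2 sP.
have mdot h : measurable_fun setT (fun w => dot (f w) h).
  have := mfH_continuous mf (@dot_continuous R H h).
  by congr measurable_fun; apply/funext => w; rewrite dotC.
have idot h : intg mu (fun w => dot (f w) h ^+ 2).
  apply: (intg_dom _ (intgZ (`|h| ^+ 2) f2)) => [|w]; first exact: measurable_funX.
  by rewrite normrX mulrC -exprMn lerXn2r ?nnegrE ?mulr_ge0// dot_le.
have coef h N : intg mu (fun w => `|f w - osum idx z h N w| ^+ 2) /\
    Ex mu (fun w => `|f w - osum idx z h N w| ^+ 2) = Ex mu (fun w => `|f w| ^+ 2)
    - 2 * (\sum_(i < N | idx i) dot (c i) (h i)) + \sum_(i < N | idx i) `|h i| ^+ 2.
  have [i _] := intg_sqrB H_sep mf (osumZ h N) f2 (osum2 h N).1; split=> //.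
  have E w : `|f w - osum idx z h N w| ^+ 2 =
     `|f w| ^+ 2 - 2 * (\sum_(i < N | idx i) z i w * dot (f w) (h i)) + `|osum idx z h N w| ^+ 2.
    rewrite normrD_sqr normrN dotNr mulrN; congr (_ - 2 * _ + _).
    rewrite /osum; elim/big_rec2 : _ => [|j y x _ <-]; first by rewrite dotC dot0l.
    by rewrite dotDr dotZr.
  have iD j : idx j -> intg mu (fun w => z j w * dot (f w) (h j)).
    by move=> jj; apply: intg_mul; [exact: l2vec_meas|exact: mdot|exact: l2vec_sqr|exact: idot].
  have iS : intg mu (fun w => \sum_(i < N | idx i) z i w * dot (f w) (h i)).
    by apply: intg_sum => j; exact: iD.
  rewrite (eq_Ex mu E) ExD; [|by apply: intgB => //; exact: intgZ|exact: (osum2 h N).1].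
  rewrite ExB//; last exact: intgZ.
  rewrite ExZ// (osum2 h N).2 Ex_sum; last by move=> j; exact: iD.
  by congr (_ - 2 * _ + _); apply: eq_bigr => j ij; exact: fc.
apply/cvgr0Pnorm_le => dl dl0; have [N0 [h hN]] := sf _ dl0.
exists N0 => // N /= N0N.
rewrite ger0_norm; last by apply: Ex_ge0 => w; exact: sqr_ge0.
apply: le_trans _ (hN N N0N); rewrite (coef c N).2 (coef h N).2 -subr_ge0.
rewrite [leRHS](_ : _ = \sum_(i < N | idx i) `|h i - c i| ^+ 2).
  by apply: sumr_ge0 => i _; exact: sqr_ge0.
under [RHS]eq_bigr => i _ do rewrite normrD_sqr normrN dotNr [dot (h i) _]dotC.
rewrite !big_split/= -mulr_sumr sumrN.
have -> : \sum_(i < N | idx i) dot (c i) (c i) = \sum_(i < N | idx i) `|c i| ^+ 2.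
  by apply: eq_bigr => i _; rewrite dotxx.
by ring.
Qed.

End Parseval.

(** * Matching of the first two moments *)

Lemma cvge0_Ex d (T : measurableType d) (R : realType) (P : probability T R)
    (f : nat -> T -> R) :
  (forall N, measurable_fun setT (f N)) -> (forall N w, 0 <= f N w) ->
  (\int[P]_w (f N w)%:E)%E @[N --> \oo] --> (0%E : \bar R) ->
  (\forall N \near \oo, intg P (f N)) /\ Ex P (f N) @[N --> \oo] --> (0 : R).
Proof.
move=> mf f0 /(@fine_cvgP _ _ _ _ _ 0)[fin c]; split=> //.
apply: filterS fin => N fin; apply: intg_lty => //.
by rewrite -ge0_fin_numE//; apply: integral_ge0 => w _; rewrite lee_fin.
Qed.

Lemma law_intg d (T : measurableType d) (R : realType) (P : probability T R)
    d' (S : measurableType d') (X : {RV P >-> S}) (mu : probability S R) (f : S -> R) :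
  (forall A, measurable A -> distribution P X A = mu A) ->
  measurable_fun setT f -> intg mu f ->
  intg P (fun w => f (X w)) /\ Ex P (fun w => f (X w)) = Ex mu f.
Proof.
move=> Xmu mf fi.
have i : intg (distribution P X) f.
  move: fi; rewrite /intg => /integrableP[mf' fi]; apply/integrableP; split=> //.
  by rewrite (eq_measure_integral mu)// => A mA _; exact: Xmu.
have [j E] := distribution_intg mf i; split=> //; rewrite E /Ex /Rintegral; congr fine.
by apply: eq_measure_integral => A mA _; exact: Xmu.
Qed.

Lemma hs_partial_cvg d (T : measurableType d) (R : realType) (mu : probability T R)
    (e : l2basis mu) (H : hilbertType R) (A : {hs e -> H}) :
  \sum_(i < N | l2idx e i) `|A (l2vec e i)| ^+ 2 @[N --> \oo] --> `|A| ^+ 2.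
Proof.
have : (\sum_(0 <= i < N | l2idx e i) (`|A (l2vec e i)| ^+ 2)%:E)%E @[N --> \oo]
    --> @hs_sum _ _ _ mu e H A.
  by apply: is_cvg_nneseries_cond => i _ _; rewrite lee_fin sqr_ge0.
rewrite -hsnorm_sqr => /fine_cvgP[_]; apply: cvg_trans; apply: near_eq_cvg.
by apply: nearW => M /=; rewrite sumEFin/= big_mkord.
Qed.

Section TaylorStep.
Context (R : realType) (H : hilbertType R) (H_sep : separable_space H)
  d (T : measurableType d) (P : probability T R).
Variables (u : H -> R) (u1 : H -> H -> R) (u2 : H -> H -> H -> R) (C K : R).
Hypotheses (uC : C21 u u1 u2 C) (K0 : 0 <= K)
  (uK : forall x h k l, `|u2 (x + h) k l - u2 x k l| <= K * `|h| * `|k| * `|l|).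

Let mu_ x (v : T -> H) : mfH v -> measurable_fun setT (fun w => u (x + v w)).
Proof.
move=> mv; apply: (mfH_continuous mv (h := fun y => u (x + y))) => y.
apply: (@continuous_comp _ _ _ (fun y => x + y) u); first by apply: cvgD; [exact: cvg_cst|exact: cvg_id].
exact: (lipschitz_cvg (C21_dist0 uC)).
Qed.

Lemma C21_shift_intg x (v : T -> H) : mfH v -> intg P (fun w => `|v w|) ->
  intg P (fun w => u (x + v w)).
Proof.
move=> mv iv; apply: (intg_dom (mu_ x mv) (intgD (intg_cst P `|u x|) (intgZ C iv))) => w.
rewrite -[X in `|X|](subrK (u x)) addrC (le_trans (ler_normD _ _))// lerD2l.
exact: (C21_lip0 uC).
Qed.

Lemma intg_cube_sqr (v : T -> H) : mfH v -> intg P (fun w => `|v w| ^+ 3) ->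
  intg P (fun w => `|v w| ^+ 2) /\ intg P (fun w => `|v w|).
Proof.
move=> mv v3; have mn := mfH_norm0 mv.
have h (a : R) : 0 <= a -> a ^+ 2 <= 1 + a ^+ 3.
  by move=> a0; have [a1|a1] := lerP a 1; nra.
have v2 : intg P (fun w => `|v w| ^+ 2).
  apply: (intg_dom _ (intgD (intg_cst P 1) v3)) => [|w]; first exact: measurable_funX.
  by rewrite normrX normr_id h.
by split=> //; exact: intg_sqr.
Qed.

Lemma taylor_step x (v : T -> H) : mfH v -> intg P (fun w => `|v w| ^+ 3) ->
  `|Ex P (fun w => u (x + v w)) -
    (u x + Ex P (fun w => u1 x (v w)) + Ex P (fun w => u2 x (v w) (v w)) / 2)| <=
  K / 6 * Ex P (fun w => `|v w| ^+ 3).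
Proof.
move=> mv v3; have [v2 v1] := intg_cube_sqr mv v3.
have u1c : continuous (u1 x).
  apply: (@lipschitz_cvg _ _ _ _ C) => h k; rewrite -(C21_sub1 uC); exact: (C21_bd1 uC).
have i0 := C21_shift_intg x mv v1.
have i1 : intg P (fun w => u1 x (v w)).
  by apply: (intg_dom (mfH_continuous mv u1c) (intgZ C v1)) => w; exact: (C21_bd1 uC).
have i2 : intg P (fun w => u2 x (v w) (v w)).
  apply: (bilinear_intg _ _ (C21_bd2 uC x)) => // [a y z k|a y z k].
  - exact: (C21_lin2l uC).
  - exact: (C21_lin2r uC).
have i012 := intgB (intgB (intgB i0 (intg_cst P (u x))) i1) (intgZ 2^-1 i2).
have -> : Ex P (fun w => u (x + v w)) -
    (u x + Ex P (fun w => u1 x (v w)) + Ex P (fun w => u2 x (v w) (v w)) / 2) =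
   Ex P (fun w => u (x + v w) - u x - u1 x (v w) - 2^-1 * u2 x (v w) (v w)).
  have j := intg_cst P (u x).
  rewrite (ExB (intgB (intgB i0 j) i1) (intgZ 2^-1 i2)) (ExB (intgB i0 j) i1) (ExB i0 j).
  by rewrite (ExZ _ i2) Ex_cst; ring.
rewrite (le_trans (Ex_norm i012))// -ExZ//; apply: Ex_le => [||w].
- exact: intg_norm.
- exact: intgZ.
by rewrite [2^-1 * _]mulrC; exact: (taylor2 uC uK).
Qed.

End TaylorStep.

Section Matching.
Context (R : realType) (H : hilbertType R) (H_sep : separable_space H)
  d (T : measurableType d) (mu : probability T R) (e : l2basis mu)
  dO (Omega : measurableType dO) (P : probability Omega R)
  (xi : nat -> nat -> {RV P >-> R}).
Hypothesis xi_iid : iid (I := (nat * nat)%type) [pred q | l2idx e q.2]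
     (fun q => xi q.1 q.2) (normal_prob 0 1).

Let idx := l2idx e.
Let xm i : idx i -> measurable_fun setT (xi 0%N i : Omega -> R).
Proof. by []. Qed.
Let x2 i : idx i -> intg P (fun w => xi 0%N i w ^+ 2).
Proof. by move=> ii; exact: (xi_intg xi_iid 0 ii). Qed.
Let xx i j : idx i -> idx j -> Ex P (fun w => xi 0%N i w * xi 0%N j w) = (i == j)%:R.
Proof. exact: (xi_orthonormal xi_iid). Qed.

Lemma noise_expands (A : {hs e -> H}) (W : Omega -> H) :
  is_noise P (fun i => xi 0%N i) (fun=> A) W ->
  expands P idx (fun i => xi 0%N i : Omega -> R) W (fun i => A (l2vec e i)).
Proof.
move=> [mW W0]; set c := fun i => A (l2vec e i).
have mo N := osum_mfH H_sep xm c N.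
have [|N w|near_i lim] := @cvge0_Ex _ _ R P
   (fun N w => `|W w - osum idx (fun i => xi 0%N i : Omega -> R) c N w| ^+ 2) _ _ W0.
- by move=> N; apply: measurable_funX; apply: mfH_norm0; apply: mfHB.
- exact: sqr_ge0.
split=> //.
(* One N with integrable error places [W] in L^2, as [W] is that error plus a finite sum. *)
have [N _ /(_ N (leqnn N)) iN] := near_i.
have [oN _] := osum_sqr xm x2 xx c N.
have [+ _] := intg_sqrD H_sep (mfHB H_sep mW (mo N)) (mo N) iN oN.
by apply: eq_intg => w; rewrite subrK.
Qed.

(** Every finite sum of coordinates has mean zero, and the error in L^2 controls the error of the
    mean. *)
Lemma noise_linear (A : {hs e -> H}) (W : Omega -> H) (L : H -> R) (C : R) :
  is_noise P (fun i => xi 0%N i) (fun=> A) W ->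
  (forall (a : R) x y, L (a *: x + y) = a * L x + L y) -> (forall x, `|L x| <= C * `|x|) ->
  Ex P (fun w => L (W w)) = 0.
Proof.
move=> WA Ll LC; have [mW W2 cW] := noise_expands WA.
set c := fun i => A (l2vec e i) in cW.
pose o := osum idx (fun i => xi 0%N i : Omega -> R) c.
have mo N : mfH (o N) := osum_mfH H_sep xm c N.
have LB x y : L (x - y) = L x - L y by rewrite addrC -scaleN1r Ll mulN1r addrC.
have Lc : continuous L by apply: (@lipschitz_cvg _ _ _ _ C) => x y; rewrite -LB.
have L0 : L 0 = 0.
  by have := Ll 1 0 0; rewrite scale1r addr0 mul1r => /eqP; rewrite -subr_eq subrr eq_sym => /eqP.
have iL (f : Omega -> H) : mfH f -> intg P (fun w => `|f w| ^+ 2) -> intg P (fun w => L (f w)).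
  move=> mf f2; have f1 := intg_sqr (mfH_norm0 mf) f2.
  by apply: (intg_dom (mfH_continuous mf Lc) (intgZ C f1)) => w; exact: LC.
have x1 i : idx i -> intg P (fun w => xi 0%N i w).
  by move=> ii; apply: intg_sqr => //; exact: x2.
have eo N : Ex P (fun w => L (o N w)) = 0.
  have E w : L (o N w) = \sum_(i < N | idx i) L (c i) * xi 0%N i w.
    rewrite /o /osum; elim/big_rec2 : _ => [|i y x _ <-]; first exact: L0.
    by rewrite Ll mulrC.
  rewrite (eq_Ex P E) Ex_sum; last by move=> i ii; apply: intgZ; exact: x1.
  apply: big1 => i ii; rewrite ExZ; last exact: x1.
  rewrite (eq_Ex P (g := fun w => xi 0%N i w ^+ 1)); last by move=> w; rewrite expr1.
  by rewrite (xi_odd xi_iid)// mulr0.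
have bd N : `|Ex P (fun w => L (W w))| <= `|C| * Num.sqrt (Ex P (fun w => `|W w - o N w| ^+ 2)).
  have [s2 _] := osum_sqr xm x2 xx c N.
  have [r2 _] := intg_sqrB H_sep mW (mo N) W2 s2.
  have mr := mfHB H_sep mW (mo N).
  have r1 := intg_sqr (mfH_norm0 mr) r2.
  rewrite -[X in `|X|]subr0 -(eo N) -ExB; [|exact: iL|exact: iL].
  rewrite (eq_Ex P (g := fun w => L (W w - o N w))); last by move=> w; rewrite LB.
  rewrite (le_trans (Ex_norm (iL _ mr r2)))//.
  apply: (@le_trans _ _ (Ex P (fun w => `|C| * `|W w - o N w|))).
    apply: Ex_le => [||w]; [exact: intg_norm (iL _ mr r2)|exact: intgZ|].
    by rewrite (le_trans (LC _))// ler_wpM2r// ler_norm.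
  rewrite ExZ// ler_wpM2l//; apply: (Ex_le_sqrt (mfH_norm0 mr) r2); first exact: sqrtr_ge0.
  by rewrite sqr_sqrtr//; apply: Ex_ge0 => w; exact: sqr_ge0.
apply/eqP; rewrite -normr_eq0 eq_le normr_ge0 andbT.
have lim : `|C| * Num.sqrt (Ex P (fun w => `|W w - o N w| ^+ 2)) @[N --> \oo] --> (0 : R).
  rewrite -(mulr0 `|C|); apply: cvgMr; rewrite -(sqrtr0 R).
  by apply: continuous_cvg => //; exact: sqrt_continuous.
rewrite -(cvg_lim _ lim)//; apply: limr_ge; first by apply/cvg_ex; exists 0.
by apply: nearW => N; exact: bd.
Qed.

(** Tested on basis vectors and inner products, the Bochner hypothesis says that A e_i is the i-th
    coefficient of [V]. So [V] under [mu] and [W] under [P] expand with the same coefficients, and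
    both sides are limits of one sequence. *)
Lemma noise_covariance (V : T -> H) (A : {hs e -> H}) (W : Omega -> H) (Q : H -> H -> R) (C : R) :
  mfH V -> intg mu (fun x => `|V x| ^+ 2) ->
  (forall u : L2 mu, bochner_mean mu (fun x => u x *: V x) (A u)) ->
  is_noise P (fun i => xi 0%N i) (fun=> A) W ->
  (forall (a : R) x y v, Q (a *: x + y) v = a * Q x v + Q y v) ->
  (forall (a : R) x y v, Q v (a *: x + y) = a * Q v x + Q v y) ->
  (forall x y, `|Q x y| <= C * `|x| * `|y|) ->
  Ex mu (fun x => Q (V x) (V x)) = Ex P (fun w => Q (W w) (W w)).
Proof.
move=> mV V2 AV WA Ql Qr QC.
have eV : expands mu idx (fun i => l2vec e i : T -> R) V (fun i => A (l2vec e i)).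
  apply: parseval => // i h ii.
  have dl (a : R) x y : dot (a *: x + y) h = a * dot x h + dot y h by exact: dot_lin_l.
  have db x : `|dot x h| <= `|h| * `|x| by rewrite mulrC dot_le.
  have [_ <-] := bochner_mean_linear H_sep (AV (l2vec e i)) dl db.
  by apply: eq_Ex => x; rewrite dotZl.
have c1 := expands_bilinear H_sep (@l2vec_meas _ _ _ _ e) (@l2vec_sqr _ _ _ _ e)
  (@l2vec_orthonormal _ _ _ _ e) eV Ql Qr QC.
have c2 := expands_bilinear H_sep xm x2 xx (noise_expands WA) Ql Qr QC.
exact: (cvg_unique _ c1 c2).
Qed.

Lemma noise_tail (A : {hs e -> H}) (W : Omega -> H) N :
  is_noise P (fun i => xi 0%N i) (fun=> A) W ->
  Ex P (fun w => `|W w - gsum idx xi 0 (fun i => A (l2vec e i)) N w| ^+ 2) =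
  `|A| ^+ 2 - \sum_(i < N | idx i) `|A (l2vec e i)| ^+ 2.
Proof.
move=> WA; have eW := noise_expands WA.
have [_ E] := expands_tail H_sep xm x2 xx N eW; apply: (etrans E); congr (_ - _).
have c1 := expands_sqr H_sep xm x2 xx eW.
have c2 := @hs_partial_cvg _ _ _ _ e _ A.
exact: (cvg_unique _ c1 c2).
Qed.

End Matching.

(** * Derivative bounds along the truncated Gaussian chain *)

Ltac nonneg := repeat first [assumption | exact: sqr_ge0 | exact: sqrtr_ge0 | by []
  | apply: addr_ge0 | apply: mulr_ge0 | apply: exprn_ge0 | rewrite invr_ge0].

Section DerivativeRecursion.
Context (R : realType).
Variables (eta B j1 j2 j3 d1 d2 d3 : R).
Hypotheses (eta0 : 0 < eta) (B0 : 0 < B) (Bj1 : B <= j1) (j20 : 0 <= j2) (j30 : 0 <= j3)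
  (d10 : 0 <= d1) (d20 : 0 <= d2) (d30 : 0 <= d3).

Let e0 : 0 <= eta := ltW eta0.
Let b0 : 0 <= B := ltW B0.
Let eb0 : 0 <= eta * B. Proof. exact: mulr_ge0. Qed.

(** The quantity C_1(eta). If S bounds the derivative of sigma and B^2 + S^2 = j1^2, it equals (1 +
    eta B)^2 + (eta S)^2, a bound for the second moment of the linearised step; [growth1] and
    [growth3] bound the first and third moments. *)
Definition growth2 : R := 1 + 2 * eta * B + eta ^+ 2 * j1 ^+ 2.
Definition growth1 : R := Num.sqrt growth2.
Definition growth3 : R := expR (eta * (4 * B + 6 * eta * j1 ^+ 2)).

Lemma growth2_ge1 : 1 <= growth2.
Proof. by rewrite /growth2 -addrA lerDl; nonneg. Qed.

Lemma growth1_sqr : growth1 ^+ 2 = growth2.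
Proof. by rewrite sqr_sqrtr// (le_trans ler01)// growth2_ge1. Qed.

Lemma growth1_lower : 1 + eta * B <= growth1.
Proof.
rewrite -(@ler_pXn2r _ 2) ?nnegrE ?sqrtr_ge0//; last by nonneg.
rewrite growth1_sqr /growth2.
have : (eta * B) ^+ 2 <= (eta * j1) ^+ 2.
  have h : eta * B <= eta * j1 by rewrite ler_wpM2l.
  by rewrite lerXn2r ?nnegrE// (le_trans eb0).
rewrite !exprMn => h; have -> : (1 + eta * B) ^+ 2 = 1 + 2 * eta * B + eta ^+ 2 * B ^+ 2 by ring.
by rewrite lerD2l.
Qed.

Lemma growth1_ge1 : 1 <= growth1.
Proof. by apply: le_trans growth1_lower; rewrite lerDl. Qed.

Lemma growth2_growth1 : eta * B <= growth2 - growth1.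
Proof.
rewrite -growth1_sqr; have := growth1_ge1; have := growth1_lower.
move: growth1 => c h1 h2; nra.
Qed.

Lemma growth3_lower : 1 + eta * (4 * B + 6 * eta * j1 ^+ 2) <= growth3.
Proof. exact: expR_ge1Dx. Qed.

Lemma growth3_growth2 : 2 * eta * B <= growth3 - growth2.
Proof.
have := growth3_lower; rewrite /growth2.
have : 0 <= eta ^+ 2 * j1 ^+ 2 by nonneg.
by move: growth3 => a h0 h1; nra.
Qed.

Lemma growth3_ge1 : 1 <= growth3.
Proof.
apply: le_trans growth3_lower; by rewrite lerDl; nonneg.
Qed.

(* [growth3 = (exp x)^2 >= (1 + x)^2] with [x = eta (2 B + 3 eta j1^2)]. *)
Lemma growth3_fourth (s : R) : B ^+ 2 + s ^+ 2 = j1 ^+ 2 ->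
  ((1 + eta * B) ^+ 2 + 3 * (eta * s) ^+ 2) ^+ 2 <= growth3.
Proof.
move=> Bs; set x := eta * (2 * B + 3 * eta * j1 ^+ 2).
have -> : growth3 = expR x ^+ 2.
  by rewrite /growth3 (_ : eta * _ = 2%:R * x) ?expRM_natl//; rewrite /x; ring.
have x0 : 0 <= 1 + eta * B by nonneg.
rewrite lerXn2r ?nnegrE ?expR_ge0//; first by nonneg.
apply: le_trans (expR_ge1Dx x); rewrite /x -Bs.
have : 0 <= eta ^+ 2 * B ^+ 2 by nonneg.
by move=> h; nra.
Qed.

(** Explicit supersolutions of the triangular recursion for the three derivative bounds. A forcing
    term of ratio [growth1] or [growth2] contributes a difference of powers divided by a lower bound
    for the gap of the ratios, which is eta B, or 2 eta B for [Y]. The factor eta cancels and B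
    stays in the denominator. *)
Definition bound1 n := d1 * growth1 ^+ n.
Definition bound2 n := growth2 ^+ n * d2 + d1 * j2 / B * (growth2 ^+ n - growth1 ^+ n).
Let X := 3 * (d2 + d1 * j2 / B) * j2 * growth1 / B.
Let Y := d1 * j3 / (2 * B).
Definition bound3 n := growth3 ^+ n * d3 + X * (growth3 ^+ n - growth2 ^+ n)
  + Y * (growth3 ^+ n - growth1 ^+ n).

Let c_le : growth1 <= growth2.
Proof. by rewrite -subr_ge0; apply: le_trans growth2_growth1. Qed.
Let c2_le : growth2 <= growth3.
Proof. by rewrite -subr_ge0; apply: le_trans growth3_growth2; nonneg. Qed.
Let c0 : 0 <= growth1. Proof. exact: sqrtr_ge0. Qed.
Let c20 : 0 <= growth2. Proof. exact: le_trans c_le. Qed.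
Let c30 : 0 <= growth3. Proof. exact: le_trans c2_le. Qed.
Let q0 : 0 <= d1 * j2 / B. Proof. by nonneg. Qed.
Let X0 : 0 <= X. Proof. by rewrite /X; nonneg. Qed.
Let Y0 : 0 <= Y. Proof. by rewrite /Y; nonneg. Qed.

Lemma bound1_ge0 n : 0 <= bound1 n.
Proof. by rewrite /bound1; nonneg. Qed.
Lemma bound2_ge0 n : 0 <= bound2 n.
Proof.
rewrite /bound2; apply: addr_ge0; first by nonneg.
by apply: mulr_ge0; rewrite ?subr_ge0 ?lerXn2r ?nnegrE.
Qed.
Lemma bound3_ge0 n : 0 <= bound3 n.
Proof.
have c13 := le_trans c_le c2_le.
rewrite /bound3; apply: addr_ge0; first apply: addr_ge0; first by nonneg.
  by apply: mulr_ge0; rewrite ?subr_ge0 ?lerXn2r ?nnegrE.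
by apply: mulr_ge0; rewrite ?subr_ge0 ?lerXn2r ?nnegrE.
Qed.

Lemma bound1S n : growth1 * bound1 n = bound1 n.+1.
Proof. by rewrite /bound1 exprS; ring. Qed.

Lemma bound2S n : growth1 ^+ 2 * bound2 n + eta * j2 * bound1 n <= bound2 n.+1.
Proof.
rewrite growth1_sqr -subr_ge0.
have -> : bound2 n.+1 - (growth2 * bound2 n + eta * j2 * bound1 n) =
  (d1 * j2 / B) * growth1 ^+ n * (growth2 - growth1 - eta * B).
  by rewrite /bound2 /bound1 !exprS; field; rewrite gt_eqF.
apply: mulr_ge0; first by nonneg.
by rewrite subr_ge0 growth2_growth1.
Qed.

Lemma bound3S n : growth3 * bound3 n + 3 * (eta * j2 * growth1) * bound2 n
    + eta * j3 * bound1 n <= bound3 n.+1.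
Proof.
have b2 : bound2 n <= growth2 ^+ n * (d2 + d1 * j2 / B).
  by rewrite /bound2 [leRHS]mulrDr lerD2l [leRHS]mulrC ler_wpM2l// lerBlDr lerDl exprn_ge0//.
apply: (@le_trans _ _ (growth3 * bound3 n + 3 * (eta * j2 * growth1) *
   (growth2 ^+ n * (d2 + d1 * j2 / B)) + eta * j3 * bound1 n)).
  by rewrite lerD2r lerD2l ler_wpM2l//; nonneg.
rewrite -subr_ge0.
have -> : bound3 n.+1 - (growth3 * bound3 n + 3 * (eta * j2 * growth1) *
   (growth2 ^+ n * (d2 + d1 * j2 / B)) + eta * j3 * bound1 n) =
   X * growth2 ^+ n * (growth3 - growth2 - eta * B) +
   Y * growth1 ^+ n * (growth3 - growth1 - 2 * eta * B).
  by rewrite /bound3 /bound1 /X /Y !exprS; field; rewrite gt_eqF.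
have h := growth3_growth2; apply: addr_ge0; (apply: mulr_ge0; first by nonneg).
- by move: h eb0; move: growth3 growth2 => p q; lra.
- by move: h eb0 c_le; move: growth3 growth2 growth1 => p q r; lra.
Qed.

(** [X] is six times A_2 and [Y] is one of the two terms of A_3. The factor 6 will meet the 1/6 of
    the Taylor remainder. *)
Lemma bound3_le n : bound3 n <= 6 * (d3 + (d2 + d1 * j2 / B) * (j2 * growth1 / (2 * B))
  + (2 * B)^-1 * (d1 * j2 ^+ 2 * growth1 / (2 * B) + d1 * j3)) * growth3 ^+ n.
Proof.
apply: (@le_trans _ _ ((d3 + X + Y) * growth3 ^+ n)).
  rewrite -subr_ge0.
  have -> : (d3 + X + Y) * growth3 ^+ n - bound3 n = X * growth2 ^+ n + Y * growth1 ^+ n.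
    by rewrite /bound3; ring.
  by nonneg.
rewrite ler_wpM2r ?exprn_ge0//.
have z0 : 0 <= (2 * B)^-1 * (d1 * j2 ^+ 2 * growth1 / (2 * B)).
  by nonneg.
rewrite -subr_ge0.
have -> : 6 * (d3 + (d2 + d1 * j2 / B) * (j2 * growth1 / (2 * B))
  + (2 * B)^-1 * (d1 * j2 ^+ 2 * growth1 / (2 * B) + d1 * j3)) - (d3 + X + Y) =
  5 * d3 + 6 * ((2 * B)^-1 * (d1 * j2 ^+ 2 * growth1 / (2 * B))) + 5 * Y.
  by rewrite /X /Y; field; rewrite gt_eqF.
by nonneg.
Qed.

(* Geometric sum: [growth3 - 1 >= 4 eta B]. *)
Lemma growth3_sum k : 4 * eta * B * \sum_(i < k) growth3 ^+ i <= growth3 ^+ k - 1.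
Proof.
rewrite subrX1 ler_wpM2r//; first by apply: sumr_ge0 => i _; exact: exprn_ge0.
have := growth3_lower; have : 0 <= eta * (6 * eta * j1 ^+ 2).
  by nonneg.
by move: growth3 => a h; lra.
Qed.

End DerivativeRecursion.

Lemma supD_ge0 (R : realType) (V W : normedModType R) (f : V -> W) : bounded_derivatives3 f ->
  [/\ 0 <= fine (supD1 f), 0 <= fine (supD2 f) & 0 <= fine (supD3 f)].
Proof.
move=> [_ _ _ [s1 s2 s3]]; split.
- exact: le_trans (normr_ge0 _) (supnorm_ub 0 s1).
- exact: le_trans (normr_ge0 _) (supnorm_ub 0 s2).
- exact: le_trans (normr_ge0 _) (supnorm_ub 0 s3).
Qed.

Lemma bounded_derivatives_C21_ge0 (R : realType) (V W : normedModType R) (f : V -> W) :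
  bounded_derivatives3 f ->
  exists2 C, 0 <= C & C21 f (fun x h => frechet f x h) (fun x h k => frechet (frechet f) x h k) C.
Proof.
move=> /bounded_derivatives_C21[C fC]; exists (Num.max 0 C); first by rewrite le_max lexx.
by apply: C21_le fC; rewrite le_max lexx orbT.
Qed.

Section HilbertSchmidtCoordinates.
Context d (T : measurableType d) (R : realType) (mu : probability T R)
  (e : l2basis mu) (H : hilbertType R).

Lemma hs_partial_sum (A : {hs e -> H}) N :
  \sum_(i < N | l2idx e i) `|A (l2vec e i)| ^+ 2 <= `|A| ^+ 2.
Proof.
rewrite -lee_fin hsnorm_sqr /hs_sum -sumEFin.
rewrite -(big_mkord (l2idx e) (fun i => (`|A (l2vec e i)| ^+ 2)%:E)).
apply: nneseries_lim_ge => i _ _; by rewrite lee_fin sqr_ge0.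
Qed.

Lemma hs_coord_le (A : {hs e -> H}) i : l2idx e i -> `|A (l2vec e i)| <= `|A|.
Proof.
move=> ii; rewrite -(@ler_pXn2r _ 2) ?nnegrE//.
apply: le_trans (hs_partial_sum A i.+1); rewrite (big_ord_condS (l2idx e) (fun j => `|A (l2vec e j)| ^+ 2)) ii lerDr.
by apply: sumr_ge0 => j _; exact: sqr_ge0.
Qed.

End HilbertSchmidtCoordinates.

Section TruncatedStep.
Context (R : realType) (H : hilbertType R) (H_sep : separable_space H)
  d (T : measurableType d) (mu : probability T R) (e : l2basis mu)
  dO (Omega : measurableType dO) (P : probability Omega R)
  (xi : nat -> nat -> {RV P >-> R}).
Hypothesis xi_iid : iid (I := (nat * nat)%type) [pred q | l2idx e q.2]
     (fun q => xi q.1 q.2) (normal_prob 0 1).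
Variables (b : H -> H) (sigma : H -> {hs e -> H}) (g : H -> R) (eta : R).
Hypotheses (b_bd : bounded_derivatives3 b) (sigma_bd : bounded_derivatives3 sigma)
  (g_bd : bounded_derivatives3 g) (Db0 : 0 < fine (supD1 b)) (eta0 : 0 < eta).

Let idx := l2idx e.

Definition hsnoise k (A : {hs e -> H}) N w : H :=
  gsum idx xi k (fun i => A (l2vec e i)) N w.

Definition tstep k N x w : H := x + eta *: b x + eta *: hsnoise k (sigma x) N w.

Lemma hsnoise_scale k A N w :
  eta *: hsnoise k A N w = gsum idx xi k (fun i => eta *: A (l2vec e i)) N w.
Proof.
rewrite /hsnoise /gsum scaler_sumr; apply: eq_bigr => i _.
by rewrite !scalerA mulrC.
Qed.

Lemma hsnoise_mfH k A N : mfH (hsnoise k A N).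
Proof. exact: gsum_mfH. Qed.

Lemma hsnoise_moments k (a : H) A N :
  [/\ intg P (fun w => `|a + eta *: hsnoise k A N w| ^+ 4),
     Ex P (fun w => `|a + eta *: hsnoise k A N w| ^+ 2) <= `|a| ^+ 2 + eta ^+ 2 * `|A| ^+ 2
   & Ex P (fun w => `|a + eta *: hsnoise k A N w| ^+ 4) <=
      (`|a| ^+ 2 + 3 * (eta ^+ 2 * `|A| ^+ 2)) ^+ 2].
Proof.
have e1 m w : `|a + eta *: hsnoise k A N w| ^+ m =
    `|a + gsum idx xi k (fun i => eta *: A (l2vec e i)) N w| ^+ m by rewrite hsnoise_scale.
have [i4 E2 E4] := gsum_moments H_sep xi_iid k a (fun i => eta *: A (l2vec e i)) N.
have s : \sum_(i < N | idx i) `|eta *: A (l2vec e i)| ^+ 2 <= eta ^+ 2 * `|A| ^+ 2.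
  under eq_bigr do rewrite normrZ exprMn real_normK ?num_real//.
  by rewrite -mulr_sumr ler_wpM2l ?sqr_ge0// hs_partial_sum.
split; first exact: (eq_intg (e1 4%N)).
  by rewrite (eq_Ex P (e1 2%N)) E2 lerD2l.
rewrite (eq_Ex P (e1 4%N)); apply: (le_trans E4).
have s0 : 0 <= \sum_(i < N | idx i) `|eta *: A (l2vec e i)| ^+ 2.
  by apply: sumr_ge0 => i _; exact: sqr_ge0.
by apply: lerXn2r; rewrite ?nnegrE; [nonneg|nonneg|rewrite lerD2l ler_wpM2l].
Qed.

Let b1 x h : H := frechet b x h.
Let b2 x h k : H := frechet (frechet b) x h k.
Let s1 x h : {hs e -> H} := frechet sigma x h.
Let s2 x h k : {hs e -> H} := frechet (frechet sigma) x h k.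
Let f1 N w x h := h + eta *: b1 x h + eta *: hsnoise 0 (s1 x h) N w.
(** The 0 is the second derivative of the identity, kept so that the sum has the shape produced by
    [C21D]. *)
Let f2 N w x h k := 0 + eta *: b2 x h k + eta *: hsnoise 0 (s2 x h k) N w.

(** The pathwise constant is affine in a finite sum of the |xi_i|, hence has a fourth moment; it
    grows with N and serves only for integrability. *)
Let tstep_C21 N : exists L : Omega -> R,
  [/\ forall w, C21 (fun x => tstep 0 N x w) (f1 N w) (f2 N w) (L w),
      forall w, 1 <= L w, measurable_fun setT L & intg P (fun w => L w ^+ 4)].
Proof.
have [Cb Cb0 bC] := bounded_derivatives_C21_ge0 b_bd.
have [Cs Cs0 sC] := bounded_derivatives_C21_ge0 sigma_bd.
pose S w := \sum_(i < N | idx i) (`|xi 0%N i w| * Cs).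
exists (fun w => 1 + eta * Cb + eta * S w).
have lineta : linear ( *:%R eta : H -> H).
  by move=> a x y; rewrite scalerDr !scalerA mulrC.
have neta (x : H) : `|eta *: x| <= eta * `|x| by rewrite normrZ gtr0_norm.
have S0 w : 0 <= S w by apply: sumr_ge0 => i _; rewrite mulr_ge0.
have [mS iS] : measurable_fun setT S /\ intg P (fun w => S w ^+ 4).
  rewrite /S; clear S S0; elim: N => [|n [mS iS]].
    have z w : \sum_(i < 0 | idx i) (`|xi 0%N i w| * Cs) = 0 by rewrite big_ord0.
    split; first by rewrite (funext z); exact: measurable_cst.
    by apply: (eq_intg (g := fun=> 0 ^+ 4)); [move=> w; rewrite z|exact: intg_cst].
  have z w : \sum_(i < n.+1 | idx i) (`|xi 0%N i w| * Cs) = \sum_(i < n | idx i) (`|xi 0%N i w| * Cs)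
      + (if idx n then `|xi 0%N n w| * Cs else 0).
    exact: (big_ord_condS idx (fun i => `|xi 0%N i w| * Cs)).
  have m1 : measurable_fun setT (fun w => if idx n then `|xi 0%N n w| * Cs else 0).
    by case: (idx n) => //; apply: measurable_funM => //; exact: measurableT_comp.
  split; first by rewrite (funext z); exact: measurable_funD.
  apply: (eq_intg (g := fun w => (\sum_(i < n | idx i) (`|xi 0%N i w| * Cs)
      + (if idx n then `|xi 0%N n w| * Cs else 0)) ^+ 4)); first by move=> w; rewrite z.
  apply: intg_pow4D => //; case: (boolP (idx n)) => idn; last exact: intg_cst.
  apply: (eq_intg (g := fun w => Cs ^+ 4 * xi 0%N n w ^+ 4)).
    by move=> w; rewrite exprMn mulrC -normrX ger0_norm// (_ : 4 = 2 * 2)%N// exprM sqr_ge0.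
  by apply: intgZ; exact: (xi_intg xi_iid 0 idn).
split.
- move=> w; apply: C21D; first apply: C21D; first exact: C21_id.
    exact: (C21_map lineta (ltW eta0) neta bC).
  apply: (C21_map lineta (ltW eta0) neta).
  apply: (@C21_sum _ _ _ _ _ _ (fun (i : 'I_N) x => xi 0%N i w *: sigma x (l2vec e i))
    (fun (i : 'I_N) x h => xi 0%N i w *: s1 x h (l2vec e i))
    (fun (i : 'I_N) x h k => xi 0%N i w *: s2 x h k (l2vec e i))) => i ii.
  apply: (C21_map (L := fun A : {hs e -> H} => xi 0%N i w *: A (l2vec e i)) _ _ _ sC) => //.
    move=> a A A'; rewrite -[(a *: A + A') _]/(a *: A (l2vec e i) + A' (l2vec e i)).
    by rewrite scalerDr !scalerA mulrC.
  by move=> A; rewrite normrZ ler_wpM2l// hs_coord_le.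
- by move=> w; rewrite -addrA lerDl addr_ge0// mulr_ge0// ltW.
- by apply: measurable_funD => //; exact: measurable_funM.
have meS : measurable_fun setT (fun w => eta * S w) by exact: measurable_funM.
apply: (intg_pow4D (f := fun=> 1 + eta * Cb)) => //; first exact: intg_cst.
by apply: (eq_intg (g := fun w => eta ^+ 4 * S w ^+ 4)); [move=> w; rewrite exprMn|exact: intgZ].
Qed.

(** The noise of step 0 stands for a generic copy; [tstep_law] transfers the result to the other
    steps. *)
Fixpoint flow N n (x : H) : R :=
  if n is m.+1 then Ex P (fun w => flow N m (tstep 0 N x w)) else g x.

Let B := fine (supD1 b).
Let j1 := J1 b sigma.
Let j2 := J2 b sigma.
Let j3 := J3 b sigma.
Let d1 := fine (supD1 g).
Let d2 := fine (supD2 g).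
Let d3 := fine (supD3 g).
Let c := growth1 eta B j1.
Let al := growth3 eta B j1.

Let Bj1 : B <= j1.
Proof.
rewrite /j1 /J1 -[leLHS]ger0_norm ?(ltW Db0)// -sqrtr_sqr ler_wsqrtr// lerDl sqr_ge0//.
Qed.
Let j1E : j1 ^+ 2 = B ^+ 2 + fine (supD1 sigma) ^+ 2.
Proof. by rewrite sqr_sqrtr// addr_ge0 ?sqr_ge0. Qed.
Let j2E : j2 ^+ 2 = fine (supD2 b) ^+ 2 + fine (supD2 sigma) ^+ 2.
Proof. by rewrite sqr_sqrtr// addr_ge0 ?sqr_ge0. Qed.
Let j3E : j3 ^+ 2 = fine (supD3 b) ^+ 2 + fine (supD3 sigma) ^+ 2.
Proof. by rewrite sqr_sqrtr// addr_ge0 ?sqr_ge0. Qed.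

Lemma tstep_mfH k N x : mfH (tstep k N x).
Proof.
by apply: (mfHD H_sep); [exact: mfH_cst|apply: (mfHZ H_sep) => //; exact: hsnoise_mfH].
Qed.

Lemma tstep_intg k N x : intg P (fun w => `|tstep k N x w|).
Proof.
have [i4 _ _] := hsnoise_moments k (x + eta *: b x) (sigma x) N.
have := intg_pow_le (isT : (1 <= 4)%N) (mfH_norm0 (tstep_mfH k N x)) i4.
by apply: eq_intg => w; rewrite expr1.
Qed.

Let sqr_moment (a : H) A N (p q r : R) : 0 <= p -> 0 <= q -> `|a| <= p * r -> `|A| <= q * r ->
  Ex P (fun w => `|a + eta *: hsnoise 0 A N w| ^+ 2) <= (p ^+ 2 + (eta * q) ^+ 2) * r ^+ 2.
Proof.
move=> p0 q0 ap Aq; have [_ E2 _] := hsnoise_moments 0 a A N.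
have h1 : `|a| ^+ 2 <= (p * r) ^+ 2 by rewrite lerXn2r ?nnegrE// (le_trans _ ap).
have h2 : `|A| ^+ 2 <= (q * r) ^+ 2 by rewrite lerXn2r ?nnegrE// (le_trans _ Aq).
apply: (le_trans E2); rewrite mulrDl; apply: lerD; first by rewrite -exprMn.
by rewrite [(eta * q) ^+ 2]exprMn -[leRHS](mulrA (eta ^+ 2)) ler_wpM2l ?sqr_ge0// -exprMn.
Qed.

(** Induction through the averaging bounds, with moment constants [growth1], [growth3], eta J_2 and
    eta J_3. Drift and noise are orthogonal in the mean, so in [sqr_moment] the squares of their
    bounds add up to J_i^2. *)
Lemma flow_C21 N n : exists u1 u2 C,
  [/\ C21 (flow N n) u1 u2 C /\ 0 <= C,
    forall x h, `|u1 x h| <= bound1 eta B j1 d1 n * `|h|,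
    forall x h k, `|u2 x h k| <= bound2 eta B j1 j2 d1 d2 n * `|h| * `|k| &
    forall x h k l, `|u2 (x + h) k l - u2 x k l| <=
      bound3 eta B j1 j2 j3 d1 d2 d3 n * `|h| * `|k| * `|l|].
Proof.
have [d10 d20 d30] := supD_ge0 g_bd.
have [_ b20 b30] := supD_ge0 b_bd; have [s10 s20 s30] := supD_ge0 sigma_bd.
have [bb1 bb2 bb3] := bounded_derivatives_sharp b_bd.
have [ss1 ss2 ss3] := bounded_derivatives_sharp sigma_bd.
have B0 : 0 <= B := ltW Db0.
have eb0 : 0 <= eta * B by rewrite mulr_ge0 ?(ltW eta0).
have j20 : 0 <= j2 by exact: sqrtr_ge0.
have j30 : 0 <= j3 by exact: sqrtr_ge0.
elim: n => [|n [u1 [u2 [C [[uC C0] uK1 uK2 uK3]]]]].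
  have [C C0 gC] := bounded_derivatives_C21_ge0 g_bd.
  have [gg1 gg2 gg3] := bounded_derivatives_sharp g_bd.
  exists (fun x h => frechet g x h), (fun x h k => frechet (frechet g) x h k), C.
  by rewrite /bound1 /bound2 /bound3 !expr0 !subrr !mulr0 !addr0 !mulr1 !mul1r.
have [L [fL L1 mL iL]] := tstep_C21 N.
have mf x : mfH (tstep 0 N x) := tstep_mfH 0 N x.
have mf1 x h : mfH (fun w => f1 N w x h).
  by apply: (mfHD H_sep); [exact: mfH_cst|apply: (mfHZ H_sep) => //; exact: hsnoise_mfH].
have mf2 x h k : mfH (fun w => f2 N w x h k).
  by apply: (mfHD H_sep); [exact: mfH_cst|apply: (mfHZ H_sep) => //; exact: hsnoise_mfH].
have ifn x : intg P (fun w => `|tstep 0 N x w|) := tstep_intg 0 N x.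
have c0 : 0 <= c by exact: sqrtr_ge0.
have c2E : c ^+ 2 = (1 + eta * B) ^+ 2 + (eta * fine (supD1 sigma)) ^+ 2.
  by rewrite /c growth1_sqr// /growth2 j1E; ring.
have al1 : 1 <= al by exact: growth3_ge1.
have nh1 x h : `|h + eta *: b1 x h| <= (1 + eta * B) * `|h|.
  rewrite (le_trans (ler_normD _ _))// mulrDl mul1r lerD2l normrZ gtr0_norm// -mulrA.
  by rewrite ler_wpM2l ?(ltW eta0)// bb1.
have m2 x h : Ex P (fun w => `|f1 N w x h| ^+ 2) <= (c * `|h|) ^+ 2.
  by rewrite exprMn c2E; apply: sqr_moment => //; [rewrite addr_ge0|exact: ss1].
have m4 x h : Ex P (fun w => `|f1 N w x h| ^+ 4) <= al * `|h| ^+ 4.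
  have [_ _ E4] := hsnoise_moments 0 (h + eta *: b1 x h) (s1 x h) N.
  apply: (le_trans E4).
  apply: (@le_trans _ _ ((((1 + eta * B) ^+ 2 + 3 * (eta * fine (supD1 sigma)) ^+ 2) * `|h| ^+ 2) ^+ 2)).
    apply: lerXn2r; rewrite ?nnegrE; [by nonneg|by nonneg|].
    have h1 : `|h + eta *: b1 x h| ^+ 2 <= ((1 + eta * B) * `|h|) ^+ 2.
      by rewrite lerXn2r ?nnegrE//; nonneg.
    have h2 : (eta * `|s1 x h|) ^+ 2 <= (eta * (fine (supD1 sigma) * `|h|)) ^+ 2.
      have ee := ltW eta0.
      by rewrite lerXn2r ?nnegrE//; [nonneg|nonneg|rewrite ler_wpM2l// ss1].
    rewrite [leRHS]mulrDl; apply: lerD; first by rewrite -exprMn.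
    by rewrite -[leRHS](mulrA 3) ler_wpM2l// -!exprMn -mulrA.
  rewrite (exprMn 2 _ (`|h| ^+ 2)) -(exprM `|h|) ler_wpM2r ?exprn_ge0//.
  by apply: growth3_fourth => //; rewrite j1E.
have n2 (z : R) (y p q : H) : z * `|p| * `|q| = z * (`|p| * `|q|) by rewrite mulrA.
have ee := ltW eta0.
have sec x h k : Ex P (fun w => `|f2 N w x h k| ^+ 2) <= (eta * j2 * `|h| * `|k|) ^+ 2.
  rewrite -mulrA exprMn [(eta * j2) ^+ 2]exprMn j2E mulrDr -!exprMn.
  apply: sqr_moment => //; first exact: mulr_ge0.
    by rewrite add0r normrZ gtr0_norm// -mulrA ler_wpM2l// mulrA bb2.
  by rewrite mulrA ss2.
have third x h k l : Ex P (fun w => `|f2 N w (x + h) k l - f2 N w x k l| ^+ 2) <=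
    (eta * j3 * `|h| * `|k| * `|l|) ^+ 2.
  (* The difference is again a fixed vector plus the noise of a fixed operator, so [sqr_moment]
     applies. *)
  have E w : f2 N w (x + h) k l - f2 N w x k l = eta *: (b2 (x + h) k l - b2 x k l)
     + eta *: hsnoise 0 (s2 (x + h) k l - s2 x k l) N w.
    rewrite /f2 !add0r opprD addrACA -!scalerBr; congr (_ + eta *: _).
    rewrite /hsnoise /gsum -sumrB; apply: eq_bigr => i _; rewrite -scalerBr; congr (_ *: _).
  rewrite (eq_Ex P (g := fun w => `|eta *: (b2 (x + h) k l - b2 x k l)
     + eta *: hsnoise 0 (s2 (x + h) k l - s2 x k l) N w| ^+ 2)); last by move=> w; rewrite E.
  rewrite -!(mulrA (eta * j3)) exprMn [(eta * j3) ^+ 2]exprMn j3E mulrDr -!exprMn.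
  apply: sqr_moment => //; first exact: mulr_ge0.
    by rewrite normrZ gtr0_norm// -(mulrA eta) ler_wpM2l// !mulrA bb3.
  by rewrite !mulrA ss3.
have ej2 : 0 <= eta * j2 by rewrite mulr_ge0.
have ej3 : 0 <= eta * j3 by rewrite mulr_ge0.
have K10 : 0 <= bound1 eta B j1 d1 n by exact: bound1_ge0.
have K20 : 0 <= bound2 eta B j1 j2 d1 d2 n by exact: bound2_ge0.
have K30 : 0 <= bound3 eta B j1 j2 j3 d1 d2 d3 n by exact: bound3_ge0.
eexists; eexists; eexists; split.
- split; first exact: (avg_C21 H_sep fL L1 mL iL mf mf1 mf2 ifn uC C0).
  rewrite !mulr_ge0//; apply: Ex_ge0 => w; rewrite exprn_ge0// (le_trans ler01)//.
- move=> x h; rewrite -bound1S//; exact: (avg_sharp1 H_sep fL L1 mL iL mf mf1 c0 m2 uC C0 K10 uK1).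
- move=> x h k; apply: (le_trans (avg_sharp2 H_sep fL L1 mL iL mf mf1 mf2 c0 ej2 m2 sec uC C0 K10 K20 uK1 uK2 x h k)).
  by rewrite !ler_wpM2r// bound2S.
- move=> x h k l.
  apply: (le_trans (avg_sharp3 H_sep fL L1 mL iL mf mf1 mf2 c0 al1 ej2 ej3 m2 m4 sec third uC C0 K10 K20 K30 uK1 uK2 uK3 x h k l)).
  by rewrite !ler_wpM2r// bound3S.
Qed.

End TruncatedStep.

(** * The truncated Gaussian chain *)

Section TruncatedChain.
Context (R : realType) (H : hilbertType R) (H_sep : separable_space H)
  d (T : measurableType d) (mu : probability T R) (e : l2basis mu)
  dO (Omega : measurableType dO) (P : probability Omega R)
  (xi : nat -> nat -> {RV P >-> R}).
Hypothesis xi_iid : iid (I := (nat * nat)%type) [pred q | l2idx e q.2]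
     (fun q => xi q.1 q.2) (normal_prob 0 1).
Variables (b : H -> H) (sigma : H -> {hs e -> H}) (eta : R).
Hypotheses (b_bd : bounded_derivatives3 b) (sigma_bd : bounded_derivatives3 sigma)
  (eta0 : 0 < eta).

Let idx := l2idx e.
Let B := fine (supD1 b).
Let S := fine (supD1 sigma).

Local Notation sub J := (g_sigma_algebraType (cyl (fun q : nat * nat => xi q.1 q.2 : Omega -> R) J)).
Local Notation step := (tstep xi b sigma eta).
Local Notation noise := (hsnoise xi).

Lemma bounded_derivatives_dist (V W : normedModType R) (f : V -> W) : bounded_derivatives3 f ->
  forall x y, `|f x - f y| <= fine (supD1 f) * `|x - y|.
Proof.
move=> [fd _ _ [s1 _ _]] x y.
have := frechet_lip fd (fun z => supnorm_ub z s1) y (x - y).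
by rewrite [y + _]addrC subrK.
Qed.

Lemma bounded_derivatives_continuous (V W : normedModType R) (f : V -> W) :
  bounded_derivatives3 f -> continuous f.
Proof. by move=> /bounded_derivatives_dist; exact: lipschitz_cvg. Qed.

Lemma hs_coord_continuous i : idx i -> continuous (fun x => sigma x (l2vec e i)).
Proof.
move=> ii; apply: (@lipschitz_cvg _ _ _ _ S) => x y.
exact: le_trans (hs_coord_le (sigma x - sigma y) ii) (bounded_derivatives_dist sigma_bd x y).
Qed.

Lemma tstep_measurable d1 (U : measurableType d1) (X : U -> H) (z : nat -> U -> R) N :
  mfH X -> (forall i, (i < N)%N -> idx i -> measurable_fun setT (z i)) ->
  mfH (fun t => X t + eta *: b (X t) +
    eta *: (\sum_(i < N | idx i) z i t *: sigma (X t) (l2vec e i))).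
Proof.
move=> mX mz; apply: (mfHD H_sep); first apply: (mfHD H_sep) => //.
  by apply: (mfHZ H_sep) => //; apply: (mfH_comp H_sep mX); exact: bounded_derivatives_continuous.
apply: (mfHZ H_sep) => //; apply: (mfH_sum H_sep) => i ii.
apply: (mfHZ H_sep); first exact: mz.
by apply: (mfH_comp H_sep mX (h := fun x => sigma x (l2vec e i))); exact: hs_coord_continuous.
Qed.

Variable phi0 : H.

(** Unlike [flow], the chain uses the noise of its own step, so that it can be compared pathwise
    with the given Gaussian iterates. *)
Fixpoint tchain N k (w : Omega) : H :=
  if k is m.+1 then step m N (tchain N m w) w else phi0.

Definition past k : {pred nat * nat} := [pred q | (q.1 < k)%N && idx q.2].

(** [J] is arbitrary above [past k] so that the induction hypothesis can be used on the larger
    sigma-algebra of the next step. *)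
Lemma tchain_sub N k (J : {pred nat * nat}) : {subset past k <= J} ->
  mfH (tchain N k : sub J -> H).
Proof.
elim: k J => [|k ih] J kJ; first exact: mfH_cst.
apply: (tstep_measurable (X := tchain N k : sub J -> H) (z := fun i => xi k i : sub J -> R)).
  by apply: ih => q /andP[qk qi]; apply: kJ; rewrite unfold_in /= ltnS ltnW.
by move=> i _ ii; apply: xi_sub; apply: kJ; rewrite unfold_in /= ltnSn ii.
Qed.

Let J : {pred nat * nat} := [pred q | idx q.2].
Let pastJ k : {subset past k <= J}. Proof. by move=> q /andP[]. Qed.
Let blockJ k N : {subset block idx k N <= J}. Proof. by move=> q /and3P[]. Qed.
Let past_block k N q : q \in past k -> q \notin block idx k N.
Proof.
move=> /andP[qk _]; apply/negP => /and3P[/eqP qE _ _]; by rewrite qE ltnn in qk.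
Qed.
Let xi_indep : mutually_independent J (fun q : nat * nat => xi q.1 q.2).
Proof. by have [] := xi_iid. Qed.

Lemma tchain_mfH N k : mfH (tchain N k).
Proof. exact: (block_measurable1 (tchain_sub N (fun _ => id))). Qed.

Local Notation T1 k := (sub (past k)).
Local Notation T2 k N := (sub (block idx k N)).

Lemma joint_step_mfH N k M : mfH (fun p : T1 k * T2 k N => step k N (tchain M k p.1) p.2).
Proof.
apply: (tstep_measurable (X := fun p : T1 k * T2 k N => tchain M k p.1) (z := fun i p => xi k i p.2)).
  exact: (measurableT_comp (tchain_sub M (fun _ => id)) measurable_fst).
move=> i iN ii; apply: measurableT_comp; last exact: measurable_snd.
by apply: xi_sub; rewrite unfold_in /= eqxx iN ii.
Qed.

Lemma tstep_law k N x (u : H -> R) : continuous u ->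
  intg P (fun w => u (step 0 N x w)) ->
  intg P (fun w => u (step k N x w)) /\
  Ex P (fun w => u (step k N x w)) = Ex P (fun w => u (step 0 N x w)).
Proof.
move=> uc iu.
pose F (z : nat -> R) := u (x + eta *: b x + eta *: (\sum_(i < N | idx i) z i *: sigma x (l2vec e i))).
have mF : measurable_fun setT (F : g_sigma_algebraType (cyl (fun i (z : nat -> R) => z i) idx) -> R).
  apply: (mfH_continuous _ uc).
  apply: (tstep_measurable (X := fun _ : g_sigma_algebraType (cyl (fun i (z : nat -> R) => z i) idx) => x) (z := fun i z => z i)).
    exact: mfH_cst.
  by move=> i _ ii; exact: (measurable_cyl_coord (X := fun i (z : nat -> R) => z i) ii).
exact: (noise_law xi_iid k mF iu).
Qed.

Lemma tstep_sqr k N x : intg P (fun w => `|step k N x w| ^+ 2) /\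
  Ex P (fun w => `|step k N x w| ^+ 2) =
  `|x + eta *: b x| ^+ 2 + eta ^+ 2 * \sum_(i < N | idx i) `|sigma x (l2vec e i)| ^+ 2.
Proof.
have [i4 E2 _] := gsum_moments H_sep xi_iid k (x + eta *: b x)
  (fun i => eta *: sigma x (l2vec e i)) N.
have E w : `|step k N x w| ^+ 2 =
   `|x + eta *: b x + gsum idx xi k (fun i => eta *: sigma x (l2vec e i)) N w| ^+ 2.
  by rewrite /tstep hsnoise_scale.
split.
  apply: (eq_intg E); apply: (intg_pow_le (isT : (2 <= 4)%N) _ i4).
  apply: mfH_norm0; apply: (mfHD H_sep); [exact: mfH_cst|exact: gsum_mfH].
rewrite (eq_Ex P E) E2 mulr_sumr; congr (_ + _); apply: eq_bigr => i _.
by rewrite normrZ exprMn real_normK ?num_real.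
Qed.

Lemma affine_growth (V W : normedModType R) (f : V -> W) x : bounded_derivatives3 f ->
  `|f x| <= `|f 0| + fine (supD1 f) * `|x|.
Proof.
move=> fb; rewrite -[X in `|X|](subrK (f 0)) addrC (le_trans (ler_normD _ _))// lerD2l.
by have := bounded_derivatives_dist fb x 0; rewrite subr0.
Qed.

(** Given the past, the second moment of a step is explicit and grows at most quadratically in the
    current point. *)
Lemma tchain_sqr N k : intg P (fun w => `|tchain N k w| ^+ 2).
Proof.
elim: k => [|k ih]; first exact: (intg_cst P (`|phi0| ^+ 2)).
have [B0 _ _] := supD_ge0 b_bd; have [S0 _ _] := supD_ge0 sigma_bd.
pose f w1 w2 := `|step k N (tchain N k w1) w2| ^+ 2.
have mf : measurable_fun setT (fun p : T1 k * T2 k N => f p.1 p.2).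
  by apply: measurable_funX; apply: mfH_norm0; exact: joint_step_mfH.
apply: (block_intg xi_indep (@pastJ k) (@blockJ k N) (@past_block k N) mf) => [w1 w2|w1|].
- exact: sqr_ge0.
- by have [] := tstep_sqr k N (tchain N k w1).
pose G x := `|x + eta *: b x| ^+ 2 + eta ^+ 2 * \sum_(i < N | idx i) `|sigma x (l2vec e i)| ^+ 2.
apply: (eq_intg (g := fun w => G (tchain N k w))); first by move=> w; rewrite (tstep_sqr k N _).2.
have mX := tchain_mfH N k.
have mG : measurable_fun setT (fun w => G (tchain N k w)).
  apply: measurable_funD.
    apply: measurable_funX; apply: mfH_norm0; apply: (mfHD H_sep) => //.
    by apply: (mfHZ H_sep) => //; apply: (mfH_comp H_sep mX); exact: bounded_derivatives_continuous.
  apply: measurable_funM => //; under eq_fun do rewrite big_mkcond/=.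
  apply: measurable_sum => i; case: (boolP (idx i)) => // ii.
  apply: measurable_funX; apply: mfH_norm0.
  by apply: (mfH_comp H_sep mX (h := fun x => sigma x (l2vec e i))); exact: hs_coord_continuous.
pose K0 := 2 * (eta * `|b 0|) ^+ 2 + 2 * (eta * `|sigma 0|) ^+ 2.
pose K1 := 2 * (1 + eta * B) ^+ 2 + 2 * (eta * S) ^+ 2.
apply: (intg_dom mG (intgD (intg_cst P K0) (intgZ K1 ih))) => w.
set x := tchain N k w; have ee := ltW eta0; have xx := normr_ge0 x.
have s0 : 0 <= \sum_(i < N | idx i) `|sigma x (l2vec e i)| ^+ 2.
  by apply: sumr_ge0 => i _; exact: sqr_ge0.
rewrite ger0_norm; last by rewrite /G; nonneg.
have sq2 (p q : R) : (p + q) ^+ 2 <= 2 * p ^+ 2 + 2 * q ^+ 2.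
  by have := sqr_ge0 (p - q); lra.
have h1 : `|x + eta *: b x| ^+ 2 <= 2 * (eta * `|b 0|) ^+ 2 + 2 * (1 + eta * B) ^+ 2 * `|x| ^+ 2.
  apply: (@le_trans _ _ ((eta * `|b 0| + (1 + eta * B) * `|x|) ^+ 2)).
    apply: lerXn2r; rewrite ?nnegrE; [by nonneg|by nonneg|].
    rewrite (le_trans (ler_normD _ _))// normrZ gtr0_norm//.
    have := ler_wpM2l ee (affine_growth x b_bd); rewrite -/B; lra.
  by apply: (le_trans (sq2 _ _)); rewrite lerD2l (exprMn 2 (1 + eta * B)) mulrA.
have h2 : eta ^+ 2 * \sum_(i < N | idx i) `|sigma x (l2vec e i)| ^+ 2 <=
    2 * (eta * `|sigma 0|) ^+ 2 + 2 * (eta * S) ^+ 2 * `|x| ^+ 2.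
  apply: (@le_trans _ _ ((eta * `|sigma x|) ^+ 2)).
    by rewrite exprMn ler_wpM2l ?sqr_ge0// hs_partial_sum.
  apply: (@le_trans _ _ ((eta * `|sigma 0| + (eta * S) * `|x|) ^+ 2)).
    apply: lerXn2r; rewrite ?nnegrE; [by nonneg|by nonneg|].
    by have := ler_wpM2l ee (affine_growth x sigma_bd); rewrite -/S; lra.
  by apply: (le_trans (sq2 _ _)); rewrite lerD2l (exprMn 2 (eta * S)) mulrA.
rewrite /G /K0 /K1 mulrDl; lra.
Qed.

Lemma lipschitz_intg (f : Omega -> H) (u : H -> R) (C : R) : mfH f ->
  (forall x y, `|u x - u y| <= C * `|x - y|) -> intg P (fun w => `|f w|) ->
  intg P (fun w => u (f w)).
Proof.
move=> mf uC fi; have uc : continuous u by exact: lipschitz_cvg uC.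
apply: (intg_dom (mfH_continuous mf uc) (intgD (intg_cst P `|u 0|) (intgZ C fi))) => w.
rewrite -[X in `|X|](subrK (u 0)) addrC (le_trans (ler_normD _ _))// lerD2l.
by have := uC (f w) 0; rewrite subr0.
Qed.

(** Markov property: the noise of step k is independent of the past and is then replaced by that of
    step 0. *)
Lemma tchain_step (u : H -> R) (C : R) N k : (forall x y, `|u x - u y| <= C * `|x - y|) ->
  Ex P (fun w => u (tchain N k.+1 w)) =
  Ex P (fun w => Ex P (fun w2 => u (step 0 N (tchain N k w) w2))).
Proof.
move=> uC; have uc : continuous u by exact: lipschitz_cvg uC.
have mf : measurable_fun setT (fun p : T1 k * T2 k N => u (step k N (tchain N k p.1) p.2)).
  apply: (mfH_continuous (X := fun p : T1 k * T2 k N => step k N (tchain N k p.1) p.2) _ uc).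
  exact: joint_step_mfH.
have i1 l x : intg P (fun w => u (step l N x w)).
  apply: (lipschitz_intg _ uC); first exact: tstep_mfH.
  exact: tstep_intg.
have i2 : intg P (fun w => u (step k N (tchain N k w) w)).
  apply: (lipschitz_intg (f := tchain N k.+1) _ uC); first exact: tchain_mfH.
  apply: (intg_sqr (mfH_norm0 (tchain_mfH N k.+1))); exact: tchain_sqr.
have [_ E] := block_fubini xi_indep (@pastJ k) (@blockJ k N) (@past_block k N)
  (f := fun w1 w2 => u (step k N (tchain N k w1) w2)) mf (fun w => i1 k _) i2.
rewrite [LHS]E; apply: eq_Ex => w.
by have [] := tstep_law k uc (i1 0%N (tchain N k w)).
Qed.

End TruncatedChain.

(** * Removal of the truncation *)

Section Truncation.
Context d (T : measurableType d) (R : realType) (P : probability T R).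

Lemma intg_min (h : T -> R) (r : R) : measurable_fun setT h -> (forall w, 0 <= h w) -> 0 <= r ->
  intg P (fun w => Num.min (h w) r).
Proof.
move=> mh h0 r0; apply: (intg_dom _ (intg_cst P r)) => [|w].
  exact: measurable_minr.
by rewrite ger0_norm ?le_min ?h0// ge_min lexx orbT.
Qed.

(** Integrability is a conclusion: uniform bounds on the truncations give it by monotone
    convergence. *)
Lemma intg_truncated (h : T -> R) (K : R) : measurable_fun setT h -> (forall w, 0 <= h w) ->
  (forall n : nat, Ex P (fun w => Num.min (h w) n%:R) <= K) -> intg P h /\ Ex P h <= K.
Proof.
move=> mh h0 hK.
have im n : intg P (fun w => Num.min (h w) n%:R) by exact: intg_min.
have le_int : (\int[P]_w (h w)%:E <= K%:E)%E.
  have mono : forall x : T, setT x ->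
      {homo (fun n => (Num.min (h x) n%:R)%:E) : n m / (n <= m)%N >-> (n <= m)%E}.
    by move=> x _ n m nm; rewrite lee_fin le_min !ge_min lexx/= ler_nat nm orbT.
  have := @cvg_monotone_convergence _ _ R P setT measurableT
    (fun n w => (Num.min (h w) n%:R)%:E).
  move=> /(_ _ _ mono) c.
  have {}c := c (fun n => iffRL (measurable_EFinP _ _) (intg_meas (im n)))
    (fun n x _ => _).
  have {c} c : (\int[P]_w (Num.min (h w) n%:R)%:E)%E @[n --> \oo] -->
      (\int[P]_w limn (fun n => (Num.min (h w) n%:R)%:E))%E.
    by apply: c => n x; rewrite lee_fin le_min h0/=.
  have -> : (\int[P]_w (h w)%:E = \int[P]_w limn (fun n => (Num.min (h w) n%:R)%:E))%E.
    apply: eq_integral => w _; apply/esym/cvg_lim => //.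
    apply: cvg_near_cst; near=> n; congr EFin; apply/min_idPl.
    near: n; exact: nbhs_infty_ger.
  rewrite -(cvg_lim _ c)//; apply: lime_le; first by apply/cvg_ex; eexists; exact: c.
  by apply: nearW => n; rewrite (integralE_Ex (im n)) lee_fin.
have ih : intg P h by apply: intg_lty => //; exact: le_lt_trans le_int (ltry _).
by split=> //; rewrite -lee_fin -integralE_Ex.
Unshelve. all: by end_near. Qed.

(** Fatou's lemma along L^1 convergence: a bound on second moments passes to the limit without
    extracting an almost surely convergent subsequence. *)
Lemma L1_fatou (f : nat -> T -> R) (h : T -> R) (K : R) :
  (forall M, measurable_fun setT (f M)) -> measurable_fun setT h ->
  (forall M w, 0 <= f M w) -> (forall w, 0 <= h w) ->
  (forall M, intg P (fun w => `|f M w - h w|)) ->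
  Ex P (fun w => `|f M w - h w|) @[M --> \oo] --> (0 : R) ->
  (\forall M \near \oo, intg P (fun w => f M w ^+ 2) /\ Ex P (fun w => f M w ^+ 2) <= K) ->
  intg P (fun w => h w ^+ 2) /\ Ex P (fun w => h w ^+ 2) <= K.
Proof.
move=> mf mh f0 h0 ifh lim near_K.
have m2 : measurable_fun setT (fun w => h w ^+ 2) by exact: measurable_funX.
apply: (intg_truncated m2) => [w|n]; first exact: sqr_ge0.
apply/ler_addgt0Pr => ep ep0.
have n0 : 0 < 2 * (n%:R : R) + 1 by rewrite ltr_wpDl.
near \oo => M.
have [iM KM] : intg P (fun w => f M w ^+ 2) /\ Ex P (fun w => f M w ^+ 2) <= K by near: M.
have small : Ex P (fun w => `|f M w - h w|) <= ep / (2 * n%:R + 1).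
  apply: (le_trans (ler_norm _)); near: M.
  by move/cvgr0Pnorm_le : lim; apply; rewrite divr_gt0.
(* min(y^2, n) exceeds x^2 by at most (2 n + 1) |x - y|, since only values up to n matter. *)
apply: (@le_trans _ _ (Ex P (fun w => f M w ^+ 2 + (2 * n%:R + 1) * `|f M w - h w|))).
  apply: Ex_le => [||w].
  - by apply: intg_min => // w; exact: sqr_ge0.
  - by apply: intgD => //; exact: intgZ.
  have := f0 M w; have := h0 w; move: (f M w) (h w) => x y y0 x0.
  have n2 : (n%:R : R) <= n%:R ^+ 2 by rewrite -natrX ler_nat; case: (n) => // k; rewrite leq_pmulr.
  have nn : 0 <= (n%:R : R) by [].
  rewrite ge_min.
  have [yx|xy] := leP y x.
    apply/orP; left; have : y ^+ 2 <= x ^+ 2 by rewrite lerXn2r ?nnegrE.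
    have : 0 <= (2 * n%:R + 1) * `|x - y| by rewrite mulr_ge0// ltW.
    lra.
  rewrite ltr0_norm ?subr_lt0// opprB.
  have [xn|nx] := leP n%:R x.
    apply/orP; right; have : n%:R ^+ 2 <= x ^+ 2 by rewrite lerXn2r ?nnegrE.
    have : 0 <= (2 * n%:R + 1) * (y - x) by rewrite mulr_ge0 ?subr_ge0// ltW.
    lra.
  have [yn|ny] := leP y n%:R.
    by apply/orP; left; nra.
  by apply/orP; right; nra.
rewrite ExD//; last exact: intgZ.
rewrite ExZ// lerD// mulrC -ler_pdivlMr//.
Unshelve. all: by end_near. Qed.

End Truncation.

Section BoundedBlocks.
Context (I : eqType) d' (S : measurableType d') d (T : measurableType d)
  (R : realType) (P : probability T R) (X : I -> {RV P >-> S}).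
Variables (J J1 J2 : {pred I}).
Hypotheses (X_indep : mutually_independent J X) (J1J : {subset J1 <= J})
  (J2J : {subset J2 <= J}) (J12 : forall i, i \in J1 -> i \notin J2).
Local Notation sub J := (g_sigma_algebraType (cyl (fun i => X i : T -> S) J)).

(** The diagonal is truncated at n, where [block_fubini] applies at once; the resulting bound does
    not depend on n. *)
Lemma block_intg_bounded (f : T -> T -> R) (M : R) :
  measurable_fun setT (fun p : sub J1 * sub J2 => f p.1 p.2) ->
  measurable_fun setT (fun w => f w w) -> (forall w1 w2, 0 <= f w1 w2) ->
  (forall w1, intg P (f w1)) -> (forall w1, Ex P (f w1) <= M) ->
  intg P (fun w => f w w) /\ Ex P (fun w => f w w) <= M.
Proof.
move=> mf md f0 if1 fM; apply: (intg_truncated md) => // n.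
have mn : measurable_fun setT (fun p : sub J1 * sub J2 => Num.min (f p.1 p.2) n%:R).
  exact: measurable_minr.
have i1 w1 : intg P (fun w2 => Num.min (f w1 w2) n%:R).
  by apply: intg_min => //; exact: intg_meas.
have i2 : intg P (fun w => Num.min (f w w) n%:R) by exact: intg_min.
have [i3 ->] := block_fubini X_indep J1J J2J J12 (f := fun w1 w2 => Num.min (f w1 w2) n%:R) mn i1 i2.
rewrite -[leRHS](Ex_cst P); apply: Ex_le => // [|w1]; first exact: intg_cst.
by apply: le_trans (fM w1); apply: Ex_le => // w2; rewrite ge_min lexx.
Qed.

End BoundedBlocks.

Section TruncationLimit.
Context (R : realType) (H : hilbertType R) (H_sep : separable_space H)
  d (T : measurableType d) (mu : probability T R) (e : l2basis mu)
  dO (Omega : measurableType dO) (P : probability Omega R)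
  (xi : nat -> nat -> {RV P >-> R}).
Hypothesis xi_iid : iid (I := (nat * nat)%type) [pred q | l2idx e q.2]
     (fun q => xi q.1 q.2) (normal_prob 0 1).
Variables (b : H -> H) (sigma : H -> {hs e -> H}) (eta : R).
Hypotheses (b_bd : bounded_derivatives3 b) (sigma_bd : bounded_derivatives3 sigma)
  (eta0 : 0 < eta).
Variable phi0 : H.

Let idx := l2idx e.
Let B := fine (supD1 b).
Let S := fine (supD1 sigma).
Let S0 : 0 <= S. Proof. by have [] := supD_ge0 sigma_bd. Qed.
Let B0 : 0 <= B. Proof. by have [] := supD_ge0 b_bd. Qed.

Local Notation sub J := (g_sigma_algebraType (cyl (fun q : nat * nat => xi q.1 q.2 : Omega -> R) J)).
Local Notation chain := (tchain xi b sigma eta phi0).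
Local Notation noise := (hsnoise xi).

Let mchain N k : mfH (chain N k) := tchain_mfH H_sep xi eta b_bd sigma_bd phi0 N k.
Let chain2 N k : intg P (fun w => `|chain N k w| ^+ 2) :=
  tchain_sqr H_sep xi_iid b_bd sigma_bd eta0 phi0 N k.

Lemma hsnoiseB k (A A' : {hs e -> H}) N w : noise k A N w - noise k A' N w = noise k (A - A') N w.
Proof. by rewrite /hsnoise /gsum -sumrB; apply: eq_bigr => i _; rewrite -scalerBr. Qed.

Lemma hsnoise_sqr k (A : {hs e -> H}) N : intg P (fun w => `|noise k A N w| ^+ 2) /\
  Ex P (fun w => `|noise k A N w| ^+ 2) = \sum_(i < N | idx i) `|A (l2vec e i)| ^+ 2.
Proof.
have [i4 E2 _] := gsum_moments H_sep xi_iid k 0 (fun i => A (l2vec e i)) N.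
have E w : `|noise k A N w| ^+ 2 = `|0 + gsum idx xi k (fun i => A (l2vec e i)) N w| ^+ 2.
  by rewrite add0r.
split; last by rewrite (eq_Ex P E) E2 normr0 expr0n add0r.
apply: (eq_intg E); apply: (intg_pow_le (isT : (2 <= 4)%N) _ i4).
by apply: mfH_norm0; apply: (mfHD H_sep); [exact: mfH_cst|exact: gsum_mfH].
Qed.

Lemma noise_measurable d1 (U : measurableType d1) (X : U -> H) (z : nat -> U -> R) N :
  mfH X -> (forall i, (i < N)%N -> idx i -> measurable_fun setT (z i)) ->
  mfH (fun t => \sum_(i < N | idx i) z i t *: sigma (X t) (l2vec e i)).
Proof.
move=> mX mz; apply: (mfH_sum H_sep) => i ii; apply: (mfHZ H_sep); first exact: mz.
apply: (mfH_comp H_sep mX (h := fun x => sigma x (l2vec e i))).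
exact: (hs_coord_continuous sigma_bd ii).
Qed.

Lemma noise_mfH (X : Omega -> H) k N : mfH X -> mfH (fun w => noise k (sigma (X w)) N w).
Proof. by move=> mX; apply: (noise_measurable (z := fun i => xi k i)). Qed.

(** An isometry for noise independent of the operator: given the past, its mean square is a partial
    Hilbert-Schmidt sum, at most S^2 times the squared distance of the two points. *)
Lemma chain_noise_dist k M M' N :
  intg P (fun w => `|noise k (sigma (chain M k w)) N w - noise k (sigma (chain M' k w)) N w| ^+ 2) /\
  Ex P (fun w => `|noise k (sigma (chain M k w)) N w - noise k (sigma (chain M' k w)) N w| ^+ 2)
  <= S ^+ 2 * Ex P (fun w => `|chain M k w - chain M' k w| ^+ 2).
Proof.
pose J1 := past e k; pose J2 := block idx k N.
pose D w := sigma (chain M k w) - sigma (chain M' k w).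
pose f w1 w2 := `|noise k (D w1) N w2| ^+ 2.
have J1J : {subset J1 <= [pred q : nat * nat | idx q.2]} by move=> q /andP[].
have J2J : {subset J2 <= [pred q : nat * nat | idx q.2]} by move=> q /and3P[].
have J12 q : q \in J1 -> q \notin J2.
  by move=> /andP[qk _]; apply/negP => /and3P[/eqP qE _ _]; rewrite qE ltnn in qk.
have mN M0 : mfH (fun p : sub J1 * sub J2 => noise k (sigma (chain M0 k p.1)) N p.2).
  apply: (noise_measurable (X := fun p : sub J1 * sub J2 => chain M0 k p.1) (z := fun i p => xi k i p.2)).
    have h : mfH (chain M0 k : sub J1 -> H) by exact: (tchain_sub H_sep eta b_bd sigma_bd).
    exact: (measurableT_comp h measurable_fst).
  move=> i iN ii; apply: measurableT_comp; last exact: measurable_snd.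
  by apply: xi_sub; rewrite unfold_in /= eqxx iN ii.
have mf : measurable_fun setT (fun p : sub J1 * sub J2 => f p.1 p.2).
  apply: measurable_funX; apply: mfH_norm0.
  have := mfHB H_sep (mN M) (mN M'); congr mfH; apply/funext => p; exact: hsnoiseB.
have f0 w1 w2 : 0 <= f w1 w2 by exact: sqr_ge0.
have if1 w1 : intg P (f w1) by have [] := hsnoise_sqr k (D w1) N.
have [i2 _] := intg_sqrB H_sep (mchain M k) (mchain M' k) (chain2 M k) (chain2 M' k).
have Ebd w1 : Ex P (f w1) <= S ^+ 2 * `|chain M k w1 - chain M' k w1| ^+ 2.
  have [_ ->] := hsnoise_sqr k (D w1) N.
  apply: le_trans (hs_partial_sum (D w1) N) _; rewrite -exprMn lerXn2r ?nnegrE ?mulr_ge0//.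
  exact: bounded_derivatives_dist.
have [indep _] := xi_iid.
have iE : intg P (fun w1 => Ex P (f w1)).
  apply: (intg_dom _ (intgZ (S ^+ 2) i2)) => [|w1]; last by rewrite ger0_norm ?Ebd// Ex_ge0.
  rewrite (_ : (fun _ => _) = (fun w1 => \sum_(i < N | idx i) `|D w1 (l2vec e i)| ^+ 2)); last first.
    by apply/funext => w1; have [_ ->] := hsnoise_sqr k (D w1) N.
  under eq_fun do rewrite big_mkcond/=.
  apply: measurable_sum => i; case: (boolP (idx i)) => // ii.
  apply: measurable_funX; apply: mfH_norm0.
  have mc M0 : mfH (fun w => sigma (chain M0 k w) (l2vec e i)).
    by apply: (mfH_comp H_sep (mchain M0 k) (h := fun x => sigma x (l2vec e i))); exact: hs_coord_continuous.
  exact: (mfHB H_sep (mc M) (mc M')).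
have idg := block_intg indep J1J J2J J12 mf f0 if1 iE.
have [_ E] := block_fubini indep J1J J2J J12 mf if1 idg.
have E1 w : `|noise k (sigma (chain M k w)) N w - noise k (sigma (chain M' k w)) N w| ^+ 2 = f w w.
  by rewrite hsnoiseB.
split; first exact: (eq_intg E1).
by rewrite (eq_Ex P E1) E -ExZ//; apply: Ex_le => //; exact: intgZ.
Qed.

Section Step.
Variables (k : nat) (Y : Omega -> H).
Hypotheses (mY : mfH Y) (Y2 : intg P (fun w => `|Y w| ^+ 2)).
Let r N := Ex P (fun w => `|Y w - chain N k w| ^+ 2).
Hypothesis r0 : r N @[N --> \oo] --> (0 : R).

Let i2 N : intg P (fun w => `|Y w - chain N k w| ^+ 2).
Proof. by have [] := intg_sqrB H_sep mY (mchain N k) Y2 (chain2 N k). Qed.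

Let xi2 i : idx i -> intg P (fun w => xi k i w ^+ 2).
Proof. by move=> ii; exact: (xi_intg xi_iid k ii). Qed.

(* The truncated noise is compared through the adapted chains [chain M], as [Y] itself is
   only almost surely a function of the past. *)
Lemma limit_noise_dist N :
  intg P (fun w => `|noise k (sigma (Y w)) N w - noise k (sigma (chain N k w)) N w| ^+ 2) /\
  Ex P (fun w => `|noise k (sigma (Y w)) N w - noise k (sigma (chain N k w)) N w| ^+ 2)
  <= S ^+ 2 * (2 * (N.+1%:R)^-1 + 2 * r N).
Proof.
pose G (X : Omega -> H) w := noise k (sigma (X w)) N w.
have mG (X : Omega -> H) : mfH X -> mfH (G X) by exact: noise_mfH.
have m1 M : measurable_fun setT (fun w => `|G (chain M k) w - G (chain N k) w|).
  by apply: mfH_norm0; apply: (mfHB H_sep); exact: mG.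
have mh : measurable_fun setT (fun w => `|G Y w - G (chain N k) w|).
  by apply: mfH_norm0; apply: (mfHB H_sep); exact: mG.
(* A pathwise bound by a finite sum over i < N: crude, but its mean tends to 0 as M grows with N
   fixed. *)
pose q M w := \sum_(i < N | idx i) S * (`|xi k i w| * `|Y w - chain M k w|).
have mYc M : measurable_fun setT (fun w => `|Y w - chain M k w|).
  by apply: mfH_norm0; apply: (mfHB H_sep).
have mxi i : measurable_fun setT (fun w => `|xi k i w|) by exact: measurableT_comp.
have nxi2 i : idx i -> intg P (fun w => `|xi k i w| ^+ 2).
  by move=> ii; apply: eq_intg (xi2 ii) => w; rewrite real_normK ?num_real.
have iq0 M i : idx i -> intg P (fun w => `|xi k i w| * `|Y w - chain M k w|).
  by move=> ii; apply: intg_mul => //; exact: nxi2.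
have iq M : intg P (q M) by apply: intg_sum => i ii; apply: intgZ; exact: iq0.
have Eq M : Ex P (q M) <= \sum_(i < N | idx i) S * Num.sqrt (r M).
  rewrite Ex_sum; last by move=> i ii; apply: intgZ; exact: iq0.
  apply: ler_sum => i ii; rewrite ExZ; last exact: iq0.
  rewrite ler_wpM2l// (le_trans (ler_norm _))//.
  rewrite (le_trans (Ex_sqr_mul (mxi i) (mYc M) (nxi2 i ii) (i2 M)))//.
  rewrite (eq_Ex P (g := fun w => xi k i w ^+ 2)); last by move=> w; rewrite real_normK ?num_real.
  by rewrite (xi_moment2 xi_iid k ii) sqrtr1 mul1r.
have pw M w : `| `|G (chain M k) w - G (chain N k) w| - `|G Y w - G (chain N k) w| | <= q M w.
  apply: (@le_trans _ _ `|G (chain M k) w - G Y w|).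
    by rewrite (le_trans (ler_dist_dist _ _))// opprB addrA subrK.
  rewrite distrC /G hsnoiseB /hsnoise /gsum (le_trans (ler_norm_sum _ _ _))//.
  apply: ler_sum => i ii; rewrite normrZ mulrCA ler_wpM2l//.
  apply: (le_trans (hs_coord_le (sigma (Y w) - sigma (chain M k w)) ii)).
  exact: bounded_derivatives_dist.
have ip M : intg P (fun w => `| `|G (chain M k) w - G (chain N k) w| - `|G Y w - G (chain N k) w| |).
  apply: (intg_dom _ (iq M)) => [|w]; last by rewrite normr_id pw.
  by apply: measurableT_comp => //; exact: measurable_funB.
apply: (L1_fatou m1 mh (fun _ _ => normr_ge0 _) (fun _ => normr_ge0 _) ip).
  apply: (@squeeze_cvgr _ _ _ _ (fun=> 0) (fun M => \sum_(i < N | idx i) S * Num.sqrt (r M))).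
  - apply: nearW => M; rewrite Ex_ge0//=; apply: le_trans (Eq M).
    by apply: Ex_le => // w; exact: pw.
  - exact: cvg_cst.
  have s0 : S * Num.sqrt (r M) @[M --> \oo] --> (0 : R).
    rewrite -(mulr0 S) -(sqrtr0 R); apply: cvgMr.
    by apply: continuous_cvg => //; exact: sqrt_continuous.
  under eq_fun do rewrite sumr_const -mulr_natl.
  by rewrite -(mulr0 (#|[pred i : 'I_N | idx i]|%:R : R)); apply: cvgMr.
(* The slack 1 / (N + 1) pays for replacing [Y] by an adapted chain: it is positive, so all large M
   meet it, and it vanishes as N grows. *)
have N0 : 0 < (N.+1%:R : R)^-1 by rewrite invr_gt0.
move/cvgr0Pnorm_le : r0 => /(_ _ N0); apply: filterS => M rM.
have [iM EM] := chain_noise_dist k M N N; split=> //.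
rewrite (le_trans EM)// ler_wpM2l ?sqr_ge0//.
have j0 M0 : intg P (fun w => `|chain M0 k w - Y w| ^+ 2).
  by apply: eq_intg (i2 M0) => w; rewrite distrC.
have [_ E2] := intg_sqrD H_sep (mfHB H_sep (mchain M k) mY) (mfHB H_sep mY (mchain N k)) (j0 M) (i2 N).
rewrite (eq_Ex P (g := fun w => `|(chain M k w - Y w) + (Y w - chain N k w)| ^+ 2)); last first.
  by move=> w; rewrite addrA subrK.
apply: (le_trans E2); rewrite lerD2r ler_wpM2l//.
rewrite (eq_Ex P (g := fun w => `|Y w - chain M k w| ^+ 2)); last by move=> w; rewrite distrC.
exact: le_trans (ler_norm _) rM.
Qed.

Variable W : Omega -> H.
Hypothesis W_noise : is_noise P (xi k) (fun w => sigma (Y w)) W.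
Let Y' w := Y w + eta *: b (Y w) + eta *: W w.

(** The new error is [p], the old error propagated by the drift, plus [s], which collects the
    discarded coordinates of the noise at [Y] and the change of the truncated noise from [Y] to the
    chain. *)
Lemma limit_step : [/\ mfH Y', intg P (fun w => `|Y' w| ^+ 2) &
  Ex P (fun w => `|Y' w - chain N k.+1 w| ^+ 2) @[N --> \oo] --> (0 : R)].
Proof.
have [mW W0] := W_noise.
pose G (X : Omega -> H) N w := noise k (sigma (X w)) N w.
have mG (X : Omega -> H) N : mfH X -> mfH (G X N) by exact: noise_mfH.
have mbc : continuous b by exact: bounded_derivatives_continuous.
have mY' : mfH Y'.
  apply: (mfHD H_sep); last by apply: (mfHZ H_sep).
  by apply: (mfHD H_sep) => //; apply: (mfHZ H_sep) => //; exact: (mfH_comp H_sep mY).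
have [|N w|nearW2 limW] := @cvge0_Ex _ _ R P (fun N w => `|W w - G Y N w| ^+ 2) _ _ W0.
- by move=> N; apply: measurable_funX; apply: mfH_norm0; apply: (mfHB H_sep) => //; exact: mG.
- exact: sqr_ge0.
pose tot N := 2 * ((1 + eta * B) ^+ 2 * r N) + 2 * (eta ^+ 2 * (2 * Ex P (fun w => `|W w - G Y N w| ^+ 2)
   + 2 * (S ^+ 2 * (2 * (N.+1%:R)^-1 + 2 * r N)))).
have bound : \forall N \near \oo, intg P (fun w => `|Y' w - chain N k.+1 w| ^+ 2) /\
    Ex P (fun w => `|Y' w - chain N k.+1 w| ^+ 2) <= tot N.
  apply: filterS nearW2 => N iW.
  have [iG EG] := limit_noise_dist N.
  have mWG : mfH (fun w => W w - G Y N w) by apply: (mfHB H_sep) => //; exact: mG.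
  have mGG : mfH (fun w => G Y N w - G (chain N k) N w) by apply: (mfHB H_sep); exact: mG.
  have [iN EN] := intg_sqrD H_sep mWG mGG iW iG.
  pose p w := Y w - chain N k w + eta *: (b (Y w) - b (chain N k w)).
  pose s w := eta *: (W w - G Y N w + (G Y N w - G (chain N k) N w)).
  have Yd w : Y' w - chain N k.+1 w = p w + s w.
    rewrite /s addrA subrK scalerBr /p scalerBr /Y' /= /tstep.
    by rewrite opprD addrACA; congr (_ + _); rewrite opprD addrACA.
  have mp : mfH p.
    apply: (mfHD H_sep); first exact: (mfHB H_sep).
    by apply: (mfHZ H_sep) => //; apply: (mfHB H_sep); exact: (mfH_comp H_sep).
  have ms : mfH s by apply: (mfHZ H_sep) => //; exact: (mfHD H_sep).
  have pp w : `|p w| ^+ 2 <= (1 + eta * B) ^+ 2 * `|Y w - chain N k w| ^+ 2.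
    rewrite -exprMn; apply: lerXn2r; rewrite ?nnegrE ?mulr_ge0 ?addr_ge0 ?mulr_ge0 ?(ltW eta0)//.
    rewrite (le_trans (ler_normD _ _))// mulrDl mul1r lerD2l normrZ gtr0_norm// -(mulrA eta).
    by rewrite ler_wpM2l ?(ltW eta0)//; exact: bounded_derivatives_dist.
  have ip : intg P (fun w => `|p w| ^+ 2).
    apply: (intg_dom _ (intgZ ((1 + eta * B) ^+ 2) (i2 N))) => [|w].
      by apply: measurable_funX; exact: mfH_norm0.
    by rewrite ger0_norm ?sqr_ge0.
  have Es w : `|s w| ^+ 2 = eta ^+ 2 * `|W w - G Y N w + (G Y N w - G (chain N k) N w)| ^+ 2.
    by rewrite normrZ exprMn gtr0_norm.
  have iS : intg P (fun w => `|s w| ^+ 2) by apply: (eq_intg Es); exact: intgZ.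
  have [ips Eps] := intg_sqrD H_sep mp ms ip iS.
  split; first by apply: eq_intg ips => w; rewrite Yd.
  rewrite (eq_Ex P (g := fun w => `|p w + s w| ^+ 2)); last by move=> w; rewrite Yd.
  apply: (le_trans Eps); apply: lerD; rewrite ler_wpM2l//.
    by rewrite -ExZ//; apply: Ex_le => //; exact: intgZ.
  rewrite (eq_Ex P Es) ExZ// ler_wpM2l ?sqr_ge0//; apply: (le_trans EN).
  by rewrite lerD2l ler_wpM2l.
have lim : tot N @[N --> \oo] --> (0 : R).
  have z : 0 = 2 * ((1 + eta * B) ^+ 2 * 0) + 2 * (eta ^+ 2 * (2 * 0 + 2 * (S ^+ 2 * (2 * 0 + 2 * 0)))) :> R.
    by ring.
  rewrite [X in _ --> X]z; apply: cvgD; first by do 2 apply: cvgMr.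
  do 2 apply: cvgMr; apply: cvgD; first exact: cvgMr.
  do 2 apply: cvgMr; apply: cvgD; last exact: cvgMr.
  by apply: cvgMr; exact: cvg_harmonic.
split=> //.
  have [N _ /(_ N (leqnn N))[iN _]] := bound.
  have [+ _] := intg_sqrD H_sep (mfHB H_sep mY' (mchain N k.+1)) (mchain N k.+1) iN (chain2 N k.+1).
  by apply: eq_intg => w; rewrite subrK.
apply: (@squeeze_cvgr _ _ _ _ (fun=> 0) tot) => //; last exact: cvg_cst.
by apply: filterS bound => N [_ ->]; rewrite Ex_ge0// => w; exact: sqr_ge0.
Qed.

End Step.

Lemma gaussian_limit (phit : nat -> Omega -> H) :
  gaussian_iterates P eta b sigma (fun n i => xi n i) phi0 phit ->
  forall k, [/\ mfH (phit k), intg P (fun w => `|phit k w| ^+ 2) &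
    Ex P (fun w => `|phit k w - chain N k w| ^+ 2) @[N --> \oo] --> (0 : R)].
Proof.
move=> [p0 pS]; elim=> [|k [mk ik ck]].
  have E : phit 0%N = fun=> phi0 by apply/funext.
  split; rewrite ?E; [exact: mfH_cst|exact: intg_cst|].
  rewrite (_ : (fun _ => _) = fun=> 0); first exact: cvg_cst.
  apply/funext => N; rewrite -[RHS](Ex_cst P); apply: eq_Ex => w.
  by rewrite /= subrr normr0 expr0n.
have [W W_noise pE] := pS k.
have -> : phit k.+1 = fun w => phit k w + eta *: b (phit k w) + eta *: W w by apply/funext.
exact: (limit_step mk ik ck W_noise).
Qed.

End TruncationLimit.

(** * The stochastic gradient chain and the telescoping sum *)

Lemma law_intg_ge0 d (T : measurableType d) (R : realType) (P : probability T R)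
    d' (S : measurableType d') (X : {RV P >-> S}) (mu : probability S R) (f : S -> R) :
  (forall A, measurable A -> distribution P X A = mu A) ->
  measurable_fun setT f -> (forall x, 0 <= f x) -> intg P (fun w => f (X w)) -> intg mu f.
Proof.
move=> Xmu mf f0 iX; apply: intg_lty => //.
have mEf : measurable_fun setT (EFin \o f) by exact/measurable_EFinP.
rewrite (eq_measure_integral (distribution P X)); last by move=> A mA _; exact/esym/Xmu.
rewrite (ge0_integral_distribution X mEf) => [|y]; last by rewrite lee_fin.
by rewrite [X in (X < _)%E](integralE_Ex iX) ltry.
Qed.

Section Comparison.
Context (R : realType) (H : hilbertType R) (H_sep : separable_space H)
  (dG : measure_display) (Gamma : measurableType dG) (mu : probability Gamma R)
  (Fgam : Gamma -> H -> R) (gradFgam : Gamma -> H -> H) (gradF : H -> H).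
Hypotheses (Fgam_grad : forall w phi, is_gradient (Fgam w) phi (gradFgam w phi))
  (Fgam_meas : forall phi, measurable_fun setT (Fgam ^~ phi))
  (gradF_mean : forall phi, bochner_mean mu (fun w => gradFgam w phi) (gradF phi))
  (gradF_sqr : forall phi, (\int[mu]_w (`|gradFgam w phi| ^+ 2)%:E < +oo)%E).
Context (b : H -> H) (V : H -> Gamma -> H).
Hypotheses (b_def : b = fun phi => - gradF phi)
  (V_def : V = fun phi w => gradF phi - gradFgam w phi).
Context (e : l2basis mu) (sigma : H -> {hs e -> H}).
Hypothesis sigma_def : forall phi (u : L2 mu),
  bochner_mean mu (fun w => u w *: V phi w) (sigma phi u).
Context (dO : measure_display) (Omega : measurableType dO) (P : probability Omega R)
  (gam : nat -> {RV P >-> Gamma}).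
Hypothesis gam_iid : iid predT gam mu.
Context (xi : nat -> nat -> {RV P >-> R}).
Hypothesis xi_iid : iid (I := (nat * nat)%type) [pred p | l2idx e p.2]
     (fun p => xi p.1 p.2) (normal_prob 0 1).
Context (sigmaW : H -> Omega -> H).
Hypothesis sigmaW_def : forall phi,
  is_noise P (fun i => xi 0%N i) (fun=> sigma phi) (sigmaW phi).
Hypotheses (b_bd : bounded_derivatives3 b) (sigma_bd : bounded_derivatives3 sigma)
  (D_fin : (third_moment P sigmaW V (gam 0%N) < +oo)%E).
Variables (eta : R) (eta0 : 0 < eta).

Let idx := l2idx e.
Let D := fine (third_moment P sigmaW V (gam 0%N)).
Let S := fine (supD1 sigma).
Local Notation step := (tstep xi b sigma eta).

Let gam_law j A : measurable A -> distribution P (gam j) A = mu A.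
Proof. by move=> mA; have [_ l] := gam_iid; exact: l. Qed.

Let gradF_cont : continuous gradF.
Proof.
move=> x; have bc := bounded_derivatives_continuous b_bd (x := x).
have -> : gradF = fun y => - b y by apply/funext => y; rewrite b_def opprK.
by apply: cvgN; exact: bc.
Qed.

Let mgrad x : mfH (fun t => gradFgam t x).
Proof. exact: bochner_mfH (gradF_mean x). Qed.

Let mV x : mfH (V x).
Proof. by rewrite V_def; apply: (mfHB H_sep); [exact: mfH_cst|exact: mgrad]. Qed.

Let igrad2 x : intg mu (fun t => `|gradFgam t x| ^+ 2).
Proof.
apply: intg_lty => [|t|]; [|exact: sqr_ge0|exact: gradF_sqr].
by apply: measurable_funX; exact: mfH_norm0.
Qed.

Let V2 x : intg mu (fun t => `|V x t| ^+ 2).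
Proof.
rewrite V_def.
have [] // := intg_sqrB H_sep (@mfH_cst R H _ Gamma (gradF x)) (mgrad x) (intg_cst mu (`|gradF x| ^+ 2)) (igrad2 x).
Qed.

Let V1 x : intg mu (fun t => `|V x t|).
Proof. exact: (intg_sqr (mfH_norm0 (mV x)) (V2 x)). Qed.

Let mean0 x (L : H -> R) (C : R) :
  (forall (a : R) y z, L (a *: y + z) = a * L y + L z) -> (forall y, `|L y| <= C * `|y|) ->
  Ex mu (fun t => L (V x t)) = 0.
Proof.
move=> Ll LC; have [iL EL] := bochner_mean_linear H_sep (gradF_mean x) Ll LC.
have LB y z : L (y - z) = L y - L z by rewrite addrC -scaleN1r Ll mulN1r addrC.
rewrite (eq_Ex mu (g := fun t => L (gradF x) - L (gradFgam t x))).
  by rewrite ExB ?Ex_cst ?EL ?subrr//; exact: intg_cst.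
by move=> t; rewrite V_def LB.
Qed.

Let mW x : mfH (sigmaW x). Proof. by have [] := sigmaW_def x. Qed.

Let moment3 x : [/\ intg P (fun w => `|sigmaW x w| ^+ 3), intg mu (fun t => `|V x t| ^+ 3) &
  Ex mu (fun t => `|V x t| ^+ 3) + Ex P (fun w => `|sigmaW x w| ^+ 3) <= D].
Proof.
have mVg : measurable_fun setT (fun t => `|V x t| ^+ 3) by apply: measurable_funX; exact: mfH_norm0.
have mVP : measurable_fun setT (fun w => `|V x (gam 0%N w)| ^+ 3).
  by apply: (measurableT_comp (f := fun t => `|V x t| ^+ 3) mVg).
have mWP : measurable_fun setT (fun w => `|sigmaW x w| ^+ 3).
  by apply: measurable_funX; exact: mfH_norm0.
have le_D : (\int[P]_w (`|sigmaW x w| ^+ 3 + `|V x (gam 0%N w)| ^+ 3)%:E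
    <= third_moment P sigmaW V (gam 0%N))%E.
  by apply: ereal_sup_ubound; exists x.
have pos w : 0 <= `|sigmaW x w| ^+ 3 + `|V x (gam 0%N w)| ^+ 3 by rewrite addr_ge0.
have i3 : intg P (fun w => `|sigmaW x w| ^+ 3 + `|V x (gam 0%N w)| ^+ 3).
  by apply: intg_lty => //; [exact: measurable_funD|exact: le_lt_trans le_D D_fin].
have iW : intg P (fun w => `|sigmaW x w| ^+ 3).
  by apply: (intg_dom mWP i3) => w; rewrite ger0_norm// lerDl.
have iVP : intg P (fun w => `|V x (gam 0%N w)| ^+ 3).
  by apply: (intg_dom mVP i3) => w; rewrite ger0_norm// lerDr.
have iV : intg mu (fun t => `|V x t| ^+ 3).
  by apply: (law_intg_ge0 (@gam_law 0%N) mVg) => // t; exact: exprn_ge0.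
split=> //; have [_ <-] := law_intg (@gam_law 0%N) mVg iV.
rewrite addrC -ExD// -lee_fin -(integralE_Ex i3) /D.
rewrite fineK// ge0_fin_numE// (le_trans _ le_D)//.
by apply: integral_ge0 => w _; rewrite lee_fin.
Qed.

Let D0 : 0 <= D.
Proof.
have [_ _ h] := moment3 0; apply: le_trans h.
by apply: addr_ge0; apply: Ex_ge0 => w; exact: exprn_ge0.
Qed.

(** By [noise_tail], the mean square of the noise coordinates discarded at x. *)
Definition tail N (x : H) : R := `|sigma x| ^+ 2 - \sum_(i < N | idx i) `|sigma x (l2vec e i)| ^+ 2.

Let tail_ge0 N x : 0 <= tail N x.
Proof. by rewrite subr_ge0 hs_partial_sum. Qed.

Let sqrt_tail_le N x : Num.sqrt (tail N x) <= `|sigma x|.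
Proof.
rewrite -[leRHS]ger0_norm// -sqrtr_sqr ler_wsqrtr// gerBl.
by apply: sumr_ge0 => i _; exact: sqr_ge0.
Qed.

Section OneStep.
Variables (u : H -> R) (u1 : H -> H -> R) (u2 : H -> H -> H -> R) (C K1 K3 : R).
Hypotheses (uC : C21 u u1 u2 C) (K10 : 0 <= K1) (K30 : 0 <= K3)
  (uK1 : forall x h, `|u1 x h| <= K1 * `|h|)
  (uK3 : forall x h k l, `|u2 (x + h) k l - u2 x k l| <= K3 * `|h| * `|k| * `|l|).

Definition sgd_avg x := Ex mu (fun t => u (x + eta *: b x + eta *: V x t)).

Let eta_lin (a : R) (y z : H) : eta *: (a *: y + z) = a *: (eta *: y) + eta *: z.
Proof. by rewrite scalerDr !scalerA mulrC. Qed.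
Let norm_eta (y : H) : `|eta *: y| = eta * `|y|.
Proof. by rewrite normrZ gtr0_norm. Qed.

(** Both expectations are compared with one number [m], the mean of the quadratic Taylor polynomial
    at [x + eta *: b x]. The two cubic remainders add up to a multiple of the sum of third moments
    that D bounds. *)
Lemma one_step_gaussian x :
  `|sgd_avg x - Ex P (fun w => u (x + eta *: b x + eta *: sigmaW x w))| <=
  K3 * eta ^+ 3 / 6 * D.
Proof.
have [iW3 iV3 le_D] := moment3 x; set y := x + eta *: b x.
have meV : mfH (fun t => eta *: V x t) by apply: (mfHZ H_sep).
have meW : mfH (fun w => eta *: sigmaW x w) by apply: (mfHZ H_sep).
have e3 (z : H) : `|eta *: z| ^+ 3 = eta ^+ 3 * `|z| ^+ 3 by rewrite norm_eta exprMn.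
have jV : intg mu (fun t => `|eta *: V x t| ^+ 3).
  by apply: eq_intg (intgZ (eta ^+ 3) iV3) => t; exact: e3.
have jW : intg P (fun w => `|eta *: sigmaW x w| ^+ 3).
  by apply: eq_intg (intgZ (eta ^+ 3) iW3) => w; exact: e3.
have tV := taylor_step uC K30 uK3 y meV jV.
have tW := taylor_step uC K30 uK3 y meW jW.
have Ll (a : R) p q : u1 y (eta *: (a *: p + q)) = a * u1 y (eta *: p) + u1 y (eta *: q).
  by rewrite eta_lin (C21_lin1 uC).
have LC p : `|u1 y (eta *: p)| <= C * eta * `|p|.
  by rewrite (le_trans (C21_bd1 uC _ _))// norm_eta mulrA.
have Ql (a : R) p q v : u2 y (eta *: (a *: p + q)) (eta *: v) =
    a * u2 y (eta *: p) (eta *: v) + u2 y (eta *: q) (eta *: v).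
  by rewrite eta_lin (C21_lin2l uC).
have Qr (a : R) p q v : u2 y (eta *: v) (eta *: (a *: p + q)) =
    a * u2 y (eta *: v) (eta *: p) + u2 y (eta *: v) (eta *: q).
  by rewrite eta_lin (C21_lin2r uC).
have QC p q : `|u2 y (eta *: p) (eta *: q)| <= C * eta ^+ 2 * `|p| * `|q|.
  by rewrite (le_trans (C21_bd2 uC _ _ _))// !norm_eta le_eqVlt; apply/orP; left; apply/eqP; ring.
have eQ := noise_covariance H_sep xi_iid (mV x) (V2 x) (sigma_def x) (sigmaW_def x) Ql Qr QC.
have eV := mean0 x Ll LC.
have eW := noise_linear H_sep xi_iid (sigmaW_def x) Ll LC.
rewrite /= in eQ eV eW.
move: tV tW; rewrite eV eW eQ !addr0 (eq_Ex mu (fun t => e3 (V x t))) (eq_Ex P (fun w => e3 (sigmaW x w))).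
rewrite (ExZ _ iV3) (ExZ _ iW3) => tV tW.
rewrite /sgd_avg -/y; set p := Ex mu _; set q := Ex P _; set m := u y + _ in tV tW.
have -> : p - q = (p - m) - (q - m) by ring.
apply: (le_trans (ler_normB _ _)); apply: (le_trans (lerD tV tW)).
rewrite -mulrDr -mulrDr.
have -> : K3 * eta ^+ 3 / 6 * D = K3 / 6 * (eta ^+ 3 * D) by ring.
by rewrite ler_wpM2l ?divr_ge0// ler_wpM2l// exprn_ge0// ltW.
Qed.

(** Truncation costs the Lipschitz constant of u times the L^2 size of the discarded noise. *)
Lemma one_step x N : `|sgd_avg x - Ex P (fun w => u (step 0 N x w))| <=
  K3 * eta ^+ 3 / 6 * D + K1 * eta * Num.sqrt (tail N x).
Proof.
set q := Ex P (fun w => u (x + eta *: b x + eta *: sigmaW x w)).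
have -> : sgd_avg x - Ex P (fun w => u (step 0 N x w)) =
  (sgd_avg x - q) + (q - Ex P (fun w => u (step 0 N x w))) by ring.
apply: (le_trans (ler_normD _ _)); apply: lerD; first exact: one_step_gaussian.
have [mWx W2 _] := noise_expands H_sep xi_iid (sigmaW_def x).
have meW : mfH (fun w => eta *: sigmaW x w) by apply: (mfHZ H_sep).
have W1 : intg P (fun w => `|sigmaW x w|) := intg_sqr (mfH_norm0 mWx) W2.
have eW1 : intg P (fun w => `|eta *: sigmaW x w|).
  by apply: eq_intg (intgZ eta W1) => w; exact: norm_eta.
have iu := C21_shift_intg uC (x + eta *: b x) meW eW1.
have mst := tstep_mfH H_sep xi b sigma eta 0 N x.
have iu' : intg P (fun w => u (step 0 N x w)).
  apply: (lipschitz_intg mst (C21_dist0 uC)); exact: (tstep_intg H_sep xi_iid).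
pose G w := hsnoise xi 0 (sigma x) N w.
have mG : mfH G by exact: hsnoise_mfH.
have [G2 _] := hsnoise_sqr H_sep xi_iid 0 (sigma x) N.
have mr := mfHB H_sep mWx mG.
have [r2 _] := intg_sqrB H_sep mWx mG W2 G2.
have r1 := intg_sqr (mfH_norm0 mr) r2.
rewrite /q -ExB// (le_trans (Ex_norm (intgB iu iu')))//.
apply: (@le_trans _ _ (Ex P (fun w => K1 * eta * `|sigmaW x w - G w|))).
  apply: Ex_le => [||w]; [exact: (intg_norm (intgB iu iu'))|exact: intgZ|].
  have := C21_sharp_lip0 uC uK1 (step 0 N x w) (eta *: (sigmaW x w - G w)).
  rewrite norm_eta mulrA; congr (`|u _ - _| <= _).
  by rewrite /tstep -/(G w) -(addrA (x + eta *: b x)) -scalerDr [G w + _]addrC subrK.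
rewrite ExZ// ler_wpM2l ?mulr_ge0 ?(ltW eta0)//.
apply: (Ex_le_sqrt (mfH_norm0 mr) r2); first exact: sqrtr_ge0.
by rewrite sqr_sqrtr// (noise_tail H_sep xi_iid N (sigmaW_def x)).
Qed.

End OneStep.

Section Chain.
Variables (phi0 : H) (phi : nat -> Omega -> H).
Hypothesis phi_sgd : sgd_iterates eta b V (fun n => gam n) phi0 phi.

Local Notation sub J := (g_sigma_algebraType (cyl (fun j : nat => gam j : Omega -> Gamma) J)).
Definition before k : {pred nat} := [pred j | (j < k)%N].

Let mVX d1 (U : measurableType d1) (X : U -> H) (G : U -> Gamma) :
  mfH X -> measurable_fun setT G -> mfH (fun t => V (X t) (G t)).
Proof.
move=> mX mG; rewrite V_def; apply: (mfHB H_sep); first exact: (mfH_comp H_sep mX gradF_cont).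
apply: (mfH_gradient H_sep (F := fun t => Fgam (G t)) (g := fun t x => gradFgam (G t) x) _ _ mX).
  by move=> t x; exact: Fgam_grad.
by move=> x; exact: (measurableT_comp (Fgam_meas x) mG).
Qed.

Let m_step d1 (U : measurableType d1) (X : U -> H) (G : U -> Gamma) :
  mfH X -> measurable_fun setT G -> mfH (fun t => X t + eta *: b (X t) + eta *: V (X t) (G t)).
Proof.
move=> mX mG; apply: (mfHD H_sep); last by apply: (mfHZ H_sep) => //; exact: mVX.
apply: (mfHD H_sep) => //; apply: (mfHZ H_sep) => //.
by apply: (mfH_comp H_sep mX); exact: bounded_derivatives_continuous.
Qed.

Lemma sgd_sub k (J : {pred nat}) : {subset before k <= J} -> mfH (phi k : sub J -> H).
Proof.
have [p0 pS] := phi_sgd; elim: k J => [|k ih] J kJ.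
  by rewrite (_ : phi 0%N = fun=> phi0); [exact: mfH_cst|apply/funext].
rewrite (_ : phi k.+1 = fun w => phi k w + eta *: b (phi k w) + eta *: V (phi k w) (gam k w)); last first.
  by apply/funext => w; rewrite pS.
apply: (m_step (X := phi k : sub J -> H) (G := gam k : sub J -> Gamma)).
  by apply: ih => j jk; apply: kJ; rewrite unfold_in /= ltnS ltnW.
apply: (measurable_cyl_coord (X := fun j : nat => gam j : Omega -> Gamma)).
by apply: kJ; rewrite unfold_in /= ltnSn.
Qed.

Let gam_indep : mutually_independent predT gam. Proof. by have [] := gam_iid. Qed.
Let beforeT k : {subset before k <= predT}. Proof. by []. Qed.
Let one k : {pred nat} := [pred j | j == k].
Let oneT k : {subset one k <= predT}. Proof. by []. Qed.
Let before_one k j : j \in before k -> j \notin one k.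
Proof. by move=> jk; apply/negP => /eqP jE; move: jk; rewrite jE unfold_in /= ltnn. Qed.

Lemma sgd_mfH k : mfH (phi k).
Proof. exact: (block_measurable1 (sgd_sub (fun _ => id))). Qed.

Local Notation T1 k := (sub (before k)).
Local Notation T2 k := (sub (one k)).

Let m_fst k : mfH (fun p : T1 k * T2 k => phi k p.1).
Proof. exact: (measurableT_comp (sgd_sub (fun _ => id)) measurable_fst). Qed.

Let m_snd k : measurable_fun setT (fun p : T1 k * T2 k => gam k p.2).
Proof.
apply: measurableT_comp; last exact: measurable_snd.
by apply: (measurable_cyl_coord (X := fun j : nat => gam j : Omega -> Gamma)); rewrite inE.
Qed.

(** The bound is uniform in x because D is a supremum; [block_intg_bounded] needs such a constant to
    integrate V along the iterates. *)
Let V1_le x : Ex mu (fun t => `|V x t|) <= 1 + D.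
Proof.
have [_ iV3 le_D] := moment3 x.
apply: (@le_trans _ _ (Ex mu (fun t => 1 + `|V x t| ^+ 3))).
  apply: Ex_le => [||t]; [exact: V1|by apply: intgD => //; exact: intg_cst|].
  have := normr_ge0 (V x t); move: (`|V x t|) => a a0; have [a1|a1] := leP a 1; last by nra.
  by rewrite (le_trans a1)// lerDl exprn_ge0.
rewrite ExD ?Ex_cst//; last exact: intg_cst.
rewrite lerD2l (le_trans _ le_D)// lerDl; apply: Ex_ge0 => w; exact: exprn_ge0.
Qed.

Lemma sgd_intg k : intg P (fun w => `|phi k w|).
Proof.
have [p0 pS] := phi_sgd; elim: k => [|k ih].
  by apply: eq_intg (intg_cst P `|phi0|) => w; rewrite p0.
have mV1 x : measurable_fun setT (fun t => `|V x t|) := mfH_norm0 (mV x).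
have iV : intg P (fun w => `|V (phi k w) (gam k w)|).
  have [] // := block_intg_bounded gam_indep (@beforeT k) (@oneT k) (@before_one k)
    (f := fun w1 w2 => `|V (phi k w1) (gam k w2)|) (M := 1 + D).
  - apply: (mfH_norm0 (X := fun p : T1 k * T2 k => V (phi k p.1) (gam k p.2))).
    exact: (mVX (@m_fst k) (@m_snd k)).
  - by apply: mfH_norm0; apply: (mVX (sgd_mfH k)).
  - by move=> w; have [] := law_intg (@gam_law k) (mV1 (phi k w)) (V1 (phi k w)).
  by move=> w; have [_ ->] := law_intg (@gam_law k) (mV1 (phi k w)) (V1 (phi k w)).
have j : intg P (fun w => `|phi k w| + eta * (`|b 0| + fine (supD1 b) * `|phi k w|)
    + eta * `|V (phi k w) (gam k w)|).
  apply: intgD; last exact: intgZ.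
  by apply: intgD => //; apply: intgZ; apply: intgD; [exact: intg_cst|exact: intgZ].
apply: (intg_dom (mfH_norm0 (sgd_mfH k.+1)) j) => w.
rewrite normr_id pS (le_trans (ler_normD _ _))// lerD//; last by rewrite normrZ gtr0_norm.
rewrite (le_trans (ler_normD _ _))// lerD2l normrZ gtr0_norm// ler_wpM2l ?(ltW eta0)//.
exact: affine_growth.
Qed.

Lemma sgd_step (u : H -> R) (C : R) k : (forall x y, `|u x - u y| <= C * `|x - y|) ->
  intg P (fun w => sgd_avg u (phi k w)) /\
  Ex P (fun w => u (phi k.+1 w)) = Ex P (fun w => sgd_avg u (phi k w)).
Proof.
have [p0 pS] := phi_sgd; move=> uC; have uc : continuous u by exact: lipschitz_cvg uC.
pose f w1 w2 := u (phi k w1 + eta *: b (phi k w1) + eta *: V (phi k w1) (gam k w2)).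
have mf : measurable_fun setT (fun p : T1 k * T2 k => f p.1 p.2).
  exact: (mfH_continuous (m_step (@m_fst k) (@m_snd k)) uc).
have ix x : measurable_fun setT (fun t => u (x + eta *: b x + eta *: V x t)) /\
    intg mu (fun t => u (x + eta *: b x + eta *: V x t)).
  have ms : mfH (fun t => x + eta *: b x + eta *: V x t).
    by apply: (mfHD H_sep); [exact: mfH_cst|apply: (mfHZ H_sep)].
  split; first exact: (mfH_continuous ms uc).
  apply: (lipschitz_intg ms uC).
  apply: (intg_dom (mfH_norm0 ms) (intgD (intg_cst mu `|x + eta *: b x|) (intgZ eta (V1 x)))) => t.
  by rewrite normr_id (le_trans (ler_normD _ _))// lerD2l normrZ gtr0_norm.
have if1 w : intg P (f w).
  by have [m i] := ix (phi k w); have [] := law_intg (@gam_law k) m i.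
have ifd : intg P (fun w => f w w).
  apply: (eq_intg (g := fun w => u (phi k.+1 w))); first by move=> w; rewrite /f -pS.
  by apply: (lipschitz_intg (sgd_mfH k.+1) uC); exact: sgd_intg.
have [i E] := block_fubini gam_indep (@beforeT k) (@oneT k) (@before_one k) mf if1 ifd.
have Ef w : Ex P (f w) = sgd_avg u (phi k w).
  by have [m j] := ix (phi k w); have [_ ->] := law_intg (@gam_law k) m j.
split; first by apply: eq_intg i => w; rewrite Ef.
rewrite -(eq_Ex P Ef) -E; apply: eq_Ex => w; by rewrite /f pS.
Qed.

Definition tail_mean N k : R := Ex P (fun w => Num.sqrt (tail N (phi k w))).

Let sigma_norm_cont : continuous (fun x => `|sigma x|).
Proof.
move=> x; apply: (@continuous_comp _ _ _ sigma (fun A : {hs e -> H} => `|A|)).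
  exact: bounded_derivatives_continuous.
exact: norm_continuous.
Qed.

Let m_tail N k : measurable_fun setT (fun w => Num.sqrt (tail N (phi k w))).
Proof.
have mp := sgd_mfH k.
apply: measurableT_comp => //; first by apply: continuous_measurable_fun; exact: sqrt_continuous.
apply: measurable_funB.
  by apply: measurable_funX; exact: (mfH_continuous mp sigma_norm_cont).
under eq_fun do rewrite big_mkcond/=.
apply: measurable_sum => i; case: (boolP (idx i)) => // ii.
apply: measurable_funX; apply: mfH_norm0.
by apply: (mfH_comp H_sep mp (h := fun x => sigma x (l2vec e i))); exact: hs_coord_continuous.
Qed.

Let i_dom k : intg P (fun w => `|sigma 0| + S * `|phi k w|).
Proof. by apply: intgD; [exact: intg_cst|apply: intgZ; exact: sgd_intg]. Qed.

Let tail_dom N k w : `|Num.sqrt (tail N (phi k w))| <= `|sigma 0| + S * `|phi k w|.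
Proof.
rewrite ger0_norm ?sqrtr_ge0// (le_trans (sqrt_tail_le _ _))//; exact: affine_growth.
Qed.

Let i_tail N k : intg P (fun w => Num.sqrt (tail N (phi k w))).
Proof. exact: (intg_dom (m_tail N k) (i_dom k) (tail_dom N k)). Qed.

(** Tails tend to 0 at every point; as sigma has linear growth, the first moment of the SGD chain
    provides the domination. *)
Lemma tail_mean_cvg k : tail_mean N k @[N --> \oo] --> (0 : R).
Proof.
rewrite -[X in _ --> X](Ex_cst P 0).
apply: (Ex_dominated_cvg (g := fun w => `|sigma 0| + S * `|phi k w|)) => //.
move=> w; rewrite -[X in _ --> X](sqrtr0 R).
apply: continuous_cvg; first exact: sqrt_continuous.
rewrite -(subrr (`|sigma (phi k w)| ^+ 2)); apply: cvgB; first exact: cvg_cst.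
exact: hs_partial_cvg.
Qed.

Variable g : H -> R.
Hypotheses (g_bd : bounded_derivatives3 g) (Db0 : 0 < fine (supD1 b)).
Local Notation flow := (flow xi b sigma g eta).
Let K1 n := bound1 eta (fine (supD1 b)) (J1 b sigma) (fine (supD1 g)) n.
Let K3 n := bound3 eta (fine (supD1 b)) (J1 b sigma) (J2 b sigma) (J3 b sigma)
  (fine (supD1 g)) (fine (supD2 g)) (fine (supD3 g)) n.

Let Bj1 : fine (supD1 b) <= J1 b sigma.
Proof.
by rewrite /J1 -[leLHS]ger0_norm ?(ltW Db0)// -sqrtr_sqr ler_wsqrtr// lerDl sqr_ge0.
Qed.

Let K1_ge0 n : 0 <= K1 n.
Proof. by have [d10 _ _] := supD_ge0 g_bd; exact: bound1_ge0. Qed.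
Let K3_ge0 n : 0 <= K3 n.
Proof.
have [d10 d20 d30] := supD_ge0 g_bd.
by apply: bound3_ge0 => //; exact: sqrtr_ge0.
Qed.

Let K1_mono m n : (m <= n)%N -> K1 m <= K1 n.
Proof.
have [d10 _ _] := supD_ge0 g_bd => mn.
by rewrite /K1 /bound1 ler_wpM2l// ler_weXn2l// growth1_ge1.
Qed.

(** After step i the function still to be evaluated is [flow N (k - i.+1)], whose third bound
    multiplies D. The truncation terms need only a factor independent of N, hence the common
    [K1 k]. *)
Lemma weak_error_telescope N k j : (j <= k)%N ->
  `|Ex P (fun w => flow N (k - j) (phi j w)) - flow N k phi0| <=
  eta ^+ 3 / 6 * D * \sum_(i < j) K3 (k - i.+1) + K1 k * eta * \sum_(i < j) tail_mean N i.
Proof.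
have [p0 pS] := phi_sgd; elim: j => [|j ih] jk.
  rewrite subn0 !big_ord0 !mulr0 addr0.
  rewrite (eq_Ex P (g := fun=> flow N k phi0)); last by move=> w; rewrite p0.
  by rewrite Ex_cst subrr normr0.
set m := (k - j.+1)%N; have mE : (k - j = m.+1)%N by rewrite subnSK.
have [u1 [u2 [C [[uC C0] uK1 _ uK3]]]] := flow_C21 H_sep xi_iid b_bd sigma_bd g_bd Db0 eta0 N m.
have [v1 [v2 [C' [[vC _] _ _ _]]]] := flow_C21 H_sep xi_iid b_bd sigma_bd g_bd Db0 eta0 N m.+1.
have {}ih := ih (ltnW jk); rewrite mE in ih.
have [ia Ea] := sgd_step j (C21_dist0 uC).
have iv : intg P (fun w => flow N m.+1 (phi j w)).
  by apply: (lipschitz_intg (sgd_mfH j) (C21_dist0 vC)); exact: sgd_intg.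
have diff : `|Ex P (fun w => flow N m (phi j.+1 w)) - Ex P (fun w => flow N m.+1 (phi j w))| <=
    eta ^+ 3 / 6 * D * K3 m + K1 k * eta * tail_mean N j.
  rewrite Ea -ExB// (le_trans (Ex_norm (intgB ia iv)))//.
  have it := intgD (intg_cst P (eta ^+ 3 / 6 * D * K3 m)) (intgZ (K1 k * eta) (i_tail N j)).
  rewrite -(ExZ _ (i_tail N j)) -[eta ^+ 3 / 6 * D * K3 m](Ex_cst P) -ExD; [|exact: intg_cst|exact: intgZ (i_tail N j)].
  apply: Ex_le => [||w]; [exact: (intg_norm (intgB ia iv))|exact: it|].
  have h : `|sgd_avg (flow N m) (phi j w) - flow N m.+1 (phi j w)| <= _ := one_step uC (K1_ge0 m) (K3_ge0 m) uK1 uK3 (phi j w) N.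
  apply: (le_trans h).
  apply: lerD; first by rewrite le_eqVlt; apply/orP; left; apply/eqP; ring.
  rewrite ler_wpM2r ?sqrtr_ge0// ler_wpM2r ?(ltW eta0)//; apply: K1_mono; exact: leq_subr.
rewrite !big_ord_recr/= -/m (mulrDr (eta ^+ 3 / 6 * D)) (mulrDr (K1 k * eta)).
have -> : Ex P (fun w => flow N m (phi j.+1 w)) - flow N k phi0 =
  (Ex P (fun w => flow N m (phi j.+1 w)) - Ex P (fun w => flow N m.+1 (phi j w)))
  + (Ex P (fun w => flow N m.+1 (phi j w)) - flow N k phi0) by ring.
apply: (le_trans (ler_normD _ _)); apply: (le_trans (lerD diff ih)).
by rewrite le_eqVlt; apply/orP; left; apply/eqP; ring.
Qed.

End Chain.
End Comparison.

(** * The theorem *)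

Section Constant.
Context dG (Gamma : measurableType dG) (R : realType) (mu : probability Gamma R)
  (e : l2basis mu) (H : hilbertType R).
Variables (g : H -> R) (b : H -> H) (sigma : H -> {hs e -> H}).
Hypotheses (g_bd : bounded_derivatives3 g) (b_bd : bounded_derivatives3 b)
  (sigma_bd : bounded_derivatives3 sigma) (Db0 : 0 < fine (supD1 b)).

Let B := fine (supD1 b).
Let K3 eta n := bound3 eta B (J1 b sigma) (J2 b sigma) (J3 b sigma)
  (fine (supD1 g)) (fine (supD2 g)) (fine (supD3 g)) n.

Let J2_ge0 : 0 <= J2 b sigma. Proof. exact: sqrtr_ge0. Qed.
Let J3_ge0 : 0 <= J3 b sigma. Proof. exact: sqrtr_ge0. Qed.
Let b0 : 0 <= fine (supD1 b). Proof. exact: ltW. Qed.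

Let J1_ge : B <= J1 b sigma.
Proof.
by rewrite /J1 -[leLHS]ger0_norm// -sqrtr_sqr ler_wsqrtr// lerDl sqr_ge0.
Qed.

Lemma A2_ge0 eta : 0 <= A2 g b sigma eta.
Proof. by have [d1 d2 d3] := supD_ge0 g_bd; rewrite /A2; nonneg. Qed.

Lemma A3_ge0 eta : 0 <= A3 g b sigma eta.
Proof. by have [d1 d2 d3] := supD_ge0 g_bd; rewrite /A3; nonneg. Qed.

Lemma A1_le eta eta' : 0 <= eta -> eta <= eta' -> A1 g b sigma eta <= A1 g b sigma eta'.
Proof.
move=> eta0 le; have [d1 d2 d3] := supD_ge0 g_bd.
have c : Num.sqrt (C1 b sigma eta) <= Num.sqrt (C1 b sigma eta').
  rewrite ler_wsqrtr// /C1; apply: lerD.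
    by rewrite lerD2l ler_wpM2r// ler_wpM2l.
  rewrite ler_wpM2r ?sqr_ge0// lerXn2r ?nnegrE//; exact: le_trans le.
rewrite /A1 /A2 /A3; apply: lerD; first apply: lerD => //.
  apply: ler_wpM2l; first by nonneg.
  apply: ler_wpM2r; first by nonneg.
  by apply: ler_wpM2l.
apply: ler_wpM2l; first by nonneg.
rewrite lerD2r; apply: ler_wpM2r; first by nonneg.
by apply: ler_wpM2l; nonneg.
Qed.

(** The Taylor factor 1/6 absorbs the 6 of [bound3_le], one factor eta is spent on the geometric
    sum, and eta^2 remains. As k eta <= T and the quantities increase with eta, the exponent and A_1
    may be evaluated at T and [etabar]. *)
Lemma Cgbsigma_bound eta etabar T k : 0 < eta -> eta <= etabar -> k%:R * eta <= T ->
  eta ^+ 3 / 6 * \sum_(i < k) K3 eta (k - i.+1) <= eta ^+ 2 * Cgbsigma g b sigma T etabar.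
Proof.
move=> eta0 le kT; have [d1 d2 d3] := supD_ge0 g_bd.
have ee := ltW eta0; have eb := le_trans ee le.
have T0 : 0 <= T by apply: le_trans kT; rewrite mulr_ge0.
set al := growth3 eta B (J1 b sigma).
have al1 : 1 <= al by exact: growth3_ge1.
have rev : \sum_(i < k) K3 eta (k - i.+1) = \sum_(i < k) K3 eta i.
  by rewrite [RHS](reindex_inj rev_ord_inj).
have s1 : \sum_(i < k) K3 eta i <= \sum_(i < k) (6 * A1 g b sigma eta) * al ^+ i.
  by apply: ler_sum => i _; exact: bound3_le.
have A1p : 0 <= A1 g b sigma eta.
  by rewrite /A1 !addr_ge0 ?A2_ge0 ?A3_ge0.
have s2 : eta * \sum_(i < k) al ^+ i <= (al ^+ k - 1) / (4 * B).
  rewrite ler_pdivlMr ?mulr_gt0//.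
  rewrite (_ : _ * (4 * B) = 4 * eta * B * \sum_(i < k) al ^+ i); last by ring.
  exact: growth3_sum.
have exp_le (x y : R) : x <= y -> expR x <= expR y by rewrite ler_expR.
have s3 : al ^+ k - 1 <= expR (T * (4 * B + 6 * etabar * J1 b sigma ^+ 2)) - 1.
  rewrite lerD2r /al /growth3 -expRM_natl; apply: exp_le.
  rewrite mulrA; apply: ler_pM => //; [by rewrite mulr_ge0|by nonneg|].
  by rewrite lerD2l ler_wpM2r ?sqr_ge0// ler_wpM2l.
have e1 (x : R) : 0 <= x -> 0 <= expR x - 1.
  by move=> x0; rewrite subr_ge0 -expR0; exact: exp_le.
rewrite rev (_ : eta ^+ 3 / 6 * _ = eta ^+ 2 * (eta * (\sum_(i < k) K3 eta i / 6))); last first.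
  by rewrite -mulr_suml; field.
rewrite ler_wpM2l ?sqr_ge0//.
apply: (@le_trans _ _ (A1 g b sigma etabar * ((expR (T * (4 * B + 6 * etabar * J1 b sigma ^+ 2)) - 1) / (4 * B)))).
  apply: (@le_trans _ _ (A1 g b sigma eta * (eta * \sum_(i < k) al ^+ i))).
    rewrite mulrCA ler_wpM2l// -mulr_suml ler_pdivrMr// (le_trans s1)// -mulr_sumr.
    by rewrite le_eqVlt; apply/orP; left; apply/eqP; ring.
  apply: ler_pM => //; [|exact: A1_le|].
    by rewrite mulr_ge0//; apply: sumr_ge0 => i _; rewrite exprn_ge0// (le_trans ler01).
  by apply: (le_trans s2); rewrite ler_wpM2r// invr_ge0 mulr_ge0.
rewrite /Cgbsigma -/B -addrA lerDl; apply: addr_ge0; apply: mulr_ge0; rewrite ?A2_ge0 ?A3_ge0//;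
  apply: mulr_ge0; rewrite ?invr_ge0 ?mulr_ge0//; apply: e1; nonneg.
Qed.

End Constant.

Theorem theorem4p5 (R : realType) (H : hilbertType R)
  (H_separable : separable_space H)
  (* the law mu of gamma *)
  (dG : measure_display) (Gamma : measurableType dG) (mu : probability Gamma R)
  (Fgam : Gamma -> H -> R) (gradFgam : Gamma -> H -> H)
  (F : H -> R) (gradF : H -> H)
  (Fgam_grad : forall w phi, is_gradient (Fgam w) phi (gradFgam w phi))
  (Fgam_integrable : forall phi,
     mu.-integrable setT (fun w => (Fgam w phi)%:E))
  (F_mean : forall phi, F phi = \int[mu]_w Fgam w phi)
  (F_grad : forall phi, is_gradient F phi (gradF phi))
  (gradF_mean : forall phi,
     bochner_mean mu (fun w => gradFgam w phi) (gradF phi))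
  (gradF_sqr : forall phi,
     (\int[mu]_w (`|gradFgam w phi| ^+ 2)%:E < +oo)%E)
  (b : H -> H) (b_def : b = fun phi => - gradF phi)
  (V : H -> Gamma -> H) (V_def : V = fun phi w => gradF phi - gradFgam w phi)
  (e : l2basis mu) (sigma : H -> {hs e -> H})
  (sigma_def : forall phi (u : L2 mu),
     bochner_mean mu (fun w => u w *: V phi w) (sigma phi u))
  (dO : measure_display) (Omega : measurableType dO) (P : probability Omega R)
  (gam : nat -> {RV P >-> Gamma})
  (gam_iid : iid predT gam mu)
  (xi : nat -> nat -> {RV P >-> R})
  (xi_iid : iid (I := (nat * nat)%type) [pred p | l2idx e p.2]
     (fun p => xi p.1 p.2) (normal_prob 0 1))
  (sigmaW : H -> Omega -> H)
  (sigmaW_def : forall phi,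
     is_noise P (fun i => xi 0%N i) (fun=> sigma phi) (sigmaW phi))
  (T : R) (T_gt0 : 0 < T)
  (g : H -> R) (g_bounded : bounded_derivatives3 g)
  (b_bounded : bounded_derivatives3 b)
  (sigma_bounded : bounded_derivatives3 sigma)
  (Db_gt0 : (0 < supD1 b)%E)
  (D_fin : (third_moment P sigmaW V (gam 0%N) < +oo)%E)
  (phi0 : H) :
  forall etabar : R, 0 <= etabar ->
  forall eta : R, 0 < eta <= etabar ->
  forall phi phit : nat -> Omega -> H,
    sgd_iterates eta b V (fun n => gam n) phi0 phi ->
    gaussian_iterates P eta b sigma (fun n i => xi n i) phi0 phit ->
  forall k : nat, (k%:Z <= Num.floor (T / eta))%R ->
    (`| \int[P]_w (g (phit k w) - g (phi k w))%:E | <=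
     (eta ^+ 2 * fine (third_moment P sigmaW V (gam 0%N))
        * Cgbsigma g b sigma T etabar)%:E)%E.
Proof.
move=> etabar _ eta /andP[eta0 le_eta] phi phit sgd gauss k kT.
have Fgam_meas x : measurable_fun setT (Fgam ^~ x) := intg_meas (Fgam_integrable x).
have Db0 : 0 < fine (supD1 b).
  by have [_ _ _ [s1 _ _]] := b_bounded; rewrite fine_gt0// Db_gt0.
have kT' : k%:R * eta <= T.
  by rewrite -ler_pdivlMr//; move: kT; rewrite floor_ge_int.
have [mphit iphit cphit] := gaussian_limit H_separable xi_iid b_bounded sigma_bounded eta0 gauss k.
have mphi := sgd_mfH H_separable Fgam_grad Fgam_meas b_def V_def b_bounded sgd k.
have iphi := sgd_intg H_separable Fgam_grad Fgam_meas gradF_mean gradF_sqr b_def V_def gam_iid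
  sigmaW_def b_bounded D_fin eta0 sgd k.
have gL := bounded_derivatives_dist g_bounded; set Dg := fine (supD1 g) in gL.
have Dg0 : 0 <= Dg by have [] := supD_ge0 g_bounded.
have ig : intg P (fun w => g (phi k w)) by exact: (lipschitz_intg mphi gL).
have igt : intg P (fun w => g (phit k w)).
  by apply: (lipschitz_intg mphit gL); exact: (intg_sqr (mfH_norm0 mphit)).
rewrite (integralE_Ex (intgB igt ig)) ExB// abse_EFin lee_fin.
pose chain := tchain xi b sigma eta phi0.
have mchain N : mfH (chain N k) := tchain_mfH H_separable xi eta b_bounded sigma_bounded phi0 N k.
have chain2 N : intg P (fun w => `|chain N k w| ^+ 2) :=
  tchain_sqr H_separable xi_iid b_bounded sigma_bounded eta0 phi0 N k.
have igc N : intg P (fun w => g (chain N k w)).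
  by apply: (lipschitz_intg (mchain N) gL); exact: (intg_sqr (mfH_norm0 (mchain N))).
(* The truncated chain is a Markov chain for the operator of [flow]; m = 0 and j = k identify
   [flow N k phi0] with the mean of [g] along it. *)
have flow_chain N m j : Ex P (fun w => flow xi b sigma g eta N m (chain N j w)) =
    flow xi b sigma g eta N (m + j) phi0.
  elim: j m => [|j ih] m; first by rewrite addn0; exact: (Ex_cst P (flow xi b sigma g eta N m phi0)).
  have [u1 [u2 [C [[uC _] _ _ _]]]] :=
    flow_C21 H_separable xi_iid b_bounded sigma_bounded g_bounded Db0 eta0 N m.
  rewrite addnS -addSn -ih.
  exact: (tchain_step H_separable xi_iid b_bounded sigma_bounded eta0 phi0 N j (C21_dist0 uC)).
(* [tot N] gathers all that depends on N: the distance from the Gaussian iterate to the truncated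
   chain, and the discarded noise in the telescoping sum. *)
pose tot N := Dg * Num.sqrt (Ex P (fun w => `|phit k w - chain N k w| ^+ 2)) +
  bound1 eta (fine (supD1 b)) (J1 b sigma) Dg k * eta * \sum_(i < k) tail_mean sigma P phi N i.
set M := eta ^+ 2 * _ * _.
have bound N : `|Ex P (fun w => g (phit k w)) - Ex P (fun w => g (phi k w))| <= M + tot N.
  have -> : Ex P (fun w => g (phit k w)) - Ex P (fun w => g (phi k w)) =
    (Ex P (fun w => g (phit k w)) - Ex P (fun w => g (chain N k w))) -
    (Ex P (fun w => g (phi k w)) - Ex P (fun w => g (chain N k w))) by ring.
  apply: (le_trans (ler_normB _ _)).
  have [i2 _] := intg_sqrB H_separable mphit (mchain N) iphit (chain2 N).
  have mr := mfHB H_separable mphit (mchain N).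
  have i1 := intg_sqr (mfH_norm0 mr) i2.
  have h1 : `|Ex P (fun w => g (phit k w)) - Ex P (fun w => g (chain N k w))| <=
      Dg * Num.sqrt (Ex P (fun w => `|phit k w - chain N k w| ^+ 2)).
    rewrite -ExB// (le_trans (Ex_norm (intgB igt (igc N))))//.
    apply: (@le_trans _ _ (Ex P (fun w => Dg * `|phit k w - chain N k w|))).
      by apply: Ex_le => [||w]; [exact: (intg_norm (intgB igt (igc N)))|exact: intgZ|exact: gL].
    rewrite ExZ// ler_wpM2l//; apply: (Ex_le_sqrt (mfH_norm0 mr) i2); first exact: sqrtr_ge0.
    by rewrite sqr_sqrtr//; apply: Ex_ge0 => w; exact: sqr_ge0.
  have := weak_error_telescope H_separable Fgam_grad Fgam_meas gradF_mean gradF_sqr b_def V_def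
    sigma_def gam_iid xi_iid sigmaW_def b_bounded sigma_bounded D_fin eta0 sgd g_bounded Db0 N (leqnn k).
  have := flow_chain N 0%N k; rewrite add0n subnn => <- h2.
  apply: (le_trans (lerD h1 h2)).
  rewrite /tot [leRHS]addrCA lerD2l lerD2r.
  have := Cgbsigma_bound sigma g_bounded Db0 eta0 le_eta kT'.
  rewrite /M => h3.
  have D0 : 0 <= fine (third_moment P sigmaW V (gam 0%N)).
    by apply: fine_ge0; apply: (@le_trans _ _ (\int[P]_w (`|sigmaW phi0 w| ^+ 3 + `|V phi0 (gam 0%N w)| ^+ 3)%:E)%E);
      [apply: integral_ge0 => w _; rewrite lee_fin addr_ge0|apply: ereal_sup_ubound; exists phi0].
  have := ler_wpM2l D0 h3; rewrite !(mulrCA (fine _)) !mulrA; lra.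
have lim : M + tot N @[N --> \oo] --> M.
  rewrite -[X in _ --> X](addr0 M); apply: cvgD; first exact: cvg_cst.
  rewrite -[X in _ --> X](addr0 0); apply: cvgD.
    rewrite -(mulr0 Dg) -(sqrtr0 R); apply: cvgMr.
    by apply: continuous_cvg => //; exact: sqrt_continuous.
  rewrite -[X in _ --> X](mulr0 (bound1 eta (fine (supD1 b)) (J1 b sigma) Dg k * eta)); apply: cvgMr.
  elim: (k) => [|j ih].
    have -> : (fun N => \sum_(i < 0) tail_mean sigma P phi N i) = fun=> (0 : R).
      by apply/funext => N; rewrite big_ord0.
    exact: cvg_cst.
  have -> : (fun N => \sum_(i < j.+1) tail_mean sigma P phi N i) =
      fun N => \sum_(i < j) tail_mean sigma P phi N i + tail_mean sigma P phi N j.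
    by apply/funext => N; rewrite big_ord_recr.
  rewrite -[X in _ --> X](addr0 0); apply: cvgD => //.
  exact: (tail_mean_cvg H_separable Fgam_grad Fgam_meas gradF_mean gradF_sqr b_def V_def gam_iid
    sigmaW_def b_bounded sigma_bounded D_fin eta0 sgd j).
(* The weak error itself does not depend on N, so it is at most the limit of the bounds. *)
rewrite -(cvg_lim _ lim)//; apply: limr_ge; first by apply/cvg_ex; exists M.
by apply: nearW => N; exact: bound.
Qed.
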